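(* Let $\mu,\nu$ be Lipschitz continuous probability densities on $\mathbb D$ with respect to the hyperbolic area measure, and let $\mathcal M,\mathcal N$ be the disk-type surfaces $(\mathbb D,g)$, $(\mathbb D,h)$ with $g=\mu(z)(1-|z|^2)^{-2}\delta_{ij}dx^i\otimes dx^j$ and $h=\nu(w)(1-|w|^2)^{-2}\delta_{ij}dy^i\otimes dy^j$. Fix $R>0$, finite sample sets $Z=\{z_i\}_{i=1}^n$, $W=\{w_j\}_{j=1}^p\subset\mathbb D$, quadrature centers $\{p_k\}\subset\Omega_{0,R}$ and an integer $L\ge1$. Let $\pi^*$ be a minimizer of the linear program defining $T_{\hat{\hat d}}(\mu_Z,\nu_W)$. Then $$\Big|\mathbf d^R(\mathcal M,\mathcal N)-T_{\hat{\hat d}}(\mu_Z,\nu_W)\Big|\le \omega_{d^R_{\mu,\nu}}\big(2\max(\varphi_g(Z),\varphi_h(W))\big)+C_1\varphi_E(\{p_k\})+C_2L^{-1},$$ where $C_1,C_2$ are constants depending only on $\mu,\nu,R$.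
   Context: $\mathbb D=\{z\in\mathbb C:|z|<1\}$, with hyperbolic area element $d\mathrm{vol}_H(z)=(1-|z|^2)^{-2}dx^1\wedge dx^2$ ($z=x^1+ix^2$). $M_{\mathbb D}$ is the group of Möbius self-maps of $\mathbb D$, $m(z)=e^{i\theta}\frac{z-a}{1-\bar a z}$, $a\in\mathbb D$, $\theta\in[0,2\pi)$. The hyperbolic disk of radius $R$ about $z_0$ is $\Omega_{z_0,R}=m^{-1}(\Omega_{0,R})$ with $\Omega_{0,R}=\{|z|\le\tanh R\}$ and $m(z)=(z-z_0)/(1-\bar z_0z)$. The cost function is $$d^R_{\mu,\nu}(z_0,w_0)=\inf_{m\in M_{\mathbb D},\,m(z_0)=w_0}\int_{\Omega_{z_0,R}}|\mu(z)-\nu(m(z))|\,d\mathrm{vol}_H(z).$$ $\Pi(\mu,\nu)$ is the set of probability measures on $\mathbb D\times\mathbb D$ with marginals $\mu\,d\mathrm{vol}_H$ and $\nu\,d\mathrm{vol}_H$, and $\mathbf d^R(\mathcal M,\mathcal N)=\inf_{\pi\in\Pi(\mu,\nu)}\int d^R_{\mu,\nu}\,d\pi$. $d_g,d_h$ denote geodesic distances of $g,h$; the fill distance is $\varphi_g(Z)=\sup\{r>0:\exists z,\ B_g(z,r)\cap Z=\emptyset\}$, $B_g$ the open geodesic ball (similarly $\varphi_h(W)$). Let $\{\Xi_i\}$ be Voronoi cells of $Z$ w.r.t. $d_g$ (a partition of $\mathbb D$ with $\{x:d_g(x,z_i)<\min_{j\neq i}d_g(x,z_j)\}\subset\Xi_i\subset\{x:d_g(x,z_i)\le\min_{j\ne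 i}d_g(x,z_j)\}$), $\mu_i=\int_{\Xi_i}\mu\,d\mathrm{vol}_H$, $\mu_Z=\sum_i\mu_i\delta_{z_i}$; similarly $\Upsilon_j,\nu_j,\nu_W$ for $W$ and $d_h$. Quadrature: $\alpha_k$ is the hyperbolic area of $\Delta_k=\Omega_{0,R}\cap(\text{Euclidean Voronoi cell of }p_k)$, and $\varphi_E(\{p_k\})$ is the Euclidean fill distance of $\{p_k\}$ in $\Omega_{0,R}$. Fix $\tilde m_i,\tilde m_j\in M_{\mathbb D}$ with $\tilde m_i(0)=z_i$, $\tilde m_j(0)=w_j$, set $m_{z_i,w_j,2\pi\ell/L}=\tilde m_j\circ\mathfrak R_\ell\circ\tilde m_i^{-1}$ with $\mathfrak R_\ell(z)=e^{2\pi i\ell/L}z$, and $$\hat{\hat d}_{ij}=\min_{\ell=1,\dots,L}\sum_k\alpha_k\,|\mu(\tilde m_i(p_k))-\nu(m_{z_i,w_j,2\pi\ell/L}(\tilde m_i(p_k)))|.$$ $T_{\hat{\hat d}}(\mu_Z,\nu_W)=\min\{\sum_{i,j}\hat{\hat d}_{ij}\pi_{ij}:\pi_{ij}\ge0,\ \sum_i\pi_{ij}=\nu_j,\ \sum_j\pi_{ij}=\mu_i\}$. The modulus of continuity is $\omega_{d^R_{\mu,\nu}}(t)=\sup_{d_g(z,z')+d_h(w,w')<t}|d^R_{\mu,\nu}(z,w)-d^R_{\mu,\nu}(z',w')|$. The surfaces are assumed to have unit area, and $(\mathbb D,d_g),(\mathbb D,d_h)$ are treated as compact metric spaces (compact surfaces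 with boundary). *)

(* Defs.v *)
(* Points of the plane are pairs (x1, x2) : R * R,
   with complex arithmetic written out by hand (c* operations below). *)
From HB Require Import structures.
From mathcomp Require Import all_boot all_order all_algebra.
From mathcomp Require Import all_classical all_reals all_analysis.
Set Implicit Arguments. Unset Strict Implicit. Unset Printing Implicit Defensive.
Import Order.TTheory GRing.Theory Num.Theory.
Import numFieldNormedType.Exports.
Local Open Scope classical_set_scope.
Local Open Scope ring_scope.

Section Defs.
Context {R : realType}.
Notation P := (R * R)%type.

Definition cadd (a b : P) : P := (a.1 + b.1, a.2 + b.2).
Definition csub (a b : P) : P := (a.1 - b.1, a.2 - b.2).
Definition cmul (a b : P) : P := (a.1 * b.1 - a.2 * b.2, a.1 * b.2 + a.2 * b.1).
Definition cconj (a : P) : P := (a.1, - a.2).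
Definition cinv (a : P) : P :=
  (a.1 / (a.1 ^+ 2 + a.2 ^+ 2), - a.2 / (a.1 ^+ 2 + a.2 ^+ 2)).
Definition cdiv (a b : P) : P := cmul a (cinv b).
Definition cone : P := (1, 0).
Definition origin : P := (0, 0).
Definition cexpi (t : R) : P := (cos t, sin t).
Definition cabs (a : P) : R := Num.sqrt (a.1 ^+ 2 + a.2 ^+ 2).

Definition disk : set P := [set z | cabs z < 1].

Definition mob (a : P) (theta : R) (z : P) : P :=
  cmul (cexpi theta) (cdiv (csub z a) (csub cone (cmul (cconj a) z))).
Definition mob_inv (a : P) (theta : R) (w : P) : P :=
  let u := cmul (cexpi (- theta)) w in
  cdiv (cadd u a) (cadd cone (cmul (cconj a) u)).

Definition MobD : set (P -> P) :=
  [set m | exists a theta, disk a /\ 0 <= theta < 2 * pi /\ m = mob a theta].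

Definition leb2 := (@lebesgue_measure R \x @lebesgue_measure R)%E.
(* density of dvol_H with respect to Lebesgue measure: (1 - |z|^2)^{-2} *)
Definition hden (z : P) : R := ((1 - cabs z ^+ 2) ^+ 2)^-1.
(* \int_A f dvol_H, for A a subset of D *)
Definition hint (A : set P) (f : P -> R) : \bar R :=
  (\int[leb2]_(x in A) (f x * hden x)%:E)%E.

Definition tanh (r : R) : R := (expR r - expR (- r)) / (expR r + expR (- r)).

Definition Omega0 (r : R) : set P := [set z | cabs z <= tanh r].
Definition Omega (z0 : P) (r : R) : set P :=
  [set z | disk z /\ Omega0 r (mob z0 0 z)].

Definition dR (mu nu : P -> R) (r : R) (z0 w0 : P) : \bar R :=
  ereal_inf [set hint (Omega z0 r) (fun z => `|mu z - nu (m z)|)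
            | m in [set m | MobD m /\ m z0 = w0]].

Definition couplings (mu nu : P -> R) : set (probability (P * P)%type R) :=
  [set pi | (forall A : set P, measurable A ->
                pi (A `*` setT) = hint (A `&` disk) mu) /\
            (forall B : set P, measurable B ->
                pi (setT `*` B) = hint (B `&` disk) nu)].

Definition dRMN (mu nu : P -> R) (r : R) : \bar R :=
  ereal_inf [set (\int[pi]_x dR mu nu r x.1 x.2)%E | pi in couplings mu nu].

(* C^1 curves gamma = (g1, g2) : [0,1] -> D from z to z' (given on all of R) *)
Definition C1curve (g1 g2 : R -> R) (z z' : P) : Prop :=
  (forall t, derivable g1 t 1) /\ (forall t, derivable g2 t 1) /\
  continuous (derive1 g1) /\ continuous (derive1 g2) /\
  (forall t, 0 <= t <= 1 -> disk (g1 t, g2 t)) /\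
  (g1 0, g2 0) = z /\ (g1 1, g2 1) = z'.

Definition glength (mu : P -> R) (g1 g2 : R -> R) : \bar R :=
  (\int[@lebesgue_measure R]_(t in `[0%R, 1%R])
     (Num.sqrt (mu (g1 t, g2 t)) * cabs ((derive1 g1) t, (derive1 g2) t)
       / (1 - cabs (g1 t, g2 t) ^+ 2))%:E)%E.

Definition geod (mu : P -> R) (z z' : P) : \bar R :=
  ereal_inf [set x | exists g1 g2, C1curve g1 g2 z z' /\ x = glength mu g1 g2].

Definition gball (mu : P -> R) (z : P) (r : R) : set P :=
  [set y | disk y /\ (geod mu z y < r%:E)%E].

Definition fill (mu : P -> R) (Z : set P) : \bar R :=
  ereal_sup [set r%:E | r in [set r | 0 < r /\
               exists z, disk z /\ gball mu z r `&` Z = set0]].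

Definition eball (z : P) (r : R) : set P := [set y | cabs (csub y z) < r].
Definition fillE (r0 : R) (Pts : set P) : \bar R :=
  ereal_sup [set r%:E | r in [set r | 0 < r /\
               exists z, Omega0 r0 z /\ eball z r `&` Pts = set0]].

Definition modcont (mu nu : P -> R) (r : R) (t : \bar R) : \bar R :=
  ereal_sup [set x | exists z w z' w', disk z /\ disk w /\ disk z' /\ disk w' /\
               (geod mu z z' + geod nu w w' < t)%E /\
               x = `|(dR mu nu r z w - dR mu nu r z' w')%E|%E].

Definition voronoi (n : nat) (mu : P -> R) (z : 'I_n -> P) (Xi : 'I_n -> set P)
  : Prop :=
  (\bigcup_(i in setT) Xi i = disk) /\
  (forall i j, i != j -> Xi i `&` Xi j = set0) /\
  (forall i x, disk x ->
     (forall j, j != i -> (geod mu x (z i) < geod mu x (z j))%E) -> Xi i x) /\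
  (forall i x, Xi i x -> forall j, j != i ->
     (geod mu x (z i) <= geod mu x (z j))%E).

Definition Delta (K : nat) (r : R) (p : 'I_K -> P) (k : 'I_K) : set P :=
  [set x | Omega0 r x /\ forall l, cabs (csub x (p k)) <= cabs (csub x (p l))].

Definition alpha (K : nat) (r : R) (p : 'I_K -> P) (k : 'I_K) : R :=
  fine (hint (Delta r p k) (fun _ => 1)).

Definition rot (L l : nat) : P -> P :=
  fun z => cmul (cexpi (2 * pi * l%:R / L%:R)) z.

(* hat-hat d_{ij}, where tilde m_i = mob ai ti (so tilde m_i^{-1} = mob_inv ai ti)
   and tilde m_j = mob bj sj *)
Definition dhh (mu nu : P -> R) (K : nat) (r : R) (p : 'I_K -> P) (L : nat)
  (ai : P) (ti : R) (bj : P) (sj : R) : R :=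
  let mi := mob ai ti in
  let mt l := fun z => mob bj sj (rot L l (mob_inv ai ti z)) in
  fine (\big[Order.min/+oo%E]_(1 <= l < L.+1)
          (\sum_(k < K) alpha r p k * `|mu (mi (p k)) - nu (mt l (mi (p k)))|)%:E).

Definition lp_feasible (n q : nat) (a : 'I_n -> R) (b : 'I_q -> R)
  (pi : 'I_n -> 'I_q -> R) : Prop :=
  (forall i j, 0 <= pi i j) /\
  (forall j, \sum_(i < n) pi i j = b j) /\
  (forall i, \sum_(j < q) pi i j = a i).

Definition lp_minimizer (n q : nat) (c : 'I_n -> 'I_q -> R) (a : 'I_n -> R)
  (b : 'I_q -> R) (pi : 'I_n -> 'I_q -> R) : Prop :=
  lp_feasible a b pi /\
  forall pi', lp_feasible a b pi' ->
    \sum_(i < n) \sum_(j < q) c i j * pi i j <=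
    \sum_(i < n) \sum_(j < q) c i j * pi' i j.

End Defs.

(* Main.v *)
From Pilot Require Import Defs.
From HB Require Import structures.
From mathcomp Require Import complex.
From mathcomp Require Import all_boot all_order all_algebra.
From mathcomp Require Import all_classical all_reals all_analysis.
From mathcomp Require Import measurable_realfun measurable_function.
From mathcomp Require Import ring lra.
Import Order.TTheory GRing.Theory Num.Theory.
Import numFieldNormedType.Exports.
Local Open Scope classical_set_scope.
Local Open Scope ring_scope.
Set Implicit Arguments. Unset Strict Implicit. Unset Printing Implicit Defensive.
Local Notation cadd := Pilot.Defs.cadd.

(* For any coupling pi, the masses pi(Xi_i x Upsilon_j) form a feasible matrix, and
   replacing d^R by its value at the centres (z_i, w_j) on each product cell changes
   the transport cost by at most the modulus of continuity; conversely a feasible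
   matrix (pi_ij) comes from the coupling with density pi_ij / (mu_i nu_j) on the
   cells.  It thus suffices to compare d^R(z_i, w_j) with the discretized cost.
   By Mobius invariance of the hyperbolic area, d^R(z_i, w_j) is the infimum over the
   rotations e^{i theta} of an integral over Omega_{0,R}, with an integrand that is
   Lipschitz uniformly in z_i and w_j; replacing theta by the grid costs O(1/L) and
   replacing the integral by the quadrature costs O(fill distance).

   Invariance of the area is proved in the coordinates X = 2z / (1 - |z|^2), where
   4 dvol_H = dX dY / T with T = sqrt(1 + X^2 + Y^2), and where the translation along
   the real axis becomes (X, Y) -> (c X + s T, Y): every change of variables needed
   alters one coordinate at a time, so Tonelli reduces it to dimension one. *)

(** * Complex arithmetic and Mobius maps *)

(** The coordinates $(X,Y)$ are the space coordinates on the hyperboloid $T^2-X^2-Y^2=1$. Mobius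
    maps of the disk act on it as Lorentz transformations, and $dX\,dY/T$ is its invariant measure;
    a general map is a rotation, a boost along one axis and a rotation. A rotation of small angle is
    in turn a product of two shears, and the chart itself splits into two changes of one coordinate.
    The constants do not see the sample points because a Mobius map, whatever its centre, stretches
    the disk of radius $\rho=\tanh R$ by at most $(1-\rho)^{-2}$. On the same disk translations
    depend on their centre in a Lipschitz way, so that $d^R$, an infimum over uncountably many maps,
    is Lipschitz and hence measurable. The modulus of continuity is a supremum over a strict
    inequality, whereas a point of a Voronoi cell is only within the closed fill distance of its
    centre. Removing the equality case means shortening a distance strictly by a small move; this is
    what the lower bounds on lengths of curves are for, and they rest on positivity of the
    densities. *)

Section Complex.
Context {R : realType}.
Notation P := (R * R)%type.
Implicit Types a b e u v z w : P.

(** Passing to the field of complex numbers makes [field], conjugation and the multiplicative norm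
    available for the pair arithmetic. *)
Definition toC z : complex.complex R := complex.Complex z.1 z.2.

Arguments toC : simpl never.
Local Arguments complex.conjc : simpl never.

Lemma toC_inj : injective toC.
Proof. by move=> [? ?] [? ?] [-> ->]. Qed.

Lemma toCD a b : toC (cadd a b) = toC a + toC b. Proof. by []. Qed.
Lemma toCB a b : toC (csub a b) = toC a - toC b. Proof. by []. Qed.
Lemma toCM a b : toC (cmul a b) = toC a * toC b. Proof. by []. Qed.
Lemma toCV a : toC (cinv a) = (toC a)^-1.
Proof. by rewrite /cinv /toC /= mulNr. Qed.
Lemma toCdiv a b : toC (cdiv a b) = toC a / toC b.
Proof. by rewrite toCM toCV. Qed.
Lemma toC1 : toC cone = 1. Proof. by []. Qed.
Lemma toC0 : toC origin = 0. Proof. by []. Qed.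
Lemma toC_conj a : toC (cconj a) = complex.conjc (toC a). Proof. by []. Qed.
Lemma toC_eq0 a : (toC a == 0) = (a == origin).
Proof. by apply/eqP/eqP => [|-> //]; rewrite -toC0 => /toC_inj. Qed.

Definition toCE := (toCD, toCB, toCdiv, toCM, toCV, toC1, toC0, toC_conj).

Lemma cabs_normc a : cabs a = complex.ComplexField.Normc.normc (toC a).
Proof. by []. Qed.

Lemma cabs_sqr a : cabs a ^+ 2 = a.1 ^+ 2 + a.2 ^+ 2.
Proof. by rewrite sqr_sqrtr// addr_ge0// sqr_ge0. Qed.

Lemma cabs_ge0 a : 0 <= cabs a. Proof. exact: sqrtr_ge0. Qed.

Lemma cabsM a b : cabs (cmul a b) = cabs a * cabs b.
Proof. by rewrite !cabs_normc toCM complex.ComplexField.Normc.normcM. Qed.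

Lemma cabsV a : cabs (cinv a) = (cabs a)^-1.
Proof. by rewrite !cabs_normc toCV complex.ComplexField.Normc.normcV. Qed.

Lemma cabsD a b : cabs (cadd a b) <= cabs a + cabs b.
Proof. by rewrite !cabs_normc toCD; exact: complex.le_normcD. Qed.

Lemma cabsN a : cabs (- a.1, - a.2) = cabs a.
Proof. by rewrite /cabs /= !sqrrN. Qed.

Lemma cabs_subC a b : cabs (csub a b) = cabs (csub b a).
Proof. by rewrite -cabsN /csub /= !opprB. Qed.

Lemma cabs_le_sub a b : cabs a <= cabs b + cabs (csub a b).
Proof.
have := cabsD b (csub a b).
by rewrite /cadd /csub /= !subrKC -surjective_pairing.
Qed.

Lemma cabs_conj a : cabs (cconj a) = cabs a.
Proof. by rewrite /cabs /cconj /= sqrrN. Qed.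

Lemma cabs0 : cabs (origin : P) = 0.
Proof. by rewrite /cabs /= expr0n /= addr0 sqrtr0. Qed.

Lemma cabs1 : cabs (cone : P) = 1.
Proof. by rewrite /cabs /= expr0n /= addr0 expr1n sqrtr1. Qed.

Lemma cabs_eq0 a : (cabs a == 0) = (a == origin).
Proof.
apply/eqP/eqP => [h|->]; last exact: cabs0.
by apply: toC_inj; rewrite toC0; exact: complex.ComplexField.Normc.eq0_normc.
Qed.

Lemma cabs_gt0 a : (0 < cabs a) = (a != origin).
Proof. by rewrite lt_def cabs_ge0 andbT cabs_eq0. Qed.

Lemma ler_abs_cabs1 a : `|a.1| <= cabs a.
Proof.
rewrite -(ler_pXn2r (n:=2)) ?nnegrE ?normr_ge0 ?cabs_ge0//.
by rewrite cabs_sqr real_normK ?num_real// lerDl sqr_ge0.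
Qed.

Lemma ler_abs_cabs2 a : `|a.2| <= cabs a.
Proof.
rewrite -(ler_pXn2r (n:=2)) ?nnegrE ?normr_ge0 ?cabs_ge0//.
by rewrite cabs_sqr real_normK ?num_real// lerDr sqr_ge0.
Qed.

Lemma cabs_le_abs a : cabs a <= `|a.1| + `|a.2|.
Proof.
rewrite -(ler_pXn2r (n:=2)) ?nnegrE ?addr_ge0 ?cabs_ge0//.
rewrite cabs_sqr sqrrD !real_normK ?num_real// lerD2r lerDl.
by rewrite mulrn_wge0// mulr_ge0.
Qed.

Lemma cabs_expi t : cabs (cexpi t : P) = 1.
Proof. by rewrite /cabs /= cos2Dsin2 sqrtr1. Qed.

Lemma sqr_toC a : toC (cabs a ^+ 2, 0) = toC a * complex.conjc (toC a).
Proof.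
by rewrite -toC_conj -toCM cabs_sqr /toC /cmul /cconj /=; congr complex.Complex; ring.
Qed.

Lemma cexpi_onto e : cabs e = 1 -> exists2 t, 0 <= t < 2 * pi & cexpi t = e.
Proof.
move=> e1.
have e1' : e.1 ^+ 2 + e.2 ^+ 2 = 1 by rewrite -cabs_sqr e1 expr1n.
have i1 : -1 <= e.1 <= 1 by rewrite -ler_norml (le_trans (ler_abs_cabs1 e)) ?e1.
have h := @acosK R e.1 i1.
have s2 : sin (acos e.1) = `|e.2|.
  by rewrite sin_acos// -e1' [e.1 ^+ 2 + _]addrC addrK sqrtr_sqr.
have pi0 := @pi_gt0 R.
have a0 := acos_ge0 i1; have api := acos_lepi i1.
case: (lerP 0 e.2) => e2.
  exists (acos e.1); first by apply/andP; split => //; lra.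
  by rewrite /cexpi h s2 ger0_norm// -surjective_pairing.
(* Excludes the angle 0, so that [2 * pi - acos e.1] stays strictly below [2 * pi]. *)
have e0 : 0 < acos e.1.
  rewrite lt_neqAle a0 andbT eq_sym; apply/eqP => h0.
  move: s2; rewrite h0 sin0 => /esym/eqP; rewrite normr_eq0 => /eqP h2; lra.
exists (2 * pi - acos e.1); first by apply/andP; split; lra.
rewrite /cexpi; have -> : 2 * pi - acos e.1 = - acos e.1 + pi *+ 2 by rewrite addrC mulr_natl.
by rewrite cosD2pi sinD2pi cosN sinN h s2 ltr0_norm// opprK -surjective_pairing.
Qed.

Lemma cexpiD s t : cmul (cexpi s) (cexpi t) = cexpi (s + t) :> P.
Proof. by rewrite /cmul /cexpi /= cosD sinD; congr pair; ring. Qed.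

Lemma cexpiN t : cexpi (- t) = cconj (cexpi t) :> P.
Proof. by rewrite /cexpi /cconj /= cosN sinN. Qed.

Lemma cmulA a b c : cmul a (cmul b c) = cmul (cmul a b) c.
Proof. by apply: toC_inj; rewrite !toCE mulrA. Qed.

Lemma cmul1 a : cmul cone a = a.
Proof. by apply: toC_inj; rewrite !toCE mul1r. Qed.

End Complex.

Section Mobius.
Context {R : realType}.
Notation P := (R * R)%type.
Local Arguments complex.conjc : simpl never.
Implicit Types a b c e f g u v z w : P.

(* [mob a theta] with the rotation given as a unit complex number *)
Definition mobe a e z : P :=
  cmul e (cdiv (csub z a) (csub cone (cmul (cconj a) z))).

Lemma mob_den_ge a z : 1 - cabs a * cabs z <= cabs (csub cone (cmul (cconj a) z)).
Proof.
have := cabs_le_sub cone (csub cone (csub cone (cmul (cconj a) z))).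
set x := cmul (cconj a) z.
have -> : csub cone (csub cone x) = x.
  by apply: toC_inj; rewrite !toCE; ring.
by rewrite cabs1 cabsM cabs_conj; lra.
Qed.

Lemma mob_den_gt0 a z : disk a -> disk z -> 0 < cabs (csub cone (cmul (cconj a) z)).
Proof.
rewrite /disk /= => a1 z1; apply: lt_le_trans (mob_den_ge _ _).
by have := cabs_ge0 a; have := cabs_ge0 z; nra.
Qed.

Lemma mob_den_neq0 a z : disk a -> disk z ->
  1 - complex.conjc (toC a) * toC z != 0.
Proof.
move=> da dz; have := mob_den_gt0 da dz.
by rewrite cabs_gt0 -toC_eq0 !toCE.
Qed.

Lemma toC_mobe a e z : toC (mobe a e z) =
  toC e * ((toC z - toC a) / (1 - complex.conjc (toC a) * toC z)).
Proof. by rewrite /mobe !toCE. Qed.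

(** The two-point form of $|m'(z)|=(1-|a|^2)/|1-\bar a z|^2$; the Lipschitz bound [mobe_lip] comes
    from it. *)
Lemma cabs_mobe_sub a e u v : disk a -> cabs e = 1 -> disk u -> disk v ->
  cabs (csub (mobe a e u) (mobe a e v)) =
  (1 - cabs a ^+ 2) * cabs (csub u v) /
  (cabs (csub cone (cmul (cconj a) u)) * cabs (csub cone (cmul (cconj a) v))).
Proof.
move=> da e1 du dv.
have -> : csub (mobe a e u) (mobe a e v) =
   cmul e (cdiv (cmul (1 - cabs a ^+ 2, 0) (csub u v))
     (cmul (csub cone (cmul (cconj a) u)) (csub cone (cmul (cconj a) v)))).
  apply: toC_inj; rewrite toCB !toC_mobe !toCE.
  have -> : toC (1 - cabs a ^+ 2, 0) = 1 - toC a * complex.conjc (toC a).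
    by rewrite -sqr_toC -toC1 -toCB /csub /= subr0.
  by field; rewrite !mob_den_neq0.
rewrite !(cabsM, cabsV) e1 mul1r; congr (_ * _ / _).
rewrite /cabs /= expr0n /= addr0 sqrtr_sqr ger0_norm// subr_ge0.
by rewrite -/(cabs a) expr_le1// ?cabs_ge0// ltW.
Qed.

Lemma mobe_one_minus a e z : disk a -> cabs e = 1 -> disk z ->
  1 - cabs (mobe a e z) ^+ 2 =
  (1 - cabs a ^+ 2) * (1 - cabs z ^+ 2) / cabs (csub cone (cmul (cconj a) z)) ^+ 2.
Proof.
move=> da e1 dz.
have h1 (x : P) : toC (1 - cabs x ^+ 2, 0) = 1 - toC x * complex.conjc (toC x).
    by rewrite -sqr_toC -toC1 -toCB /csub /= subr0.
(* The identity is between real numbers; [h2] reads it as one between complex numbers of zero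
   imaginary part, where conjugates can be used. *)
have h2 x y : (x, 0) = cmul (y, 0) (cinv (cabs (csub cone (cmul (cconj a) z)) ^+ 2, 0)) ->
    x = y / cabs (csub cone (cmul (cconj a) z)) ^+ 2.
  set q := cabs _ ^+ 2; have q0 : q != 0.
    by rewrite expf_neq0// gt_eqF// mob_den_gt0.
  case; rewrite expr0n addr0 mul0r subr0 => -> _.
  by rewrite expr2; field.
apply: h2; apply: toC_inj; rewrite toCM toCV sqr_toC.
have -> : toC ((1 - cabs a ^+ 2) * (1 - cabs z ^+ 2), 0) =
   toC (1 - cabs a ^+ 2, 0) * toC (1 - cabs z ^+ 2, 0).
  by rewrite -toCM /cmul /= !(mulr0, mul0r, subr0, addr0).
rewrite !h1 !toC_mobe !toCE !(rmorphM, rmorphB, fmorphV, rmorph1) /=.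
have e1' : toC e * complex.conjc (toC e) = 1 by rewrite -sqr_toC e1 expr1n.
have e0 : toC e != 0.
  by apply/eqP => e0; move: e1'; rewrite e0 mul0r => /esym/eqP; rewrite oner_eq0.
have -> : complex.conjc (toC e) = (toC e)^-1.
  by apply: (mulfI e0); rewrite e1' divff.
rewrite complex.conjcK; have d1 := mob_den_neq0 da dz.
have d2 : 1 - toC a * complex.conjc (toC z) != 0.
  have := d1; rewrite -complex.conjc_eq0 rmorphB rmorphM rmorph1 /=.
  by rewrite complex.conjcK.
by field; rewrite e0 d1 d2.
Qed.

Lemma disk_sqr z : disk z <-> 0 < 1 - cabs z ^+ 2.
Proof. by rewrite /disk /= subr_gt0 expr_lt1// cabs_ge0. Qed.

Lemma mobe_disk a e z : disk a -> cabs e = 1 -> disk z -> disk (mobe a e z).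
Proof.
move=> da e1 dz; apply/disk_sqr; rewrite mobe_one_minus//.
apply: divr_gt0; last exact/exprn_gt0/mob_den_gt0.
by apply: mulr_gt0; apply/disk_sqr.
Qed.

Lemma mobe_comp a e b f : disk a -> cabs e = 1 -> disk b -> cabs f = 1 ->
  exists c g, [/\ disk c, cabs g = 1 &
    forall z, disk z -> mobe b f (mobe a e z) = mobe c g z].
Proof.
move=> da e1 db f1.
have e1' : toC e * complex.conjc (toC e) = 1 by rewrite -sqr_toC e1 expr1n.
have e0 : toC e != 0.
  by apply/eqP => e0; move: e1'; rewrite e0 mul0r => /esym/eqP; rewrite oner_eq0.
have e2 : complex.conjc (toC e) = (toC e)^-1.
  by apply: (mulfI e0); rewrite e1' divff.
have dea : disk (- (cmul e a).1, - (cmul e a).2).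
  by rewrite /disk /mkset cabsN cabsM e1 mul1r.
(* The composite is $f\,(nz-(ea+b))/(d-(\bar a+\bar b e)z)$. Its zero is [c], and $n=e\bar d$ makes
   $n/d$ a unit, which is absorbed in [g]. *)
pose n := cadd e (cmul b (cconj a)); pose d := cadd cone (cmul (cconj b) (cmul e a)).
have toCN x : toC (- x.1, - x.2) = - toC x by [].
have d0 : toC d != 0.
  by have := mob_den_neq0 db dea; rewrite toCN mulrN opprK /d !toCE.
have nd : toC n = toC e * complex.conjc (toC d).
  rewrite /n /d !toCE !(rmorphM, rmorphD, rmorph1) /= complex.conjcK e2.
  by field.
have n0 : toC n != 0 by rewrite nd mulf_neq0// complex.conjc_eq0.
have cnd : cabs n = cabs d.
  rewrite cabs_normc nd complex.ComplexField.Normc.normcM -[in LHS]toC_conj.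
  by rewrite -!cabs_normc cabs_conj e1 mul1r.
pose c := cdiv (cadd (cmul e a) b) n; pose g := cmul f (cdiv n d).
have g1 : cabs g = 1.
  by rewrite /g !(cabsM, cabsV) f1 mul1r cnd divff// cabs_eq0 -toC_eq0.
have E z : disk z -> mobe b f (mobe a e z) = mobe c g z.
  move=> dz; apply: toC_inj; rewrite !toC_mobe.
  have := mob_den_neq0 db (mobe_disk da e1 dz); rewrite toC_mobe.
  have := mob_den_neq0 da dz.
  have cc : complex.conjc (toC c) =
      (complex.conjc (toC a) + complex.conjc (toC b) * toC e) / toC d.
    rewrite /c toCdiv fmorph_div /= nd !toCE !(rmorphM, rmorphD, rmorph1) /= !complex.conjcK e2.
    by field; rewrite e0 -[1 + _](_ : toC d = _) ?d0 // /d !toCE; ring.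
  rewrite cc; clear cc; move: d0 n0; rewrite /g /c /n /d !toCE.
  move: (toC a) (toC b) (toC e) e0 (complex.conjc (toC a)) (complex.conjc (toC b)) (toC f) (toC z).
  move=> A B E E0 A' B' F Z d0 n0 h1 h2.
  field; rewrite d0 n0 h1 /= andbT.
  rewrite (_ : _ - _ = (1 - A' * Z) * (1 - B' * (E * ((Z - A) / (1 - A' * Z))))).
    by rewrite mulf_neq0.
  by field.
exists c, g; split => //.
have d00 : disk (origin : P) by rewrite /disk /mkset cabs0 ltr01.
(* The composite sends the origin to $-gc$, of modulus $|c|$; as it preserves the disk, [c] lies in
   it. *)
have := mobe_disk db f1 (mobe_disk da e1 d00).
rewrite E// /disk /mkset; congr (_ < _).
have -> : mobe c g origin = cmul g (- c.1, - c.2).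
  apply: toC_inj; rewrite toC_mobe toCM toC0 toCN mulr0 subr0 divr1 sub0r //.
by rewrite cabsM g1 mul1r cabsN.
Qed.

Lemma disk0 : disk (origin : P).
Proof. by rewrite /disk /mkset cabs0 ltr01. Qed.

Definition cneg a : P := (- a.1, - a.2).

Lemma toCN a : toC (cneg a) = - toC a. Proof. by []. Qed.

Lemma conjc_unit e : cabs e = 1 -> toC e != 0 /\ complex.conjc (toC e) = (toC e)^-1.
Proof.
move=> e1.
have e1' : toC e * complex.conjc (toC e) = 1 by rewrite -sqr_toC e1 expr1n.
have e0 : toC e != 0.
  by apply/eqP => e0; move: e1'; rewrite e0 mul0r => /esym/eqP; rewrite oner_eq0.
by split => //; apply: (mulfI e0); rewrite e1' divff.
Qed.

Lemma mobeK a e z : disk a -> cabs e = 1 -> disk z ->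
  mobe (cneg (cmul e a)) (cconj e) (mobe a e z) = z.
Proof.
move=> da e1 dz; have [e0 e2] := conjc_unit e1.
apply: toC_inj; rewrite !toC_mobe toCN toC_conj toCM rmorphN rmorphM /= e2.
have h1 := mob_den_neq0 da dz.
have h2 := mob_den_neq0 da da.
field; rewrite e0 h1 /=.
by rewrite (_ : _ - _ - _ = 1 - complex.conjc (toC a) * toC a)//; ring.
Qed.

Lemma mobeKV a e z : disk a -> cabs e = 1 -> disk z ->
  mobe a e (mobe (cneg (cmul e a)) (cconj e) z) = z.
Proof.
move=> da e1 dz; have [e0 e2] := conjc_unit e1.
have da' : disk (cneg (cmul e a)).
  by rewrite /disk /mkset cabsN cabsM e1 mul1r.
have e1' : cabs (cconj e) = 1 by rewrite cabs_conj.
have := mobeK da' e1' dz.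
have -> : cneg (cmul (cconj e) (cneg (cmul e a))) = a.
  by apply: toC_inj; rewrite toCN toCM toCN toCM toC_conj e2; field.
have -> // : cconj (cconj e) = e.
by apply: toC_inj; rewrite !toC_conj complex.conjcK.
Qed.

Lemma mob_invE a t z : mob_inv a t z = mobe (cneg (cmul (cexpi t) a)) (cconj (cexpi t)) z.
Proof.
have [e0 e2] := conjc_unit (cabs_expi t).
apply: toC_inj; rewrite toC_mobe toCN toCM rmorphN rmorphM /= toC_conj e2.
rewrite /mob_inv cexpiN !toCE e2.
rewrite opprK [RHS]mulrA [_ * (_ + _ * _)]mulrDr (mulKf e0).
by congr (_ / _); ring.
Qed.

Lemma mobE a t z : mob a t z = mobe a (cexpi t) z. Proof. by []. Qed.

Lemma mob_invK a t z : disk a -> disk z -> mob_inv a t (mob a t z) = z.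
Proof. by move=> da dz; rewrite mob_invE mobE mobeK// cabs_expi. Qed.

Lemma mobe_origin a e : mobe a e origin = cneg (cmul e a).
Proof. by apply: toC_inj; rewrite toC_mobe toCN toCM toC0 mulr0 subr0 divr1 sub0r mulrN. Qed.

Lemma mobe0 e z : mobe origin e z = cmul e z.
Proof. by apply: toC_inj; rewrite toC_mobe !toCE rmorph0 mul0r !subr0 divr1. Qed.

Lemma mobe_fix0 a e : cabs e = 1 -> mobe a e origin = origin -> a = origin.
Proof.
move=> e1; rewrite mobe_origin => /(congr1 toC); rewrite toCN toCM toC0 => /eqP.
have [e0 _] := conjc_unit e1.
by rewrite oppr_eq0 mulf_eq0 (negbTE e0) /= toC_eq0 => /eqP.
Qed.

(** In [cabs_mobe_sub] the factor $1-|a|^2$ is at most 1 and both denominators are at least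
    $1-\rho$, whatever [a]. This uniformity keeps the sample points out of the final constants. *)
Lemma mobe_lip rho a e u v : disk a -> cabs e = 1 -> rho < 1 ->
  cabs u <= rho -> cabs v <= rho ->
  cabs (csub (mobe a e u) (mobe a e v)) <= cabs (csub u v) / (1 - rho) ^+ 2.
Proof.
move=> da e1 r1 ur vr.
have du : disk u by apply: le_lt_trans ur _.
have dv : disk v by apply: le_lt_trans vr _.
rewrite cabs_mobe_sub//; apply: ler_pM.
- by apply: mulr_ge0; [exact/ltW/disk_sqr|exact: cabs_ge0].
- by rewrite invr_ge0 mulr_ge0// cabs_ge0.
- by rewrite ler_piMl ?cabs_ge0// gerBl sqr_ge0.
have a1 : cabs a <= 1 by exact: ltW.
have h x : cabs x <= rho -> 1 - rho <= cabs (csub cone (cmul (cconj a) x)).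
  move=> xr; apply: le_trans (mob_den_ge a x).
  by have := cabs_ge0 x; have := cabs_ge0 a; nra.
have r0 : 0 < 1 - rho by rewrite subr_gt0.
rewrite lef_pV2 ?posrE ?exprn_gt0// ?mulr_gt0 ?mob_den_gt0//.
by rewrite expr2 ler_pM ?h// ltW.
Qed.

(* [mobe (cneg z) cone] is the translation taking the origin to [z]. *)
Lemma mobe_base_lip rho z z' u : disk z -> disk z' -> rho < 1 -> cabs u <= rho ->
  cabs (csub (mobe (cneg z) cone u) (mobe (cneg z') cone u)) <=
  4 * cabs (csub z z') / (1 - rho) ^+ 2.
Proof.
move=> dz dz' r1 ur.
have du : disk u by apply: le_lt_trans ur _.
have dN x : disk x -> disk (cneg x) by rewrite /disk /mkset cabsN.
(* Over the common denominator the numerator is a sum of three terms of modulus at most $D$, $D$ and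
   $2D$, where $D=|z-z'|$; this is the origin of the 4. *)
have -> : csub (mobe (cneg z) cone u) (mobe (cneg z') cone u) =
  cdiv (cadd (cadd (csub z z') (cmul (cmul u u) (csub (cconj z') (cconj z))))
     (cmul u (cadd (cmul z (csub (cconj z') (cconj z))) (cmul (csub z z') (cconj z)))))
   (cmul (csub cone (cmul (cconj (cneg z)) u)) (csub cone (cmul (cconj (cneg z')) u))).
  apply: toC_inj; rewrite toCB !toC_mobe !toCE.
  have h1 := mob_den_neq0 (dN _ dz) du; have h2 := mob_den_neq0 (dN _ dz') du.
  move: h1 h2; rewrite !toCN !rmorphN /= => h1 h2.
  by field; rewrite h1 h2.
have hc : cabs (csub (cconj z') (cconj z)) = cabs (csub z z').
  by rewrite cabs_subC -[RHS]cabs_conj /cconj /csub /=; congr cabs; congr pair; ring.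
rewrite cabsM cabsV; apply: ler_pM; rewrite ?invr_ge0 ?cabs_ge0//.
  apply: (le_trans (cabsD _ _)); apply: (le_trans (lerD (cabsD _ _) (lexx _))).
  rewrite !cabsM hc.
  have := cabsD (cmul z (csub (cconj z') (cconj z))) (cmul (csub z z') (cconj z)).
  rewrite !cabsM hc cabs_conj.
  set D := cabs (csub z z'); set U := cabs u; set Q := cabs (cadd _ _).
  have D0 : 0 <= D by exact: cabs_ge0.
  have U0 : 0 <= U by exact: cabs_ge0.
  have U1 : U <= 1 by exact: ltW.
  have Z1 : cabs z <= 1 by exact: ltW.
  have Z0 : 0 <= cabs z by exact: cabs_ge0.
  have Q0 : 0 <= Q by exact: cabs_ge0.
  move=> hQ.
  have : Q <= 2 * D by nra.
  have : U * U * D <= D by rewrite ler_piMl// mulr_ile1.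
  have : U * Q <= Q by rewrite ler_piMl.
  lra.
have r0 : 0 < 1 - rho by rewrite subr_gt0.
have h x : disk x -> 1 - rho <= cabs (csub cone (cmul (cconj (cneg x)) u)).
  move=> dx; apply: le_trans (mob_den_ge _ u); rewrite cabsN.
  have : cabs x <= 1 by exact: ltW.
  by have := cabs_ge0 x; have := cabs_ge0 u; nra.
rewrite lef_pV2 ?posrE ?exprn_gt0// ?cabsM ?mulr_gt0 ?mob_den_gt0//; try exact: dN.
by rewrite expr2 ler_pM ?h// ltW.
Qed.

End Mobius.

(** * Change of variables *)

Section Density.
Local Open Scope ereal_scope.
Context d (T : measurableType d) (R : realType) (m : {measure set T -> \bar R}).
Variables (g : T -> R) (g0 : forall x, (0 <= g x)%R) (mg : measurable_fun setT g).

(** The two proofs are arguments so that the term itself determines its measure structure. *)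
Definition densm of (forall x, (0 <= g x)%R) & measurable_fun setT g :=
  fun A : set T => \int[m]_(x in A) (g x)%:E.

Local Notation dens := (densm g0 mg).

Let dens0 : dens set0 = 0. Proof. exact: integral_set0. Qed.

Let dens_ge0 A : 0 <= dens A.
Proof. by apply: integral_ge0 => x _; rewrite lee_fin. Qed.

Let dens_sigma_additive : semi_sigma_additive dens.
Proof.
move=> /= F mF tF mUF; rewrite /densm; apply: cvg_toP.
  apply: ereal_nondecreasing_is_cvgn => k n kn.
  by apply: lee_sum_nneg_natr => // i _ _; exact: dens_ge0.
rewrite ge0_integral_bigcup//=.
  exact/measurable_funTS/measurable_EFinP.
by move=> x _; rewrite lee_fin.
Qed.

HB.instance Definition _ := isMeasure.Build _ _ _ dens
  dens0 dens_ge0 dens_sigma_additive.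

Import HBNNSimple.

(** Monotone approximation by simple functions reduces this to indicators, where it is the
    definition of [densm]. *)
Lemma integral_densm (f : T -> \bar R) : (forall x, 0 <= f x) ->
  measurable_fun setT f ->
  \int[dens]_x f x = \int[m]_x (f x * (g x)%:E).
Proof.
move=> f0 mf; pose h := nnsfun_approx measurableT mf.
have mgE : measurable_fun setT (EFin \o g) by exact/measurable_EFinP.
have -> : \int[dens]_x f x = lim (\int[dens]_x (EFin \o h n) x @[n --> \oo]).
  have fE x : f x = lim ((EFin \o h n) x @[n --> \oo]).
    by apply/esym/cvg_lim => //; exact: cvg_nnsfun_approx.
  under eq_integral do rewrite fE.
  apply: monotone_convergence => //.
  - by move=> n; exact/measurable_EFinP.
  - by move=> n x _ //=; rewrite lee_fin.
  - by move=> x _ a b ab; rewrite lee_fin; exact/lefP/nd_nnsfun_approx.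
have -> : \int[m]_x (f x * (g x)%:E) =
    lim (\int[m]_x ((EFin \o h n) x * (g x)%:E) @[n --> \oo]).
  have fg x : f x * (g x)%:E = lim (((EFin \o h n) x * (g x)%:E) @[n --> \oo]).
    apply/esym/cvg_lim => //; apply: cvgeZr => //.
    exact: cvg_nnsfun_approx.
  under eq_integral do rewrite fg.
  apply: monotone_convergence => [//| | |].
  - by move=> n; apply/emeasurable_funM => //; exact/measurable_EFinP.
  - by move=> n x _ /=; rewrite mule_ge0 ?lee_fin.
  - by move=> x _ a b ab/=; rewrite lee_wpmul2r ?lee_fin//; exact/lefP/nd_nnsfun_approx.
suff suf n : \int[m]_x ((EFin \o h n) x * (g x)%:E) =
    \int[dens]_x (EFin \o h n) x.
  by under [in RHS]eq_fun do rewrite suf.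
transitivity (\int[dens]_x
   (\sum_(y \in range (h n)) (y * \1_(h n @^-1` [set y]) x)%:E)); last first.
  by apply: eq_integral => t _; rewrite /= fimfunE -fsumEFin.
have indich k r : measurable_fun setT (fun x => (r * \1_(h k @^-1` [set r]) x)%:E).
  by apply: (measurable_comp measurableT) => //; exact: measurable_funM.
rewrite ge0_integral_fsum//; last by move=> k y _; exact: nnfun_muleindic_ge0.
transitivity (\int[m]_x (\sum_(y \in range (h n))
    (y * \1_(h n @^-1` [set y]) x)%:E * (g x)%:E)).
  under [RHS]eq_integral => x _.
    rewrite -ge0_mule_fsuml => [|y]; last exact: nnfun_muleindic_ge0.
    rewrite fsumEFin // -(fimfunE _ x); over.
  by [].
rewrite ge0_integral_fsum//; last 2 first.
  - by move=> y; apply: emeasurable_funM.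
  - by move=> k y _; apply: mule_ge0; [exact: nnfun_muleindic_ge0|rewrite lee_fin].
apply: eq_fsbigr => r rhn.
under [RHS]eq_integral do rewrite EFinM.
rewrite integralZl_indic_nnsfun => //.
under eq_integral do rewrite EFinM -muleA.
rewrite ge0_integralZl//.
- under eq_integral do rewrite muleC.
  rewrite (eq_integral ((EFin \o g) \_ (h n @^-1` [set r]))); last first.
    by move=> x _; rewrite epatch_indic.
  by rewrite -integral_mkcondr setTI integral_indic// setIT.
- by apply: emeasurable_funM => //; exact/measurable_EFinP.
- by move=> t _; rewrite mule_ge0 ?lee_fin.
- by move: rhn; rewrite inE => -[t _ <-]; rewrite lee_fin.
Qed.

End Density.

Section Substitution.
Local Open Scope ereal_scope.
Context {R : realType}.
Notation leb := (@lebesgue_measure R).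

(** The image under [phi] of the measure with density [psi] on [I] gives each interval $]a,b]$ the
    mass $b-a$, by the fundamental theorem of calculus on the preimage $]x_a,x_b]$. By uniqueness it
    is Lebesgue measure, so the formula holds for every nonnegative measurable [F]. *)
Lemma integral_substitution (I : set R) (phi psi : R -> R) :
  measurable I -> is_interval I ->
  measurable_fun setT phi -> measurable_fun setT psi ->
  (forall x, I x -> 0 < psi x)%R ->
  (forall x, I x -> is_derive x 1%R phi (psi x)) ->
  (forall x, I x -> {for x, continuous psi}) ->
  (forall u, exists2 x, I x & phi x = u) ->
  forall F : R -> \bar R, measurable_fun setT F -> (forall u, 0 <= F u) ->
  \int[leb]_(x in I) (F (phi x) * (psi x)%:E) = \int[leb]_u F u.
Proof.
move=> mI iI mphi mpsi psi0 dphi cpsi surj F mF F0.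
pose g := (psi \_ I)%R.
have g0 x : (0 <= g x)%R.
  by rewrite /g patchE; case: ifPn => //; rewrite inE => /psi0/ltW.
have mg : measurable_fun setT g.
  by apply/(measurable_restrictT _ mI)/measurable_funTS.
have phi_incr x y : I x -> I y -> (x < y)%R -> (phi x < phi y)%R.
  move=> Ix Iy xy.
  have Iz z : z \in `[x, y]%R -> I z by rewrite in_itv /=; exact: (iI x y).
  apply: (@gtr0_derive1_lt_cc R phi x y _ _ _ x y); rewrite ?bound_itvE ?ltW//.
  - move=> z zxy; have Izz : I z by apply: Iz; exact: subset_itv_oo_cc zxy.
    by have [] := dphi _ Izz.
  - move=> z zxy; have Izz : I z by apply: Iz; exact: subset_itv_oo_cc zxy.
    by rewrite derive1E; have := dphi _ Izz => h; rewrite derive_val psi0.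
  - apply: continuous_in_subspaceT => z; rewrite inE /= => /Iz Izz.
    by apply/differentiable_continuous/derivable1_diffP; have [] := dphi _ Izz.
pose m : {measure set (measurableTypeR R) -> \bar R} := densm leb g0 mg.
transitivity (\int[m]_x F (phi x)).
  rewrite integral_densm//; last by exact: (measurableT_comp mF).
  rewrite [LHS]integral_mkcond; apply: eq_integral => x _.
  by rewrite /g !patchE; case: ifPn => // _; rewrite mule0.
pose phi' : measurableTypeR R -> measurableTypeR R := phi.
have mphi' : measurable_fun setT phi' by exact: mphi.
rewrite -[LHS](@ge0_integral_pushforward _ _ _ _ _ phi' mphi' m setT F)//.
pose pm : {measure set (measurableTypeR R) -> \bar R} :=
  measure_function_pushforward__canonical__measure_function_Measure m mphi'.
apply: eq_measure_integral => A mA _.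
apply: esym; rewrite -[RHS]/(pm A); apply: lebesgue_measure_unique => // _ [[a b] _ <-] /=.
rewrite /pm/= /pushforward /= /m /= /densm.
case: (ltP a b) => ab; last first.
  by rewrite set_itv_ge ?bnd_simp -?leNgt// preimage_set0 integral_set0 measure0.
have [xa Ia pa] := surj a; have [xb Ib pb] := surj b.
have xab : (xa < xb)%R.
  rewrite ltNge; apply/negP; rewrite le_eqVlt => /orP[/eqP h|h].
    by move: ab; rewrite -pa -pb h ltxx.
  by have := phi_incr _ _ Ib Ia h; rewrite pa pb ltNge ltW.
rewrite lebesgue_measure_itv /= lte_fin ab.
have -> : \int[leb]_(x in phi @^-1` `]a, b]) (g x)%:E = \int[leb]_(x in `]xa, xb]) (psi x)%:E.
  rewrite [LHS]integral_mkcond [RHS]integral_mkcond; apply: eq_integral => x _.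
  rewrite /g !patchE; case: (boolP (x \in I)); rewrite (inE, notin_setE) => Ix; last first.
    rewrite if_same; case: ifPn => //; rewrite inE /= in_itv /= => /andP[h1 h2].
    by exfalso; apply: Ix; apply: (iI xa xb) => //; rewrite (ltW h1) h2.
  suff -> : (x \in phi @^-1` `]a, b]) = (x \in (`]xa, xb]%classic : set R)) by [].
  apply/idP/idP; rewrite !inE /= !in_itv /= => /andP[h1 h2].
    apply/andP; split.
      rewrite ltNge; apply/negP; rewrite le_eqVlt => /orP[/eqP h|h].
        by move: h1; rewrite h pa ltxx.
      by have := phi_incr _ _ Ix Ia h; rewrite pa ltNge ltW.
    rewrite leNgt; apply/negP => h.
    by have := phi_incr _ _ Ib Ix h; rewrite pb ltNge h2.
  apply/andP; split; first by rewrite -pa phi_incr.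
  move: h2; rewrite le_eqVlt => /orP[/eqP->|h]; first by rewrite pb.
  by rewrite -pb ltW// phi_incr.
rewrite integral_itv_obnd_cbnd; last exact/measurable_EFinP/measurable_funTS.
have Iz z : z \in `[xa, xb]%R -> I z by rewrite in_itv /=; exact: (iI xa xb).
have cphi z : z \in `[xa, xb]%R -> {for z, continuous phi}.
  move=> /Iz Izz.
  by apply/differentiable_continuous/derivable1_diffP; have [] := dphi _ Izz.
rewrite (@continuous_FTC2 _ psi phi xa xb xab) ?pa ?pb//.
- by apply: continuous_in_subspaceT => z; rewrite inE /= => /Iz/cpsi.
- split.
  + move=> z zxy; have Izz : I z by apply: Iz; exact: subset_itv_oo_cc zxy.
    by have [] := dphi _ Izz.
  + by apply: cvg_at_right_filter; apply: cphi; rewrite bound_itvE ltW.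
  + by apply: cvg_at_left_filter; apply: cphi; rewrite bound_itvE ltW.
- move=> z zxy; have Izz : I z by apply: Iz; exact: subset_itv_oo_cc zxy.
  by rewrite derive1E; have := dphi _ Izz => h; rewrite derive_val.
Qed.
End Substitution.

Section Fiberwise.
Local Open Scope ereal_scope.
Context {R : realType}.
Notation P := (R * R)%type.
Notation leb := (@lebesgue_measure R).
Implicit Types (F : P -> \bar R) (I : set P) (phi psi : P -> R).

(** The data of an increasing $C^1$ bijection from an interval onto the whole line; injectivity
    follows from the positive derivative. *)
Definition fiber_change (J : set R) (f g : R -> R) :=
  [/\ is_interval J, forall x, J x -> (0 < g x)%R,
      forall x, J x -> is_derive x 1%R f (g x),
      forall x, J x -> {for x, continuous g} &
      forall u, exists2 x, J x & f x = u].

Lemma integral_fiber2 I U phi psi F :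
  measurable I -> measurable U ->
  measurable_fun setT phi -> measurable_fun setT psi ->
  (forall z, I z -> U z.1) ->
  (forall x, U x -> fiber_change (xsection I x) (fun y => phi (x, y)) (fun y => psi (x, y))) ->
  measurable_fun setT F -> (forall z, 0 <= F z) ->
  \int[leb2]_(z in I) (F (z.1, phi z) * (psi z)%:E) = \int[leb2]_(z in U `*` setT) F z.
Proof.
move=> mI mU mphi mpsi IU H mF F0.
have mUT : measurable (U `*` [set: R]) by exact: measurableX.
rewrite integral_mkcond [RHS]integral_mkcond /leb2.
have psi0 z : I z -> (0 < psi z)%R.
  case: z => x y Iz; have Ux := IU _ Iz; have [_ h _ _ _] := H _ Ux.
  by apply: h; rewrite /xsection /= inE.
have mFp : measurable_fun setT (fun z : P => F (z.1, phi z)).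
  by apply: (measurableT_comp mF); apply: measurable_fun_pair => //; exact: measurable_fst.
rewrite fubini_tonelli1; first last.
- move=> z; rewrite patchE; case: ifPn => //; rewrite inE => Iz.
  by rewrite mule_ge0// lee_fin ltW// psi0.
- apply/(measurable_restrictT _ _).1 => //.
  by apply/measurable_funTS/emeasurable_funM => //; exact/measurable_EFinP.
rewrite fubini_tonelli1; first last.
- by move=> z; rewrite patchE; case: ifPn.
- by apply/(measurable_restrictT _ _).1 => //; exact: measurable_funTS.
apply: eq_integral => x _; rewrite /fubini_F.
case: (pselect (U x)) => Ux; last first.
  rewrite !integral0_eq// => y _; rewrite patchE; case: ifPn => //; rewrite inE.
    by case.
  by move=> /IU.
have [h1 h2 h3 h4 h5] := H _ Ux.
have mp (f : P -> R) : measurable_fun setT f -> measurable_fun setT (fun y => f (x, y)).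
  by move=> mf; apply: (measurableT_comp mf); exact: pair1_measurable.
have := @integral_substitution R _ _ _ (measurable_xsection x mI) h1 (mp _ mphi) (mp _ mpsi)
  h2 h3 h4 h5 (fun u => F (x, u)).
move=> E.
transitivity (\int[leb]_u F (x, u)).
  rewrite -E//; last by apply: (measurableT_comp mF); exact: pair1_measurable.
  by rewrite [RHS]integral_mkcond; apply: eq_integral => y _; rewrite !patchE /xsection mem_setE.
by apply: eq_integral => y _; rewrite patchE mem_set.
Qed.

Lemma integral_fiber1 I U phi psi F :
  measurable I -> measurable U ->
  measurable_fun setT phi -> measurable_fun setT psi ->
  (forall z, I z -> U z.2) ->
  (forall y, U y -> fiber_change (ysection I y) (fun x => phi (x, y)) (fun x => psi (x, y))) ->
  measurable_fun setT F -> (forall z, 0 <= F z) ->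
  \int[leb2]_(z in I) (F (phi z, z.2) * (psi z)%:E) = \int[leb2]_(z in setT `*` U) F z.
Proof.
move=> mI mU mphi mpsi IU H mF F0.
have mUT : measurable ([set: R] `*` U) by exact: measurableX.
rewrite integral_mkcond [RHS]integral_mkcond /leb2.
have psi0 z : I z -> (0 < psi z)%R.
  case: z => x y Iz; have Ux := IU _ Iz; have [_ h _ _ _] := H _ Ux.
  by apply: h; rewrite /ysection /= inE.
have mFp : measurable_fun setT (fun z : P => F (phi z, z.2)).
  by apply: (measurableT_comp mF); apply: measurable_fun_pair => //; exact: measurable_snd.
rewrite fubini_tonelli2; first last.
- move=> z; rewrite patchE; case: ifPn => //; rewrite inE => Iz.
  by rewrite mule_ge0// lee_fin ltW// psi0.
- apply/(measurable_restrictT _ _).1 => //.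
  by apply/measurable_funTS/emeasurable_funM => //; exact/measurable_EFinP.
rewrite fubini_tonelli2; first last.
- by move=> z; rewrite patchE; case: ifPn.
- by apply/(measurable_restrictT _ _).1 => //; exact: measurable_funTS.
apply: eq_integral => x _; rewrite /fubini_G.
case: (pselect (U x)) => Ux; last first.
  rewrite !integral0_eq// => y _; rewrite patchE; case: ifPn => //; rewrite inE.
    by case.
  by move=> /IU.
have [h1 h2 h3 h4 h5] := H _ Ux.
have mp (f : P -> R) : measurable_fun setT f -> measurable_fun setT (fun y => f (y, x)).
  by move=> mf; apply: (measurableT_comp mf); exact: pair2_measurable.
have := @integral_substitution R _ _ _ (measurable_ysection x mI) h1 (mp _ mphi) (mp _ mpsi)
  h2 h3 h4 h5 (fun u => F (u, x)).
move=> E.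
transitivity (\int[leb]_u F (u, x)).
  rewrite -E//; last by apply: (measurableT_comp mF); exact: pair2_measurable.
  by rewrite [RHS]integral_mkcond; apply: eq_integral => y _; rewrite !patchE /ysection mem_setE.
by apply: eq_integral => y _; rewrite patchE mem_set.
Qed.

End Fiberwise.

Section Derivatives.
Context {R : realType}.
Implicit Types (f g : R -> R) (x a b c : R).

(* [is_derive] without the class resolution, which would fill in unsimplified derivatives *)
Definition isd x f a := is_derive x 1 f a.

Lemma isd_eq x f a b : isd x f a -> a = b -> is_derive x 1 f b.
Proof. by move=> ? <-. Qed.

Lemma isd_id x : isd x (fun t : R => t) 1.
Proof. exact: is_derive_id. Qed.

Lemma isd_cst x c : isd x (fun=> c) 0.
Proof. exact: is_derive_cst. Qed.

Lemma isdD f g x a b : isd x f a -> isd x g b -> isd x (fun t => f t + g t) (a + b).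
Proof. by move=> ? ?; exact: is_deriveD. Qed.

Lemma isdN f x a : isd x f a -> isd x (fun t => - f t) (- a).
Proof. by move=> ?; exact: is_deriveN. Qed.

Lemma isdM f g x a b : isd x f a -> isd x g b ->
  isd x (fun t => f t * g t) (f x * b + g x * a).
Proof. by move=> ? ?; exact: is_deriveM. Qed.

Lemma isdX2 f x a : isd x f a -> isd x (fun t => f t ^+ 2) (2 * f x * a).
Proof.
move=> h; apply: is_derive_eq (isdM h h) _.
by rewrite -mulrA mulr_natl mulr2n.
Qed.

Lemma isdV f x a : f x != 0 -> isd x f a -> isd x (fun t => (f t)^-1) (- f x ^- 2 * a).
Proof. by move=> fx h; exact: is_deriveV. Qed.

Lemma isd_sqrt f x a : 0 < f x -> isd x f a ->
  isd x (fun t => Num.sqrt (f t)) ((2 * Num.sqrt (f x))^-1 * a).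
Proof.
move=> fx h; have hs := is_derive1_sqrt fx.
exact: (@is_derive1_comp _ (@Num.sqrt R) f).
Qed.

Lemma isd_cont f x a : isd x f a -> {for x, continuous f}.
Proof. by move=> -[h _]; exact/differentiable_continuous/derivable1_diffP. Qed.

End Derivatives.

(** * Boosts and rotations in hyperboloid coordinates *)

Section Gans.
Context {R : realType}.
Notation P := (R * R)%type.
Implicit Types (F : P -> \bar R) (z : P).

(** The time coordinate of the point of the upper sheet $T^2-X^2-Y^2=1$ that lies over $(X,Y)$. *)
Definition gT z : R := Num.sqrt (1 + z.1 ^+ 2 + z.2 ^+ 2).

Lemma gT_arg_gt0 z : 0 < 1 + z.1 ^+ 2 + z.2 ^+ 2.
Proof. by rewrite !ltr_wpDr ?sqr_ge0// ltr01. Qed.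

Lemma gT_gt0 z : 0 < gT z. Proof. by rewrite sqrtr_gt0 gT_arg_gt0. Qed.

Lemma gT_sqr z : gT z ^+ 2 = 1 + z.1 ^+ 2 + z.2 ^+ 2.
Proof. by rewrite sqr_sqrtr// ltW// gT_arg_gt0. Qed.

Lemma gT_gt_abs z : `|z.1| < gT z.
Proof.
rewrite -(ltr_pXn2r (n := 2)) ?nnegrE ?normr_ge0 ?(ltW (gT_gt0 _))//.
by rewrite gT_sqr real_normK ?num_real//; have := sqr_ge0 z.2; lra.
Qed.

(** The Lorentz boost along the first axis, with [c] and [s] the hyperbolic cosine and sine of the
    rapidity; the rapidity itself never appears, only $c^2-s^2=1$ and $c>0$. *)
Definition boost (c s : R) z : P := (c * z.1 + s * gT z, z.2).

Lemma boost_pos c s z : c ^+ 2 - s ^+ 2 = 1 -> 0 < c -> 0 < s * z.1 + c * gT z.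
Proof.
move=> cs c0; have := gT_gt_abs z; have := gT_gt0 z.
have sc : `|s| < c.
  rewrite -(ltr_pXn2r (n := 2)) ?nnegrE ?normr_ge0 ?(ltW c0)//.
  by rewrite real_normK ?num_real//; lra.
move=> T0 xT; have : `|s * z.1| < c * gT z.
  by rewrite normrM ltr_pM ?normr_ge0.
by rewrite ltr_norml => /andP[]; lra.
Qed.

Lemma gT_boost c s z : c ^+ 2 - s ^+ 2 = 1 -> 0 < c ->
  gT (boost c s z) = s * z.1 + c * gT z.
Proof.
move=> cs c0; have p := boost_pos z cs c0.
rewrite -[RHS](ger0_norm (ltW p)) -sqrtr_sqr; congr Num.sqrt => /=.
have -> : 1 + (c * z.1 + s * gT z) ^+ 2 + z.2 ^+ 2 =
  1 + c ^+ 2 * z.1 ^+ 2 + 2 * c * s * z.1 * gT z + s ^+ 2 * gT z ^+ 2 + z.2 ^+ 2 by ring.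
have -> : (s * z.1 + c * gT z) ^+ 2 =
  s ^+ 2 * z.1 ^+ 2 + 2 * c * s * z.1 * gT z + c ^+ 2 * gT z ^+ 2 by ring.
have -> : c ^+ 2 = 1 + s ^+ 2 by lra.
by rewrite gT_sqr; ring.
Qed.

Lemma boostK c s z : c ^+ 2 - s ^+ 2 = 1 -> 0 < c ->
  boost c s (boost c (- s) z) = z.
Proof.
move=> cs c0; rewrite {1}/boost gT_boost ?sqrrN//=.
case: z => x y /=; congr pair.
transitivity ((c ^+ 2 - s ^+ 2) * x); first ring.
by rewrite cs mul1r.
Qed.

Lemma measurable_fst' : measurable_fun setT (fun z : P => z.1).
Proof. exact: measurable_fst. Qed.

Lemma measurable_snd' : measurable_fun setT (fun z : P => z.2).
Proof. exact: measurable_snd. Qed.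

Hint Resolve measurable_fst' measurable_snd' : core.

Lemma measurable_sqrt : measurable_fun setT (@Num.sqrt R).
Proof. by apply: continuous_measurable_fun; exact: sqrt_continuous. Qed.

Lemma measurable_invr : measurable_fun setT (@GRing.inv R).
Proof.
have -> : [set: R] = [set~ 0] `|` [set 0] by rewrite setUC setUv.
apply/measurable_funU; [exact: measurableC| |split].
- by [].
- apply: open_continuous_measurable_fun; first exact/closed_openC/closed_eq.
  by move=> x; rewrite inE /= => /eqP x0; exact: inv_continuous.
- exact: measurable_fun_set1.
Qed.

Lemma measurable_gT : measurable_fun setT gT.
Proof.
apply: (measurableT_comp measurable_sqrt).
apply: measurable_funD; last exact: measurable_funX.
by apply: measurable_funD => //; exact: measurable_funX.
Qed.

Lemma measurable_cabs : measurable_fun setT (@cabs R).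
Proof.
apply: (measurableT_comp measurable_sqrt).
by apply: measurable_funD; exact: measurable_funX.
Qed.

Lemma measurable_boost c s : measurable_fun setT (boost c s).
Proof.
apply: measurable_fun_pair => //; apply: measurable_funD.
  exact: measurable_funM.
by apply: measurable_funM => //; exact: measurable_gT.
Qed.

Local Open Scope ereal_scope.

(** At fixed $Y$ the derivative of $X\mapsto cX+sT$ is $c+sX/T=T'/T$, where $T'$ is the time
    coordinate of the image; hence $dX'/T'=dX/T$. *)
Lemma integral_boost c s F : (c ^+ 2 - s ^+ 2 = 1)%R -> (0 < c)%R ->
  measurable_fun setT F -> (forall z, 0 <= F z) ->
  \int[leb2]_z (F (boost c s z) * ((gT z)^-1)%R%:E) = \int[leb2]_z (F z * ((gT z)^-1)%R%:E).
Proof.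
move=> cs c0 mF F0.
have miT : measurable_fun setT (fun z : P => (gT z)^-1)%R.
  by apply: (measurableT_comp measurable_invr); exact: measurable_gT.
pose G z := F z * ((gT z)^-1)%R%:E.
pose phi (z : P) := (c * z.1 + s * gT z)%R.
pose psi (z : P) := (c + s * (z.1 / gT z))%R.
have psiE z : psi z = ((s * z.1 + c * gT z) / gT z)%R.
  by rewrite /psi; have := gT_gt0 z => T0; field; rewrite gt_eqF.
have := @integral_fiber1 R setT setT phi psi G measurableT measurableT.
rewrite setXTT => <- //.
- apply: eq_integral => z _; rewrite /G -[(phi z, z.2)]/(boost c s z).
  rewrite gT_boost// -muleA -EFinM; congr (_ * _%:E).
  rewrite psiE; have := boost_pos z cs c0; have := gT_gt0 z => T0 p0.
  by field; rewrite !gt_eqF.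
- apply: measurable_funD; first exact: measurable_funM.
  by apply: measurable_funM => //; exact: measurable_gT.
- apply: measurable_funD => //; apply: measurable_funM => //.
  exact: measurable_funM.
- move=> y _; rewrite ysectionE preimage_setT.
  have dT (x : R) : is_derive x 1%R (fun t => gT (t, y)) (x / gT (x, y))%R.
    have T0 := gT_gt0 (x, y).
    rewrite /gT /=; apply: isd_eq.
      apply: isd_sqrt; first exact: (gT_arg_gt0 (x, y)).
      apply: isdD; last exact: isd_cst.
      apply: isdD; first exact: isd_cst.
      by apply: isdX2; exact: isd_id.
    move: T0; rewrite /gT /=; set T := Num.sqrt _ => T0.
    by field; rewrite gt_eqF.
  split.
  + by move=> ? ? _ _ ? _.
  + move=> x _; rewrite psiE divr_gt0 ?gT_gt0//.
    exact: (boost_pos (x, y) cs c0).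
  + move=> x _; apply: isd_eq.
      apply: isdD; apply: isdM; [exact: isd_cst|exact: isd_id|exact: isd_cst|exact: dT].
    by rewrite /psi /=; ring.
  + move=> x _; apply: isd_cont.
    apply: isdD; first exact: isd_cst.
    apply: isdM; first exact: isd_cst.
    apply: isdM; first exact: isd_id.
    by apply: isdV; [rewrite gt_eqF// gT_gt0|exact: dT].
  + move=> u; exists (boost c (- s) (u, y)).1 => //.
    by have := congr1 fst (boostK (u, y) cs c0).
- by apply: emeasurable_funM => //; exact/measurable_EFinP.
- by move=> z; rewrite mule_ge0// lee_fin invr_ge0 ltW// gT_gt0.
Qed.

Definition rotcs (c s : R) z : P := (c * z.1 - s * z.2, s * z.1 + c * z.2)%R.

Lemma measurable_rotcs c s : measurable_fun setT (rotcs c s).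
Proof.
apply: measurable_fun_pair.
  by apply: measurable_funB; exact: measurable_funM.
by apply: measurable_funD; exact: measurable_funM.
Qed.

(** The rotation is the composite of $(x,y)\mapsto(cx-sy,y)$ and $(x',y)\mapsto(x',(sx'+y)/c)$,
    whose Jacobians $c$ and $1/c$ cancel. The division is what asks for a nonzero cosine. *)
Lemma integral_rotcs_pos c s F : (c ^+ 2 + s ^+ 2 = 1)%R -> (0 < c)%R ->
  measurable_fun setT F -> (forall z, 0 <= F z) ->
  \int[leb2]_z F (rotcs c s z) = \int[leb2]_z F z.
Proof.
move=> cs c0 mF F0.
have cn0 : c != 0%R by rewrite gt_eqF.
pose phi2 (z : P) := ((s * z.1 + z.2) / c)%R.
have mphi2 : measurable_fun setT phi2.
  apply: measurable_funM => //; apply: measurable_funD => //.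
  exact: measurable_funM.
pose G z := F (z.1, phi2 z) * (c^-1)%R%:E.
have mG : measurable_fun setT G.
  by apply: emeasurable_funM => //; apply: (measurableT_comp mF); exact: measurable_fun_pair.
have := @integral_fiber1 R setT setT (fun z => c * z.1 - s * z.2)%R (cst c) G measurableT measurableT.
rewrite setXTT => E; have {}E := E _ _ _ _ mG _.
transitivity (\int[leb2]_z G z).
  rewrite -E//.
  - apply: eq_integral => z _; rewrite /G -muleA -EFinM mulVf// mule1.
    congr F; rewrite /rotcs /phi2 /=; congr pair.
    apply: (mulIf cn0); rewrite divfK//.
    transitivity (s * (c * z.1 - s * z.2) + (c ^+ 2 + s ^+ 2) * z.2)%R; first ring.
    by rewrite cs mul1r.
  - by apply: measurable_funB; exact: measurable_funM.
  - move=> y _; rewrite ysectionE preimage_setT; split => //.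
    + move=> x _ /=; apply: isd_eq.
        apply: isdD; last exact: isd_cst.
        apply: isdM; [exact: isd_cst|exact: isd_id].
      by rewrite /cst; ring.
    + by move=> x _; exact: cst_continuous.
    + move=> u; exists ((u + s * y) / c)%R => //=.
      by rewrite mulrC divfK// addrK.
  - by move=> z; rewrite mule_ge0// lee_fin invr_ge0 ltW.
have := @integral_fiber2 R setT setT phi2 (cst c^-1)%R F measurableT measurableT.
rewrite setXTT => <- //.
move=> x _; rewrite xsectionE preimage_setT; split => //.
- by move=> ? _; rewrite invr_gt0.
- move=> y _; rewrite /phi2 /=; apply: isd_eq.
    apply: isdM; last exact: isd_cst.
    by apply: isdD; [exact: isd_cst|exact: isd_id].
  by rewrite /cst /=; ring.
- by move=> y _; exact: cst_continuous.
- move=> u; exists (c * u - s * x)%R => //=.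
  by rewrite /phi2 /= addrCA subrr addr0 mulrC mulKf.
Qed.

(** A quarter of an angle below $2\pi$ is below $\pi/2$ and has positive cosine, so
    [integral_rotcs_pos] is applied four times. *)
Lemma integral_rot t F : (0 <= t < 2 * pi)%R ->
  measurable_fun setT F -> (forall z, 0 <= F z) ->
  \int[leb2]_z F (cmul (cexpi t) z) = \int[leb2]_z F z.
Proof.
move=> /andP[t0 t1] mF F0; pose q := (t / 4)%R.
have q0 : (0 < cos q)%R.
  apply: cos_gt0_pihalf; apply/andP; split; rewrite /q; have := @pi_gt0 R; lra.
have rE z : cmul (cexpi q) z = rotcs (cos q) (sin q) z.
  by rewrite /cmul /rotcs /=; congr pair; ring.
have E z : cmul (cexpi t) z =
    rotcs (cos q) (sin q) (rotcs (cos q) (sin q) (rotcs (cos q) (sin q) (rotcs (cos q) (sin q) z))).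
  rewrite -!rE !cmulA; congr cmul; rewrite !cexpiD; congr cexpi; rewrite /q; lra.
under eq_integral do rewrite E.
have mr := measurable_rotcs (cos q) (sin q).
have mFr (G : P -> \bar R) : measurable_fun setT G -> measurable_fun setT (fun z => G (rotcs (cos q) (sin q) z)).
  by move=> mG; exact: (measurableT_comp mG).
have H (G : P -> \bar R) : measurable_fun setT G -> (forall z, 0 <= G z) ->
    \int[leb2]_z G (rotcs (cos q) (sin q) z) = \int[leb2]_z G z.
  by move=> mG G0; apply: integral_rotcs_pos => //; exact: cos2Dsin2.
rewrite (H (fun z => F (rotcs (cos q) (sin q) (rotcs (cos q) (sin q) (rotcs (cos q) (sin q) z)))))//; last first.
  exact: (mFr _ (mFr _ (mFr _ mF))).
rewrite (H (fun z => F (rotcs (cos q) (sin q) (rotcs (cos q) (sin q) z))))//; last exact: (mFr _ (mFr _ mF)).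
by rewrite (H (fun z => F (rotcs (cos q) (sin q) z)))// ?H//; exact: (mFr _ mF).
Qed.

End Gans.

(** * Invariance of the hyperbolic area *)

Ltac meas := repeat first
  [ exact: measurable_fst' | exact: measurable_snd' | exact: measurable_cst
  | exact: measurable_gT | exact: measurable_cabs
  | apply: measurable_funM | apply: measurable_funX
  | apply: measurable_funD | apply: measurable_funB | apply: measurable_funN
  | apply: (measurableT_comp measurable_invr)
  | apply: (measurableT_comp measurable_sqrt)
  | apply: measurable_fun_pair ].

Section Hyperbolic.
Context {R : realType}.
Notation P := (R * R)%type.
Implicit Types (F : P -> \bar R) (z : P).

Lemma measurable_disk : measurable (@disk R).
Proof.
have -> : @disk R = setT `&` @cabs R @^-1` `]-oo, 1[%classic.
  by rewrite setTI; apply/seteqP; split => z; rewrite /disk /= in_itv.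
exact: measurable_cabs.
Qed.

Definition qd z : R := 1 - z.1 ^+ 2 - z.2 ^+ 2.

Lemma qdE z : 1 - cabs z ^+ 2 = qd z.
Proof. by rewrite cabs_sqr /qd; ring. Qed.

Lemma disk_qd z : disk z <-> 0 < qd z.
Proof. by rewrite -qdE; exact: disk_sqr. Qed.

Definition gans z : P := (2 * z.1 / qd z, 2 * z.2 / qd z).
Definition gans_inv z : P := (z.1 / (1 + gT z), z.2 / (1 + gT z)).

Lemma measurable_gans : measurable_fun setT gans.
Proof. by rewrite /gans /qd; meas. Qed.

Lemma measurable_gans_inv : measurable_fun setT gans_inv.
Proof. by rewrite /gans_inv; meas. Qed.

Lemma gT_gans z : disk z -> gT (gans z) = (1 + z.1 ^+ 2 + z.2 ^+ 2) / qd z.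
Proof.
move/disk_qd => q0.
rewrite -[RHS]ger0_norm; last by rewrite divr_ge0 ?ltW// gT_arg_gt0.
rewrite -sqrtr_sqr; congr Num.sqrt; rewrite /gans /=.
have : qd z != 0 by rewrite gt_eqF.
by rewrite /qd => ?; field.
Qed.

Lemma gans_invK z : disk z -> gans_inv (gans z) = z.
Proof.
move=> dz; rewrite /gans_inv gT_gans//; move/disk_qd: dz => q0.
have q0' : qd z != 0 by rewrite gt_eqF.
have -> : 1 + (1 + z.1 ^+ 2 + z.2 ^+ 2) / qd z = 2 / qd z.
  by move: q0'; rewrite /qd => ?; field.
by case: z q0 q0' => x y q0 q0'; rewrite /gans /=; congr pair; field; rewrite q0'.
Qed.

Lemma itv11_sqr (x : R) : (`]-1, 1[%classic : set R) x <-> 0 < 1 - x ^+ 2.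
Proof.
rewrite /= in_itv /= -ltr_norml subr_gt0 -(real_normK (num_real x)).
by rewrite expr_lt1.
Qed.

(** The chart [gans] in two moves: $(x,y)\mapsto(x,Y)$ with $Y$ given by [gphi1], then
    $(x,Y)\mapsto(X,Y)$ with $X$ given by [gphi2]. The intermediate domain is the strip $|x|<1$;
    [gpsi1] and [gpsi2] are the partial derivatives in the moving coordinate. *)
Definition gphi1 z : R := 2 * z.2 / qd z.
Definition gpsi1 z : R := 2 * (1 - z.1 ^+ 2 + z.2 ^+ 2) / qd z ^+ 2.
(** The root of the reduced discriminant of $Yy^2+2y-Y(1-x^2)=0$, the equation for $y$ in terms of
    $(x,Y)$. *)
Definition gS z : R := Num.sqrt (1 + z.2 ^+ 2 * (1 - z.1 ^+ 2)).
Definition gphi2 z : R := z.1 * (1 + gS z) / (1 - z.1 ^+ 2).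
Definition gpsi2 z : R := (1 + gS z) * (gS z + z.1 ^+ 2) / (gS z * (1 - z.1 ^+ 2) ^+ 2).

Lemma gS_eq z (s : R) : 0 <= s -> s ^+ 2 = 1 + z.2 ^+ 2 * (1 - z.1 ^+ 2) -> gS z = s.
Proof. by move=> s0 h; rewrite /gS -h sqrtr_sqr ger0_norm. Qed.

Lemma gS_gt0 z : 0 < 1 - z.1 ^+ 2 -> 0 < gS z.
Proof.
by move=> h; rewrite sqrtr_gt0 ltr_wpDr// mulr_ge0 ?sqr_ge0// ltW.
Qed.

Lemma gpsi2_gt0 z : 0 < 1 - z.1 ^+ 2 -> 0 < gpsi2 z.
Proof.
move=> h; have S0 := gS_gt0 h; apply: divr_gt0.
  by apply: mulr_gt0; [exact: addr_gt0|rewrite ltr_wpDr// sqr_ge0].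
by apply: mulr_gt0 => //; exact: exprn_gt0.
Qed.

Lemma fiber_change1 (x : R) : `]-1, 1[%classic x ->
  fiber_change (xsection (@disk R) x) (fun y => gphi1 (x, y)) (fun y => gpsi1 (x, y)).
Proof.
move/itv11_sqr => x1.
have secE y : xsection (@disk R) x y <-> 0 < qd (x, y).
  by rewrite /xsection /= inE disk_qd.
have dq y : isd y (fun t => qd (x, t)) (- (2 * y)).
  apply: isd_eq.
    rewrite /qd /=; apply: isdD; first exact: isd_cst.
    by apply: isdN; apply: isdX2; exact: isd_id.
  by rewrite /=; ring.
split.
- move=> y1 y2 /secE h1 /secE h2 y /andP[y1y yy2]; apply/secE.
  move: h1 h2; rewrite /qd /=.
  case: (lerP 0 y) => y0; nra.
- move=> y /secE h; rewrite /gpsi1 divr_gt0 ?exprn_gt0//=.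
  by rewrite mulr_gt0//; have := sqr_ge0 y; lra.
- move=> y /secE h; apply: isd_eq.
    apply: isdM; last by apply: isdV; [rewrite gt_eqF|exact: dq].
    by apply: isdM; [exact: isd_cst|exact: isd_id].
  have : qd (x, y) != 0 by rewrite gt_eqF.
  by rewrite /gpsi1 /qd /= => ?; field.
- move=> y /secE h; apply: isd_cont.
  apply: isdM; last first.
    apply: isdV; first by rewrite expf_neq0// gt_eqF.
    by apply: isdX2; exact: dq.
  apply: isdM; first exact: isd_cst.
  rewrite /=; apply: isdD; first exact: isd_cst.
  by apply: isdX2; exact: isd_id.
(* The preimage of $Y$ solves $Yy^2+2y-Y(1-x^2)=0$. The root is taken in the form $Y(1-x^2)/(1+S)$,
   which stays meaningful at $Y=0$. *)
move=> Y; pose S := gS (x, Y).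
have S0 : 0 < S by exact: gS_gt0.
have SE : S ^+ 2 = 1 + Y ^+ 2 * (1 - x ^+ 2).
  by rewrite sqr_sqrtr//= addr_ge0// mulr_ge0 ?sqr_ge0// ltW.
have qE : qd (x, Y * (1 - x ^+ 2) / (1 + S)) = 2 * (1 - x ^+ 2) / (1 + S).
  have n1 : 1 + S != 0 by rewrite gt_eqF// addr_gt0.
  rewrite /qd /=; apply/eqP; rewrite -subr_eq0; apply/eqP.
  have -> : 1 - x ^+ 2 - (Y * (1 - x ^+ 2) / (1 + S)) ^+ 2 - 2 * (1 - x ^+ 2) / (1 + S) =
    (1 - x ^+ 2) / (1 + S) ^+ 2 * (S ^+ 2 - (1 + Y ^+ 2 * (1 - x ^+ 2))) by field.
  by rewrite SE subrr mulr0.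
exists (Y * (1 - x ^+ 2) / (1 + S)).
  by apply/secE; rewrite qE; apply: divr_gt0; [exact: mulr_gt0|exact: addr_gt0].
rewrite /gphi1 qE /=; field.
by rewrite !gt_eqF// addr_gt0.
Qed.

Lemma fiber_change2 (y : R) :
  fiber_change (ysection (`]-1, 1[%classic `*` [set: R]) y)
    (fun x => gphi2 (x, y)) (fun x => gpsi2 (x, y)).
Proof.
have secE (x : R) : ysection (`]-1, 1[%classic `*` [set: R]) y x <-> 0 < 1 - x ^+ 2.
  rewrite /ysection /= inE; split => [[h _]|h]; first exact: (itv11_sqr x).1.
  by split => //; exact: (itv11_sqr x).2.
have dm x : isd x (fun t => 1 - t ^+ 2) (- (2 * x)).
  apply: isd_eq.
    apply: isdD; first exact: isd_cst.
    by apply: isdN; apply: isdX2; exact: isd_id.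
  by rewrite /=; ring.
have SE x : 0 < 1 - x ^+ 2 -> gS (x, y) ^+ 2 = 1 + y ^+ 2 * (1 - x ^+ 2).
  by move=> h; rewrite sqr_sqrtr//= addr_ge0// mulr_ge0 ?sqr_ge0// ltW.
have dS x : 0 < 1 - x ^+ 2 -> isd x (fun t => gS (t, y)) (- y ^+ 2 * x / gS (x, y)).
  move=> h; have S0 := gS_gt0 (z := (x, y)) h.
  rewrite /gS /=; apply: isd_eq.
    apply: isd_sqrt; first by rewrite ltr_wpDr//= mulr_ge0 ?sqr_ge0// ltW.
    apply: isdD; first exact: isd_cst.
    by apply: isdM; [exact: isd_cst|exact: dm].
  move: S0; rewrite /gS /=; set S := Num.sqrt _ => S0.
  by field; rewrite gt_eqF.
split.
- move=> x1 x2 /secE h1 /secE h2 x /andP[x1x xx2]; apply/secE.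
  case: (lerP 0 x) => x0; nra.
- by move=> x /secE h; exact: gpsi2_gt0.
- move=> x /secE h; have S0 := gS_gt0 (z := (x, y)) h; apply: isd_eq.
    apply: isdM; last by apply: isdV; [rewrite gt_eqF|exact: dm].
    apply: isdM; first exact: isd_id.
    by apply: isdD; [exact: isd_cst|exact: dS].
  rewrite /gpsi2 /=; set S := gS _ in S0 *; have hS := SE _ h.
  rewrite -/S in hS.
  have m0 : 1 - x ^+ 2 != 0 by rewrite gt_eqF.
  have Sn : S != 0 by rewrite gt_eqF.
  have -> : y ^+ 2 = (S ^+ 2 - 1) / (1 - x ^+ 2).
    by rewrite hS addrAC subrr add0r mulfK.
  by field; rewrite m0 Sn.
- move=> x /secE h; have S0 := gS_gt0 (z := (x, y)) h; apply: isd_cont.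
  apply: isdM; last first.
    apply: isdV; first by rewrite gt_eqF// mulr_gt0// exprn_gt0.
    by apply: isdM; [exact: dS|apply: isdX2; exact: dm].
  apply: isdM.
    by apply: isdD; [exact: isd_cst|exact: dS].
  by apply: isdD; [exact: dS|apply: isdX2; exact: isd_id].
(* The preimage of $X$ is $X/(1+T)$, the first coordinate of [gans_inv] at $(X,y)$. *)
move=> X; pose T := gT (X, y).
have T0 : 0 < T by exact: gT_gt0.
have TE : T ^+ 2 = 1 + X ^+ 2 + y ^+ 2 by exact: gT_sqr.
have n1 : 1 + T != 0 by rewrite gt_eqF// addr_gt0.
have mE : 1 - (X / (1 + T)) ^+ 2 = (2 + 2 * T + y ^+ 2) / (1 + T) ^+ 2.
  have -> : 2 + 2 * T + y ^+ 2 = (1 + T) ^+ 2 - X ^+ 2.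
    rewrite (_ : (1 + T) ^+ 2 = 1 + 2 * T + T ^+ 2); last ring.
    by rewrite TE; ring.
  by field.
have m0 : 0 < 2 + 2 * T + y ^+ 2 by rewrite ltr_wpDr ?sqr_ge0// addr_gt0// mulr_gt0.
exists (X / (1 + T)).
  by apply/secE; rewrite mE divr_gt0// exprn_gt0// addr_gt0.
have SV : gS (X / (1 + T), y) = 1 + y ^+ 2 / (1 + T).
  apply: gS_eq; first by rewrite addr_ge0// divr_ge0 ?sqr_ge0// addr_ge0// ltW.
  by rewrite /= mE; field.
rewrite /gphi2 SV /= mE; field.
by rewrite n1 !gt_eqF// mulr_gt0.
Qed.

Local Open Scope ereal_scope.

(** The two Jacobians multiply to $4T$ times [hden]. The 4 appears because the metric
    $|dz|^2/(1-|z|^2)^2$ has curvature $-4$, while the hyperboloid has curvature $-1$. *)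
Lemma integral_gans F : measurable_fun setT F -> (forall z, 0 <= F z) ->
  \int[leb2]_(z in @disk R) (F (gans z) * (4 * hden z)%:E) =
  \int[leb2]_z (F z * ((gT z)^-1)%R%:E).
Proof.
move=> mF F0.
pose I1 : set R := `]-1, 1[%classic%R.
pose I2 : set P := I1 `*` [set: R].
have mI2 : measurable I2 by apply: measurableX => //; exact: measurable_itv.
have I2P z : I2 z <-> (0 < 1 - z.1 ^+ 2)%R.
  split => [[h _]|h]; first exact: (itv11_sqr z.1).1.
  by split => //; exact: (itv11_sqr z.1).2.
pose F' z := F z * ((gT z)^-1)%R%:E.
have mF' : measurable_fun setT F'.
  by apply: emeasurable_funM => //; apply/measurable_EFinP; meas.
have F'0 z : 0 <= F' z by rewrite mule_ge0// lee_fin invr_ge0 ltW// gT_gt0.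
have mphi2 : measurable_fun setT gphi2 by rewrite /gphi2 /gS; meas.
have mpsi2 : measurable_fun setT gpsi2 by rewrite /gpsi2 /gS; meas.
have := @integral_fiber1 R I2 setT gphi2 gpsi2 F' mI2 measurableT mphi2 mpsi2.
rewrite setXTT => <- //; last by move=> y _; exact: fiber_change2.
pose G := (fun z => F' (gphi2 z, z.2) * (gpsi2 z)%:E) \_ I2.
have mG : measurable_fun setT G.
  apply/(measurable_restrictT _ _).1 => //; apply/measurable_funTS/emeasurable_funM.
    by apply: (measurableT_comp mF'); apply: measurable_fun_pair => //; exact: measurable_snd.
  exact/measurable_EFinP.
have G0 z : 0 <= G z.
  rewrite /G patchE; case: ifPn => //; rewrite inE => /I2P h.
  by rewrite mule_ge0// lee_fin ltW// gpsi2_gt0.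
have := @integral_fiber2 R (@disk R) I1 gphi1 gpsi1 G measurable_disk
  (measurable_itv _).
have mphi1 : measurable_fun setT gphi1 by rewrite /gphi1 /qd; meas.
have mpsi1 : measurable_fun setT gpsi1 by rewrite /gpsi1 /qd; meas.
move=> /(_ mphi1 mpsi1) E.
transitivity (\int[leb2]_(z in I2) G z); last first.
  by apply: eq_integral => z zI; rewrite /G patchE zI.
rewrite -E//; last first.
- by move=> x /fiber_change1.
- move=> z /disk_qd; rewrite /qd => h; apply/itv11_sqr.
  by have := sqr_ge0 z.2; lra.
apply: eq_integral => -[x y]; rewrite inE => dz; have := dz; move/disk_qd => q0.
have x0 : (0 < 1 - x ^+ 2)%R.
  by move: q0; rewrite /qd /=; have := sqr_ge0 y; lra.
have w0 : (0 < 1 - x ^+ 2 + y ^+ 2)%R by have := sqr_ge0 y; lra.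
have qn : (1 - x ^+ 2 - y ^+ 2 != 0)%R by rewrite gt_eqF.
have x0' : (1 - x ^+ 2 != 0)%R by rewrite gt_eqF.
have w0' : (1 - x ^+ 2 + y ^+ 2 != 0)%R by rewrite gt_eqF.
have t0 : (1 + x ^+ 2 + y ^+ 2 != 0)%R by rewrite gt_eqF// (gT_arg_gt0 (x, y)).
have SV : gS (x, gphi1 (x, y)) = ((1 - x ^+ 2 + y ^+ 2) / (1 - x ^+ 2 - y ^+ 2))%R.
  apply: gS_eq; first by rewrite divr_ge0 ?ltW.
  by rewrite /gphi1 /= /qd /=; field.
have phiV : (gphi2 (x, gphi1 (x, y)), gphi1 (x, y)) = gans (x, y).
  rewrite /gans /gphi2 SV /=; congr pair.
  by rewrite /qd /=; field; rewrite qn x0'.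
rewrite /G patchE mem_set; last exact/I2P.
rewrite /= phiV /F' -!muleA -!EFinM; congr (_ * _%:E).
rewrite gT_gans// /gpsi2 /gpsi1 /hden SV qdE /= /qd /=.
by field; rewrite qn x0' w0' t0.
Qed.

End Hyperbolic.

Section Invariance.
Context {R : realType}.
Notation P := (R * R)%type.
Implicit Types (F : P -> \bar R) (z a e : P).
Local Open Scope ereal_scope.
Local Arguments complex.conjc : simpl never.
Local Arguments toC : simpl never.

Lemma gT_rot e z : cabs e = 1%R -> gT (cmul e z) = gT z.
Proof.
move=> e1; congr Num.sqrt; rewrite -!addrA; congr (1 + _)%R.
by rewrite -!cabs_sqr cabsM e1 mul1r.
Qed.

Lemma gans_rot e z : cabs e = 1%R -> gans (cmul e z) = cmul e (gans z).
Proof.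
move=> e1; rewrite /gans -!qdE cabsM e1 mul1r /cmul /=.
by congr pair; ring.
Qed.

Lemma mobe_real (rho x y : R) : ((1 - rho * x) ^+ 2 + (rho * y) ^+ 2 != 0)%R ->
  mobe (rho, 0%R) cone (x, y) =
  (((x - rho) * (1 - rho * x) - rho * y ^+ 2) / ((1 - rho * x) ^+ 2 + (rho * y) ^+ 2),
   (y * (1 - rho ^+ 2)) / ((1 - rho * x) ^+ 2 + (rho * y) ^+ 2))%R.
Proof.
move=> D0; rewrite /mobe cmul1 /cdiv /cinv /csub /cmul /cconj /=.
have -> : (1 - (rho * x - - 0 * y) = 1 - rho * x)%R by ring.
have -> : (0 - (rho * y + - 0 * x) = - (rho * y))%R by ring.
by rewrite sqrrN; congr pair; field.
Qed.

(** With $\rho=\tanh t$ the coefficients are $\cosh 2t$ and $-\sinh 2t$. *)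
Lemma gans_boost (rho : R) z : (0 <= rho < 1)%R -> disk z ->
  gans (mobe (rho, 0%R) cone z) =
  boost ((1 + rho ^+ 2) / (1 - rho ^+ 2)) (- (2 * rho) / (1 - rho ^+ 2)) (gans z).
Proof.
case: z => x y /andP[r0 r1] dz.
have q0 := (disk_qd _).1 dz; rewrite /qd /= in q0.
have p0 : (1 - rho ^+ 2 != 0)%R by rewrite gt_eqF// subr_gt0 expr_lt1.
have D0 : ((1 - rho * x) ^+ 2 + (rho * y) ^+ 2 != 0)%R.
  rewrite gt_eqF// ltr_wpDr ?sqr_ge0// exprn_gt0// subr_gt0.
  have := le_lt_trans (ler_abs_cabs1 _) dz; rewrite /= ltr_norml => /andP[_ x1].
  nra.
have qn : (1 - x ^+ 2 - y ^+ 2 != 0)%R by rewrite gt_eqF.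
rewrite mobe_real// /boost gT_gans// /gans /=.
have -> : qd (((x - rho) * (1 - rho * x) - rho * y ^+ 2) / ((1 - rho * x) ^+ 2 + (rho * y) ^+ 2),
   (y * (1 - rho ^+ 2)) / ((1 - rho * x) ^+ 2 + (rho * y) ^+ 2))%R =
   ((1 - rho ^+ 2) * (1 - x ^+ 2 - y ^+ 2) / ((1 - rho * x) ^+ 2 + (rho * y) ^+ 2))%R.
  by rewrite /qd /=; field.
by rewrite /qd /=; congr pair; field; rewrite D0 qn p0.
Qed.

Lemma measurable_cmul e : measurable_fun setT (cmul e).
Proof. by rewrite /cmul; meas. Qed.

Lemma integral_gT_rot e F : cabs e = 1%R ->
  measurable_fun setT F -> (forall z, 0 <= F z) ->
  \int[leb2]_z (F (cmul e z) * ((gT z)^-1)%R%:E) = \int[leb2]_z (F z * ((gT z)^-1)%R%:E).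
Proof.
move=> e1 mF F0; have [t t2 et] := cexpi_onto e1.
rewrite -[RHS](@integral_rot _ t (fun z => F z * ((gT z)^-1)%R%:E))//.
- by apply: eq_integral => z _; rewrite -et gT_rot// cabs_expi.
- by apply: emeasurable_funM => //; apply/measurable_EFinP; meas.
- by move=> z; rewrite mule_ge0// lee_fin invr_ge0 ltW// gT_gt0.
Qed.

(** Writing $a=w\rho$ with $|w|=1$ splits the map into the rotation by $\bar w$, the real
    translation by $\rho$ and the rotation by $ew$. [B] is this composite with the translation
    replaced by its boost, and is defined on the whole plane. *)
Lemma mobe_gans a e : disk a -> cabs e = 1%R -> exists B : P -> P,
  [/\ measurable_fun setT B, forall z, disk z -> gans (mobe a e z) = B (gans z) &
    forall F, measurable_fun setT F -> (forall z, 0 <= F z) ->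
    \int[leb2]_z (F (B z) * ((gT z)^-1)%R%:E) = \int[leb2]_z (F z * ((gT z)^-1)%R%:E)].
Proof.
move=> da e1; pose rho := cabs a.
have [w w1 aw] : exists2 w, cabs w = 1%R & a = cmul w (rho, 0%R).
  have [a0|a0] := eqVneq a origin.
    exists cone; first exact: cabs1.
    by rewrite cmul1 /rho a0 cabs0.
  have r0 : (0 < rho)%R by rewrite cabs_gt0.
  exists (a.1 / rho, a.2 / rho)%R.
    have := cabs_sqr a; rewrite /cabs /= !expr_div_n -mulrDl => h.
    rewrite -[X in Num.sqrt (X / _)]h divff ?sqrtr1// expf_neq0// gt_eqF//.
  rewrite /cmul /= !mulr0 subr0 add0r !divfK ?gt_eqF//.
  by rewrite -surjective_pairing.
have [w0 wc] := conjc_unit w1.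
have rho01 : (0 <= rho < 1)%R by rewrite cabs_ge0.
pose c := ((1 + rho ^+ 2) / (1 - rho ^+ 2))%R.
pose s := (- (2 * rho) / (1 - rho ^+ 2))%R.
have p0 : (0 < 1 - rho ^+ 2)%R.
  by case/andP: rho01 => h0 h1; rewrite subr_gt0 expr_lt1.
have cs : (c ^+ 2 - s ^+ 2 = 1)%R by rewrite /c /s; field; rewrite gt_eqF.
have c0 : (0 < c)%R by rewrite divr_gt0// ltr_wpDr ?sqr_ge0.
have mE z : mobe a e z = cmul (cmul e w) (mobe (rho, 0%R) cone (cmul (cconj w) z)).
  apply: toC_inj; rewrite toC_mobe toCM toC_mobe aw !toCE !rmorphM /= wc.
  have -> : complex.conjc (toC (rho, 0%R)) = toC (rho, 0%R).
    by rewrite -toC_conj /cconj /= oppr0.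
  have -> : ((toC w)^-1 * toC (rho, 0) * toC z = toC (rho, 0) * ((toC w)^-1 * toC z))%R.
    by ring.
  rewrite mul1r; set D := (1 - _ : complex.complex R)%R.
  rewrite !mulrA; congr (_ / _)%R.
  rewrite -!mulrA; congr (_ * _)%R.
  by rewrite mulrBr mulrA divff// mul1r.
have eo1 : cabs (cmul e w) = 1%R by rewrite cabsM e1 w1 mulr1.
have co1 : cabs (cconj w) = 1%R by rewrite cabs_conj.
exists (fun z => cmul (cmul e w) (boost c s (cmul (cconj w) z))); split.
- apply: (measurableT_comp (measurable_cmul _)).
  apply: (measurableT_comp (measurable_boost _ _)); exact: measurable_cmul.
- move=> z dz; rewrite mE gans_rot// gans_boost// ?gans_rot//.
  by rewrite /disk /mkset cabsM co1 mul1r.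
- move=> F mF F0.
  have m1 : measurable_fun setT (fun z => F (cmul (cmul e w) z)).
    by apply: (measurableT_comp mF); exact: measurable_cmul.
  have m2 : measurable_fun setT (fun z => F (cmul (cmul e w) (boost c s z))).
    by apply: (measurableT_comp m1); exact: measurable_boost.
  rewrite (integral_gT_rot co1 m2)// (integral_boost cs c0 m1)//.
  exact: (integral_gT_rot eo1 mF).
Qed.

(** Extended by zero off [A] and carried to the plane by [gans], the integrand is composed with [B],
    which preserves $dX\,dY/T$; the factor 4 of the chart appears on both sides and cancels. *)
Lemma hint_mobe a e (A : set P) (g : P -> R) : disk a -> cabs e = 1%R ->
  measurable A -> A `<=` @disk R -> measurable_fun A g -> (forall z, A z -> (0 <= g z)%R) ->
  hint (@disk R `&` mobe a e @^-1` A) (g \o mobe a e) = hint A g.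
Proof.
move=> da e1 mA Ad mg g0.
pose gA : P -> \bar R := (EFin \o g) \_ A.
have mgA : measurable_fun setT gA.
  by apply/(measurable_restrictT _ _).1 => //; exact/measurable_EFinP.
have gA0 z : 0 <= gA z.
  by rewrite /gA patchE; case: ifPn => //; rewrite inE => /g0; rewrite lee_fin.
pose F z := gA (gans_inv z).
have mF : measurable_fun setT F.
  by apply: (measurableT_comp mgA); exact: measurable_gans_inv.
have F0 z : 0 <= F z by exact: gA0.
have [B [mB BE BI]] := mobe_gans da e1.
have hden0 z : (0 <= hden z)%R by rewrite invr_ge0 exprn_even_ge0.
have E1 : hint A g = \int[leb2]_(z in @disk R) (F (gans z) * (hden z)%:E).
  rewrite /hint [LHS]integral_mkcond [RHS]integral_mkcond; apply: eq_integral => z _.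
  rewrite !patchE; case: (boolP (z \in @disk R)) => dz.
    rewrite /F gans_invK; last by rewrite inE in dz.
    by rewrite /gA patchE; case: ifPn => zA; rewrite ?mul0e// EFinM.
  case: ifPn => //; rewrite inE => /Ad h.
  by move: dz; rewrite notin_setE.
have E2 : hint (@disk R `&` mobe a e @^-1` A) (g \o mobe a e) =
    \int[leb2]_(z in @disk R) (F (B (gans z)) * (hden z)%:E).
  rewrite /hint [LHS]integral_mkcond [RHS]integral_mkcond; apply: eq_integral => z _.
  rewrite !patchE; case: (boolP (z \in @disk R)) => dz.
    have dz' : disk z by rewrite inE in dz.
    rewrite -BE// /F gans_invK; last exact: mobe_disk.
    rewrite in_setI dz /= /gA patchE.
    rewrite -[z \in _ @^-1` _]/(mobe a e z \in A).
    by case: ifPn => zA; rewrite ?mul0e// EFinM.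
  by rewrite in_setI (negbTE dz).
have hE G : (forall z, 0 <= G z) -> measurable_fun setT G ->
    \int[leb2]_(z in @disk R) (G (gans z) * (4 * hden z)%:E) =
    4%:E * \int[leb2]_(z in @disk R) (G (gans z) * (hden z)%:E).
  move=> G0 mG; rewrite -ge0_integralZl//.
  - by apply: eq_integral => z _; rewrite muleCA -EFinM.
  - exact: measurable_disk.
  - apply: measurable_funTS; apply: emeasurable_funM.
      by apply: (measurableT_comp mG); exact: measurable_gans.
    by apply/measurable_EFinP; rewrite /hden; meas.
  - by move=> z _; rewrite mule_ge0// lee_fin.
have mFB : measurable_fun setT (fun z => F (B z)) by exact: (measurableT_comp mF).
have E4 := BI F mF F0.
rewrite -(integral_gans mF F0) -(@integral_gans _ (fun z => F (B z)) mFB)// in E4.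
move: E4; rewrite (hE (fun z => F (B z)))// hE// -E1 -E2 => /(congr1 (fun x => (4^-1)%R%:E * x)).
by rewrite !muleA -!EFinM mulVf ?mul1e.
Qed.

End Invariance.

(** * Cost function *)

(** The set $\{f<a\}$ is a countable union, over the dense points $Q_i$ in [D], of the measurable
    sets $\{f(Q_i)+L\,\mathrm{dist}(x,Q_i)<a\}$. Nothing is asked of [f] outside [D], which suits
    densities controlled on the disk alone. *)
Lemma lipschitz_measurable d (T : measurableType d) (R : realType) (I : countType)
    (Q : I -> T) (D : set T) (dist : T -> T -> R) (f : T -> R) (L : R) :
  measurable D -> (forall i, measurable_fun setT (fun x => dist x (Q i))) ->
  0 < L -> (forall x y, D x -> D y -> `|f x - f y| <= L * dist x y) ->
  (forall x e, D x -> 0 < e -> exists2 i, D (Q i) & dist x (Q i) < e) ->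
  measurable_fun D f.
Proof.
move=> mD md L0 lip dense _; apply: (measurability _ (RGenInftyO.measurableE R)) => //.
move=> _ [_ [a ->] <-].
pose B i := if `[< D (Q i) >]
  then D `&` (fun x => f (Q i) + L * dist x (Q i)) @^-1` `]-oo, a[%classic else set0.
have -> : D `&` f @^-1` `]-oo, a[%classic = \bigcup_i B i.
  apply/seteqP; split => [x [Dx]|x [i _]].
    rewrite /= in_itv /= => fa.
    (* The Lipschitz bound is spent twice: once to pass from $f(x)$ to $f(Q_i)$ and once for the
       added term. *)
    have e0 : 0 < (a - f x) / (2 * L) by rewrite divr_gt0 ?subr_gt0// mulr_gt0.
    have [i Di hi] := dense x _ Dx e0.
    exists i => //; rewrite /B; case: asboolP => // _; split => //=; rewrite in_itv /=.
    have := lip _ _ Dx Di; rewrite ler_norml => /andP[h _].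
    move: hi; rewrite ltr_pdivlMr ?mulr_gt0// => hi.
    have E : dist x (Q i) * (2 * L) = 2 * (L * dist x (Q i)) by ring.
    lra.
  rewrite /B; case: asboolP => // Di [Dx]; rewrite /= in_itv /= => h; split => //=.
  rewrite in_itv /=; apply: le_lt_trans h.
  by have := lip _ _ Dx Di; rewrite ler_norml => /andP[_]; lra.
apply: countable_bigcupT_measurable; first exact: countableP.
move=> i; rewrite /B; case: asboolP => // _.
have mf : measurable_fun D (fun x => f (Q i) + L * dist x (Q i)).
  apply: measurable_funTS; apply: measurable_funD => //; exact: measurable_funM.
by apply: mf => //; exact: measurable_itv.
Qed.

Section PlaneMeasure.
Context {R : realType}.
Notation P := (R * R)%type.
Implicit Types (z w u : P).

Definition ratP (q : rat * rat) : P := (ratr q.1, ratr q.2).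

Lemma ratP_dense z (e : R) : disk z -> 0 < e ->
  exists2 q, disk (ratP q) & cabs (csub z (ratP q)) < e.
Proof.
(* The minimum with $1-|z|$ keeps the rational point inside the disk; the half pays for adding the
   errors of the two coordinates. *)
move=> dz e0; pose d := Num.min e (1 - cabs z) / 2.
have d0 : 0 < d by rewrite divr_gt0// lt_min e0 subr_gt0.
have app x : exists q, `|x - ratr q| < d.
  have /rat_in_itvoo[q] : x - d < x + d by lra.
  by rewrite in_itv /= => /andP[h1 h2]; exists q; rewrite ltr_norml; apply/andP; split; lra.
have [q1 h1] := app z.1; have [q2 h2] := app z.2.
have hd : cabs (csub z (ratP (q1, q2))) < 2 * d.
  by apply: le_lt_trans (cabs_le_abs _) _ => /=; lra.
have d2 : 2 * d = Num.min e (1 - cabs z) by rewrite /d mulrC divfK.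
exists (q1, q2); last by apply: lt_le_trans hd _; rewrite d2 ge_min lexx.
rewrite /disk /mkset; apply: le_lt_trans (cabs_le_sub _ z) _.
rewrite cabs_subC -ltrBrDl; apply: lt_le_trans hd _.
by rewrite d2 ge_min lexx orbT.
Qed.

Lemma measurable_dist w : measurable_fun setT (fun z => cabs (csub z w)).
Proof. by apply: (measurableT_comp measurable_cabs); rewrite /csub; meas. Qed.

Lemma lip_disk_measurable (f : P -> R) (k : R) : 0 < k ->
  (forall x y, disk x -> disk y -> `|f x - f y| <= k * cabs (csub x y)) ->
  measurable_fun (@disk R) f.
Proof.
move=> k0 lip; apply: (@lipschitz_measurable _ _ _ _ ratP _ (fun x y => cabs (csub x y))) k0 lip _.
- exact: measurable_disk.
- by move=> i; exact: measurable_dist.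
- by move=> x e dx e0; exact: ratP_dense.
Qed.

Lemma measurable_mobe a e : measurable_fun setT (mobe a e : P -> P).
Proof.
have m1 (f : P -> P) : measurable_fun setT f -> measurable_fun setT (fun z => (f z).1).
  by move=> mf; exact: (measurableT_comp measurable_fst').
have m2 (f : P -> P) : measurable_fun setT f -> measurable_fun setT (fun z => (f z).2).
  by move=> mf; exact: (measurableT_comp measurable_snd').
have mM (f g : P -> P) : measurable_fun setT f -> measurable_fun setT g ->
    measurable_fun setT (fun z => cmul (f z) (g z)).
  move=> /[dup] /m1 f1 /m2 f2 /[dup] /m1 g1 /m2 g2.
  apply: measurable_fun_pair.
    by apply: measurable_funB; exact: measurable_funM.
  by apply: measurable_funD; exact: measurable_funM.
have mB (f g : P -> P) : measurable_fun setT f -> measurable_fun setT g ->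
    measurable_fun setT (fun z => csub (f z) (g z)).
  move=> /[dup] /m1 f1 /m2 f2 /[dup] /m1 g1 /m2 g2.
  by apply: measurable_fun_pair; exact: measurable_funB.
have mV (f : P -> P) : measurable_fun setT f -> measurable_fun setT (fun z => cinv (f z)).
  move=> /[dup] /m1 f1 /m2 f2.
  have h : measurable_fun setT (fun z => ((f z).1 ^+ 2 + (f z).2 ^+ 2)^-1).
    apply: (measurableT_comp measurable_invr).
    by apply: measurable_funD; exact: measurable_funX.
  by apply: measurable_fun_pair; apply: measurable_funM => //; exact: measurable_funN.
apply: (mM (cst e)) => //; apply: (mM _ _); first exact: (mB id (cst a)).
by apply: mV; apply: (mB (cst cone)) => //; exact: (mM (cst (cconj a)) id).
Qed.

Lemma tanh_gt0 (r : R) : 0 < r -> 0 < tanh r.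
Proof.
move=> r0; apply: divr_gt0; last by rewrite addr_gt0// expR_gt0.
by rewrite subr_gt0 ltr_expR; lra.
Qed.

Lemma tanh_lt1 (r : R) : tanh r < 1.
Proof.
rewrite /tanh ltr_pdivrMr ?mul1r ?addr_gt0 ?expR_gt0//.
by have := expR_gt0 (- r); lra.
Qed.

Lemma Omega0_disk (r : R) : Omega0 r `<=` @disk R.
Proof. by move=> z h; exact: le_lt_trans h (tanh_lt1 r). Qed.

Lemma measurable_Omega0 (r : R) : measurable (Omega0 r).
Proof.
have -> : Omega0 r = setT `&` @cabs R @^-1` `]-oo, tanh r]%classic.
  by rewrite setTI; apply/seteqP; split => z; rewrite /Omega0 /= in_itv.
exact: measurable_cabs.
Qed.

Lemma hden_ge0 z : 0 <= hden z.
Proof. by rewrite invr_ge0 exprn_even_ge0. Qed.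

Lemma measurable_hden (A : set P) : measurable_fun A (@hden R).
Proof. by apply: measurable_funTS; rewrite /hden; meas. Qed.

Local Open Scope ereal_scope.

Lemma measurable_hintE (A : set P) (f : P -> R) : measurable_fun A f ->
  measurable_fun A (fun x => (f x * hden x)%:E).
Proof. by move=> mf; apply/measurable_EFinP/measurable_funM => //; exact: measurable_hden. Qed.

Lemma hint_ge0 (A : set P) (f : P -> R) : (forall x, A x -> (0 <= f x)%R) -> 0 <= hint A f.
Proof. by move=> f0; apply: integral_ge0 => x Ax; rewrite lee_fin mulr_ge0 ?f0// hden_ge0. Qed.

Lemma hint_le_add (A : set P) (f g : P -> R) (c : R) : measurable A ->
  measurable_fun A f -> measurable_fun A g -> (0 <= c)%R ->
  (forall x, A x -> (0 <= f x)%R) -> (forall x, A x -> (0 <= g x)%R) ->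
  (forall x, A x -> (f x <= g x + c)%R) ->
  hint A f <= hint A g + c%:E * hint A (cst 1%R).
Proof.
move=> mA mf mg c0 f0 g0 fg.
have h0 (h : P -> R) : (forall x, A x -> (0 <= h x)%R) ->
    forall x, A x -> 0 <= (h x * hden x)%:E.
  by move=> hh x Ax; rewrite lee_fin mulr_ge0 ?hh// hden_ge0.
have mE (h : P -> R) : measurable_fun A h -> measurable_fun A (fun x => (h x * hden x)%:E).
  exact: measurable_hintE.
rewrite /hint -ge0_integralZl//; [|exact: mE|exact: h0].
rewrite -ge0_integralD//; [|exact: h0|exact: mE| |]; first last.
- by apply: emeasurable_funM => //; exact: mE.
- by move=> x Ax; rewrite mule_ge0// lee_fin ?mul1r ?hden_ge0.
apply: ge0_le_integral => //; [exact: h0|exact: mE| |].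
- by apply: emeasurable_funD; [exact: mE|apply: emeasurable_funM => //; exact: mE].
- move=> x Ax; rewrite -EFinM -EFinD lee_fin mul1r -mulrDl ler_wpM2r ?hden_ge0//.
  exact: fg.
Qed.

Lemma hint_le (A : set P) (f g : P -> R) : measurable A ->
  measurable_fun A f -> measurable_fun A g ->
  (forall x, A x -> (0 <= f x)%R) -> (forall x, A x -> (f x <= g x)%R) ->
  hint A f <= hint A g.
Proof.
move=> mA mf mg f0 fg; apply: ge0_le_integral => //.
- by move=> x Ax; rewrite lee_fin mulr_ge0 ?f0// hden_ge0.
- exact: measurable_hintE.
- exact: measurable_hintE.
- by move=> x Ax; rewrite lee_fin ler_wpM2r ?hden_ge0// fg.
Qed.

Lemma hint_cst (A : set P) (c : R) : measurable A -> (0 <= c)%R ->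
  hint A (cst c) = c%:E * hint A (cst 1%R).
Proof.
move=> mA c0; rewrite /hint -ge0_integralZl//.
- by apply: eq_integral => x _; rewrite -EFinM mul1r.
- exact: measurable_hintE.
- by move=> x Ax; rewrite lee_fin mul1r hden_ge0.
Qed.

(** The density is largest on the boundary circle, of radius $\tanh r<1$, and the disk lies in the
    square $[-1,1]^2$. *)
Lemma hint_Omega0_lty (r : R) : hint (Omega0 r) (cst 1%R) < +oo.
Proof.
have mO := measurable_Omega0 r.
case: (ltP (tanh r) 0%R) => [t0|t0].
  rewrite (_ : Omega0 r = set0) ?[hint _ _]integral_set0//.
  apply/seteqP; split => z //; rewrite /Omega0 /= => h.
  by have := cabs_ge0 z; rewrite leNgt (le_lt_trans h t0).
pose M := (((1 - tanh r ^+ 2) ^+ 2)^-1)%R.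
have t1 := tanh_lt1 r.
have p0 : (0 < 1 - tanh r ^+ 2)%R by rewrite subr_gt0 expr_lt1.
apply: (@le_lt_trans _ _ (\int[leb2]_(x in Omega0 r) (cst M%:E) x)).
  apply: ge0_le_integral => //.
  - by move=> x _; rewrite lee_fin mul1r hden_ge0.
  - exact: measurable_hintE.
  - move=> x Ox; have dx := (disk_sqr x).1 (Omega0_disk Ox).
    rewrite lee_fin mul1r lef_pV2 ?posrE ?exprn_gt0//.
    apply: lerXn2r; rewrite ?nnegrE ?(ltW p0) ?(ltW dx)// lerD2l lerN2.
    by apply: lerXn2r; rewrite ?nnegrE ?cabs_ge0.
rewrite integral_cst//.
pose B1 : set R := `[(-1)%R, 1%R]%classic.
pose B : set P := B1 `*` B1.
have mB : measurable B by apply: measurableX; exact: measurable_itv.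
apply: (@le_lt_trans _ _ (M%:E * leb2 B)).
  apply: lee_wpmul2l; first by rewrite lee_fin invr_ge0 exprn_even_ge0.
  apply: le_measure; rewrite ?inE//.
  move=> x /Omega0_disk dx; split; rewrite /B1 /= in_itv /= -ler_norml.
    exact: le_trans (ler_abs_cabs1 _) (ltW dx).
  exact: le_trans (ler_abs_cabs2 _) (ltW dx).
rewrite /leb2 product_measure1E//; try exact: measurable_itv.
change (M%:E * (@lebesgue_measure R B1 * @lebesgue_measure R B1) < +oo).
rewrite /B1 lebesgue_measure_itv /= lte_fin; case: ifPn => _; last by rewrite !mule0.
by rewrite -!EFinB -!EFinM ltry.
Qed.

End PlaneMeasure.

Lemma measurable_norm_comp d (T : measurableType d) (R : realType) (D : set T) (f : T -> R) :
  measurable_fun D f -> measurable_fun D (fun x => `|f x|).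
Proof. by move=> mf; exact: (@measurableT_comp _ _ _ _ _ _ (@Num.norm R R) D f). Qed.

Section CostFunction.
Context {R : realType}.
Notation P := (R * R)%type.
Implicit Types (z w u a b e f g : P).
Variables (mu nu : P -> R) (k r : R).
Hypothesis k0 : 0 < k.
Hypothesis mulip : forall x y, disk x -> disk y -> `|mu x - mu y| <= k * cabs (csub x y).
Hypothesis nulip : forall x y, disk x -> disk y -> `|nu x - nu y| <= k * cabs (csub x y).

Local Notation Om := (Omega0 r).
Local Notation rho := (tanh r).
Local Notation V := (hint Om (cst 1)).

(** The base maps $m_{a,e}$ and $m_{b,f}$ send the origin to $z$ and $w$. After the substitution
    $x=m_{a,e}(u)$ this is the integrand of $d^R$ for the competitor $m_{b,f}\circ g\circ
    m_{a,e}^{-1}$. *)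
Definition integrand a e b f g u := `|mu (mobe a e u) - nu (mobe b f (cmul g u))|.
Definition costJ a e b f g : \bar R := hint Om (integrand a e b f g).

Lemma disk_cmul g u : cabs g = 1 -> disk u -> disk (cmul g u).
Proof. by move=> g1; rewrite /disk /mkset cabsM g1 mul1r. Qed.

Lemma measurable_mobe_comp (h : P -> R) (A : set P) a e : disk a -> cabs e = 1 ->
  measurable_fun (@disk R) h -> A `<=` @disk R -> measurable_fun A (h \o mobe a e).
Proof.
move=> da e1 mh Ad; apply: measurable_comp mh _; first exact: measurable_disk.
- by move=> _ [u /Ad du <-]; exact: mobe_disk.
- by apply: measurable_funTS; exact: measurable_mobe.
Qed.

Lemma mobe_rot_disk b f g : disk b -> cabs f = 1 -> cabs g = 1 ->
  exists c h, [/\ disk c, cabs h = 1 & forall u, disk u -> mobe b f (cmul g u) = mobe c h u].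
Proof.
move=> db f1 g1; have [c [h [dc h1 E]]] := mobe_comp disk0 g1 db f1.
by exists c, h; split => // u du; rewrite -E// mobe0.
Qed.

Lemma measurable_integrand a e b f g : disk a -> cabs e = 1 -> disk b -> cabs f = 1 ->
  cabs g = 1 -> measurable_fun Om (integrand a e b f g).
Proof.
move=> da e1 db f1 g1.
have [c [h [dc h1 E]]] := mobe_rot_disk db f1 g1.
rewrite /integrand; apply: measurable_norm_comp; apply: measurable_funB.
  apply: (measurable_mobe_comp da e1 _ (@Omega0_disk R r)).
  exact: lip_disk_measurable k0 mulip.
have m : measurable_fun Om (nu \o mobe c h).
  apply: (measurable_mobe_comp dc h1 _ (@Omega0_disk R r)).
  exact: lip_disk_measurable k0 nulip.
apply: eq_measurable_fun m => u; rewrite inE => /Omega0_disk du /=.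
by rewrite E.
Qed.

Lemma integrand_ge0 a e b f g u : 0 <= integrand a e b f g u.
Proof. exact: normr_ge0. Qed.

Definition costB : R := `|mu origin| + `|nu origin| + 2 * k.

Lemma dens_bound x y : disk x -> disk y -> `|mu x - nu y| <= costB.
Proof.
move=> dx dy; have h1 := mulip dx disk0; have h2 := nulip dy disk0.
have cx (v : P) : disk v -> k * cabs (csub v origin) <= k.
  move=> dv; rewrite ger_pMr//; have -> : csub v origin = v.
    by rewrite /csub /= !subr0 -surjective_pairing.
  exact: ltW.
have := cx _ dx; have := cx _ dy.
have -> : mu x - nu y = (mu x - mu origin) - (nu y - nu origin) + (mu origin - nu origin) by ring.
have := ler_normD ((mu x - mu origin) - (nu y - nu origin)) (mu origin - nu origin).
have := ler_normB (mu x - mu origin) (nu y - nu origin).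
have := ler_normB (mu origin) (nu origin).
rewrite /costB; lra.
Qed.

Lemma rho1 : 0 < 1 - rho. Proof. by rewrite subr_gt0 tanh_lt1. Qed.

Local Open Scope ereal_scope.

Lemma costJ_ge0 a e b f g : 0 <= costJ a e b f g.
Proof. by apply: hint_ge0 => *; exact: integrand_ge0. Qed.

Lemma costJ_lty a e b f g : disk a -> cabs e = 1%R -> disk b -> cabs f = 1%R ->
  cabs g = 1%R -> costJ a e b f g < +oo.
Proof.
move=> da e1 db f1 g1.
have B0 : (0 <= costB)%R by rewrite /costB !addr_ge0// mulr_ge0// ltW.
apply: (@le_lt_trans _ _ (hint Om (cst costB))).
  apply: hint_le => //; first exact: measurable_Omega0.
  - exact: measurable_integrand.
  - by move=> *; exact: integrand_ge0.
  - by move=> u /Omega0_disk du; apply: dens_bound; apply: mobe_disk => //; exact: disk_cmul.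
rewrite hint_cst//; last exact: measurable_Omega0.
by rewrite lte_mul_pinfty// ?lee_fin// hint_Omega0_lty.
Qed.

(** Serves twice: varying the base maps gives the Lipschitz continuity of [dR], varying the rotation
    gives the $1/L$ term. *)
Lemma costJ_lip a e b f g a' e' b' f' g' (c1 c2 : R) :
  disk a -> cabs e = 1%R -> disk b -> cabs f = 1%R -> cabs g = 1%R ->
  disk a' -> cabs e' = 1%R -> disk b' -> cabs f' = 1%R -> cabs g' = 1%R ->
  (0 <= c1)%R -> (0 <= c2)%R ->
  (forall u, Om u -> cabs (csub (mobe a e u) (mobe a' e' u)) <= c1)%R ->
  (forall u, Om u -> cabs (csub (mobe b f (cmul g u)) (mobe b' f' (cmul g' u))) <= c2)%R ->
  costJ a e b f g <= costJ a' e' b' f' g' + (k * (c1 + c2))%:E * V.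
Proof.
move=> da e1 db f1 g1 da' e1' db' f1' g1' c10 c20 h1 h2.
apply: hint_le_add; first exact: measurable_Omega0.
- exact: measurable_integrand.
- exact: measurable_integrand.
- by rewrite mulr_ge0 ?addr_ge0// ltW.
- by move=> *; exact: integrand_ge0.
- by move=> *; exact: integrand_ge0.
move=> u Ou; have du := Omega0_disk Ou.
have m1 := mulip (mobe_disk da e1 du) (mobe_disk da' e1' du).
have m2 := nulip (mobe_disk db f1 (disk_cmul g1 du)) (mobe_disk db' f1' (disk_cmul g1' du)).
have := h1 _ Ou; have := h2 _ Ou; rewrite -(ler_pM2l k0) => n2; rewrite -(ler_pM2l k0) => n1.
rewrite /integrand; set A := mu _ in m1 *; set B := nu _ in m2 *.
set A' := mu _ in m1 *; set B' := nu _ in m2 *.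
have -> : (A - B = (A' - B') + ((A - A') - (B - B')))%R by ring.
have := ler_normD (A' - B')%R ((A - A') - (B - B'))%R.
have := ler_normB (A - A')%R (B - B')%R.
rewrite mulrDr; lra.
Qed.

(** The composite of [mobe a e] with the map taking $z$ back to the origin fixes the origin, so it
    is a rotation and preserves the modulus. *)
Lemma Omega_pre a e z : disk a -> cabs e = 1%R -> mobe a e origin = z ->
  @disk R `&` mobe a e @^-1` (Omega z r) = Om.
Proof.
move=> da e1 az.
have dz : disk z by rewrite -az; apply: mobe_disk => //; exact: disk0.
have E0 : cexpi 0 = cone :> P by rewrite /cexpi cos0 sin0.
have [c [g [dc g1 E]]] := mobe_comp da e1 dz (cabs1 (R := R)).
have zz : mobe z cone z = origin.
  by apply: toC_inj; rewrite toC_mobe subrr mul0r mulr0.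
have c0 : c = origin.
  by apply: (mobe_fix0 g1); rewrite -E ?az//; exact: disk0.
have cE u : disk u -> cabs (mobe z cone (mobe a e u)) = cabs u.
  by move=> du; rewrite E// c0 mobe0 cabsM g1 mul1r.
apply/seteqP; split => [u [du [_]]|u Ou].
  by rewrite /Omega0 /= mobE E0 cE.
have du := Omega0_disk Ou; split => //; split; first exact: mobe_disk.
by rewrite /Omega0 /= mobE E0 cE.
Qed.

Lemma measurable_Omega z : disk z -> measurable (Omega z r).
Proof.
move=> dz; have -> : Omega z r = @disk R `&` (setT `&` mobe z (cexpi 0) @^-1` Om).
  by rewrite setTI.
apply: measurableI; first exact: measurable_disk.
by apply: measurable_mobe => //; exact: measurable_Omega0.
Qed.

Lemma hint_Omega a e z a' e' : disk a -> cabs e = 1%R -> mobe a e origin = z ->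
  disk a' -> cabs e' = 1%R ->
  hint (Omega z r) (fun x => `|mu x - nu (mobe a' e' x)|%R) =
  hint Om (fun u => `|mu (mobe a e u) - nu (mobe a' e' (mobe a e u))|%R).
Proof.
move=> da e1 az da' e1'; rewrite -(Omega_pre da e1 az).
have dz : disk z by rewrite -az; apply: mobe_disk => //; exact: disk0.
rewrite -(@hint_mobe R a e (Omega z r))//.
- exact: measurable_Omega.
- by move=> x [].
- apply: measurable_norm_comp; apply: measurable_funB.
    apply: (measurable_funS measurable_disk); last exact: lip_disk_measurable k0 mulip.
    by move=> x [].
  apply: (measurable_mobe_comp da' e1') => [|x []//].
  exact: lip_disk_measurable k0 nulip.
Qed.

Lemma hint_Om_eq (f1 f2 : P -> R) : (forall u, Om u -> f1 u = f2 u) -> hint Om f1 = hint Om f2.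
Proof. by move=> h; apply: eq_integral => u; rewrite inE => /h ->. Qed.

(** On the disk, the maps with $m(z)=w$ are the $m_{b,f}\circ g\circ m_{a,e}^{-1}$ with [g] a
    rotation, since $m_{b,f}^{-1}\circ m\circ m_{a,e}$ fixes the origin. The base maps are
    arbitrary: translations are chosen for continuity in $(z,w)$, the prescribed $\tilde m_i,\tilde
    m_j$ for the discretization. *)
Lemma dR_rep a e b f z w : disk a -> cabs e = 1%R -> disk b -> cabs f = 1%R ->
  mobe a e origin = z -> mobe b f origin = w ->
  dR mu nu r z w = ereal_inf [set costJ a e b f g | g in [set g | cabs g = 1%R]].
Proof.
move=> da e1 db f1 az bw.
have dz : disk z by rewrite -az; apply: mobe_disk => //; exact: disk0.
have dw : disk w by rewrite -bw; apply: mobe_disk => //; exact: disk0.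
have dN (x : P) (y : P) : cabs y = 1%R -> disk x -> disk (cneg (cmul y x)).
  by move=> y1; rewrite /disk /mkset cabsN cabsM y1 mul1r.
have cN (y : P) : cabs y = 1%R -> cabs (cconj y) = 1%R by rewrite cabs_conj.
apply/eqP; rewrite eq_le; apply/andP; split.
  apply: le_ereal_inf_tmp => _ [g /= g1 <-].
  have [c1 [h1 [dc1 h11 E1]]] := mobe_comp (dN _ _ e1 da) (cN _ e1) disk0 g1.
  have [c2 [h2 [dc2 h21 E2]]] := mobe_comp dc1 h11 db f1.
  have [t t2 ht] := cexpi_onto h21.
  have E x : disk x -> mobe c2 h2 x = mobe b f (cmul g (mobe (cneg (cmul e a)) (cconj e) x)).
    by move=> dx; rewrite -E2// -E1// mobe0.
  apply: ereal_inf_lbound; exists (mob c2 t).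
    split; first by exists c2, t.
    by rewrite mobE ht E// -az mobeK//; [rewrite -mobe0 mobe_origin -bw|exact: disk0]; congr mobe;
      rewrite /cneg /cmul /= !(mulr0, subr0, addr0, oppr0).
  under [LHS]eq_integral do rewrite mobE ht.
  rewrite -/(hint _ _) (hint_Omega da e1 az dc2 h21).
  apply: hint_Om_eq => u /Omega0_disk du; rewrite /integrand E; last exact: mobe_disk.
  by rewrite mobeK.
apply: le_ereal_inf_tmp => _ [m [[a' [t [da' [t2 ->]]]] mzw] <-].
have e1' := cabs_expi t; set e' := cexpi t in e1'.
have [c1 [h1 [dc1 h11 E1]]] := mobe_comp da e1 da' e1'.
have [c2 [h2 [dc2 h21 E2]]] := mobe_comp dc1 h11 (dN _ _ f1 db) (cN _ f1).
have c20 : c2 = origin.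
  apply: (mobe_fix0 h21); rewrite -E2; last exact: disk0.
  rewrite -E1; last exact: disk0.
  by rewrite az -[mobe a' e' z]/(mob a' t z) mzw -bw mobeK//; exact: disk0.
apply: ereal_inf_lbound; exists h2 => //.
rewrite [RHS](hint_Omega da e1 az da' e1').
apply: hint_Om_eq => u /Omega0_disk du; rewrite /integrand -mobe0 -c20 -E2//.
rewrite -E1// mobeKV//.
by apply: mobe_disk => //; exact: mobe_disk.
Qed.

Lemma mobe_cneg z : mobe (cneg z) cone origin = z.
Proof.
by rewrite mobe_origin cmul1 /cneg /= !opprK -surjective_pairing.
Qed.

Lemma disk_cneg z : disk z -> disk (cneg z).
Proof. by rewrite /disk /mkset cabsN. Qed.

Lemma dR_ge0 z w : 0 <= dR mu nu r z w.
Proof.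
by apply: le_ereal_inf_tmp => _ [m _ <-]; apply: hint_ge0 => *; exact: normr_ge0.
Qed.

Lemma dR_fin z w : disk z -> disk w -> dR mu nu r z w \is a fin_num.
Proof.
move=> dz dw; rewrite ge0_fin_numE ?dR_ge0//.
rewrite (dR_rep (disk_cneg dz) (cabs1 (R := R)) (disk_cneg dw) (cabs1 (R := R)) (mobe_cneg _) (mobe_cneg _)).
apply: le_lt_trans (costJ_lty (disk_cneg dz) (cabs1 (R := R)) (disk_cneg dw) (cabs1 (R := R)) (cabs1 (R := R))).
by apply: ereal_inf_lbound; exists cone => //; exact: cabs1.
Qed.

Definition costL : R := (k * (4 / (1 - rho) ^+ 2) * fine V)%R.

Lemma V_fin : V \is a fin_num.
Proof. by rewrite ge0_fin_numE ?hint_Omega0_lty//; apply: hint_ge0. Qed.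

Lemma V_ge0 : (0 <= fine V)%R. Proof. by apply: fine_ge0; apply: hint_ge0. Qed.

(** With the translations [mobe (cneg z) cone] as base maps, both infima run over the same
    rotations, and for each rotation the cost moves by at most the added term. *)
Lemma dR_lip z w z' w' : disk z -> disk w -> disk z' -> disk w' ->
  dR mu nu r z w <=
  dR mu nu r z' w' + (costL * (cabs (csub z z') + cabs (csub w w')))%:E.
Proof.
move=> dz dw dz' dw'; rewrite -leeBlDr//.
rewrite (dR_rep (disk_cneg dz) (cabs1 (R := R)) (disk_cneg dw) (cabs1 (R := R)) (mobe_cneg _) (mobe_cneg _)).
rewrite (dR_rep (disk_cneg dz') (cabs1 (R := R)) (disk_cneg dw') (cabs1 (R := R)) (mobe_cneg _) (mobe_cneg _)).
apply: le_ereal_inf_tmp => _ [g g1 <-]; rewrite leeBlDr//.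
have q0 : (0 <= (1 - rho) ^+ 2)%R by exact: sqr_ge0.
apply: (@le_trans _ _ (costJ (cneg z) cone (cneg w) cone g)).
  by apply: ereal_inf_lbound; exists g.
have := @costJ_lip (cneg z) cone (cneg w) cone g (cneg z') cone (cneg w') cone g
  (4 * cabs (csub z z') / (1 - rho) ^+ 2) (4 * cabs (csub w w') / (1 - rho) ^+ 2)
  (disk_cneg dz) (cabs1 (R := R)) (disk_cneg dw) (cabs1 (R := R)) g1
  (disk_cneg dz') (cabs1 (R := R)) (disk_cneg dw') (cabs1 (R := R)) g1.
have p x y : (0 <= 4 * cabs (csub x y) / (1 - rho) ^+ 2)%R.
  by rewrite divr_ge0// mulr_ge0// cabs_ge0.
move=> /(_ (p _ _) (p _ _)) H; apply: le_trans (H _ _) _.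
- by move=> u Ou; apply: mobe_base_lip => //; exact: tanh_lt1.
- by move=> u Ou; apply: mobe_base_lip; rewrite ?cabsM ?g1 ?mul1r//; exact: tanh_lt1.
rewrite leeD2l// -(fineK V_fin) -EFinM lee_fin /costL le_eqVlt; apply/orP; left; apply/eqP.
by field; rewrite gt_eqF// rho1.
Qed.

End CostFunction.

(** * The grid of rotation angles *)

Section Grid.
Context {R : realType}.
Notation P := (R * R)%type.

Lemma cos_lip (s t : R) : `|cos s - cos t| <= `|s - t|.
Proof.
wlog st : s t / t <= s.
  by move=> H; case: (leP t s) => [/H//|/ltW/H h]; rewrite (distrC (cos s)) (distrC s).
have [x _ ->] := @MVT_segment R cos (fun x => - sin x) t s st
  (fun x _ => is_derive_cos x) (continuous_subspaceT (@continuous_cos R)).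
by rewrite normrM ler_piMl// normrN ler_norml sin_geN1 sin_le1.
Qed.

Lemma sin_lip (s t : R) : `|sin s - sin t| <= `|s - t|.
Proof.
wlog st : s t / t <= s.
  by move=> H; case: (leP t s) => [/H//|/ltW/H h]; rewrite (distrC (sin s)) (distrC s).
have [x _ ->] := @MVT_segment R sin cos t s st
  (fun x _ => is_derive_sin x) (continuous_subspaceT (@continuous_sin R)).
by rewrite normrM ler_piMl// ler_norml cos_geN1 cos_le1.
Qed.

(** The angle is off by at most $2\pi/L$; bounding the modulus by the sum of the two coordinate
    errors doubles this. *)
Lemma grid_unit (L : nat) (g : P) : (0 < L)%N -> cabs g = 1 ->
  exists2 l : nat, (1 <= l < L.+1)%N &
    cabs (csub (cexpi (2 * pi * l%:R / L%:R)) g) <= 4 * pi / L%:R.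
Proof.
move=> L0 /cexpi_onto[t /andP[t0 t1] <-].
have pi0 := @pi_gt0 R; have L0' : 0 < L%:R :> R by rewrite ltr0n.
pose x := t * L%:R / (2 * pi).
have x0 : 0 <= x by rewrite divr_ge0 ?mulr_ge0// ltW// mulr_gt0.
have xL : x < L%:R by rewrite ltr_pdivrMr ?mulr_gt0// mulrC ltr_pM2l.
have /andP[h1 h2] := Num.Theory.truncn_itv x0.
(* Rounding up puts the index in the range 1 to [L] used by [dhh]: angles near 0 get the index 1,
   and the truncation is below [L]. *)
exists (Num.truncn x).+1.
  by rewrite /= ltnS -(ltr_nat R); apply: le_lt_trans h1 xL.
have tE : t = x * (2 * pi) / L%:R.
  by rewrite /x divfK ?mulfK ?gt_eqF ?mulr_gt0.
have hd : `|2 * pi * (Num.truncn x).+1%:R / L%:R - t| <= 2 * pi / L%:R.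
  rewrite [in X in _ - X]tE.
  have -> : 2 * pi * (Num.truncn x).+1%:R / L%:R - x * (2 * pi) / L%:R =
    ((Num.truncn x).+1%:R - x) * (2 * pi / L%:R) by ring.
  rewrite normrM (ger0_norm (x := 2 * pi / _)); last by rewrite divr_ge0// ?mulr_ge0// ltW.
  apply: ler_piMl; first by rewrite divr_ge0// ?mulr_ge0// ltW.
  have nE : (Num.truncn x).+1%:R = (Num.truncn x)%:R + 1 :> R by rewrite natr1.
  by rewrite ler_norml; apply/andP; split; move: h1 h2; rewrite nE; lra.
apply: le_trans (cabs_le_abs _) _ => /=.
have := cos_lip (2 * pi * (Num.truncn x).+1%:R / L%:R) t.
have := sin_lip (2 * pi * (Num.truncn x).+1%:R / L%:R) t.
have -> : 4 * pi / L%:R = 2 * (2 * pi / L%:R) :> R by ring.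
lra.
Qed.

End Grid.

(** * Quadrature *)

Lemma ge0_integral_partition d (T : measurableType d) (R : realType)
    (m : {measure set T -> \bar R}) (I : finType) (A : I -> set T) (D : set T) (f : T -> \bar R) :
  (forall i, measurable (A i)) -> (forall i j, i != j -> A i `&` A j = set0) ->
  \bigcup_i A i = D -> measurable_fun D f -> (forall x, D x -> (0 <= f x)%E) ->
  (\int[m]_(x in D) f x = \sum_i \int[m]_(x in A i) f x)%E.
Proof.
move=> mA tA AD mf f0.
have DE : D = \big[setU/set0]_(i <- index_enum I) A i.
  rewrite -AD -bigcup_seq; apply: eq_bigcupl.
  by split => i //= _; rewrite mem_index_enum.
rewrite DE in mf f0 *; rewrite ge0_integral_bigsetU//; first exact: index_enum_uniq.
apply/trivIsetP => i j _ _; exact: tA.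
Qed.

Section Quadrature.
Context {R : realType}.
Notation P := (R * R)%type.
Implicit Types (x u v : P).

Lemma measurable_bisector (a b : P) : measurable [set x | cabs (csub x a) = cabs (csub x b)].
Proof.
have -> : [set x | cabs (csub x a) = cabs (csub x b)] =
    setT `&` (fun x => cabs (csub x a) - cabs (csub x b)) @^-1` [set 0].
  rewrite setTI; apply/seteqP; split => x /=; first by move=> ->; rewrite subrr.
  by move/eqP; rewrite subr_eq0 => /eqP.
have m : measurable_fun setT (fun x : P => cabs (csub x a) - cabs (csub x b)).
  by apply: measurable_funB; exact: measurable_dist.
by apply: m.
Qed.

(** The bisector is a line. If $a_2\ne b_2$ each vertical section is at most a point; otherwise the
    line is vertical, a point times the axis. *)
Lemma bisector_null (a b : P) : a != b ->
  leb2 [set x | cabs (csub x a) = cabs (csub x b)] = 0%E.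
Proof.
move=> ab; set E := [set x | _].
have mE : measurable E by exact: measurable_bisector.
have EP x : E x -> x.1 * (2 * (b.1 - a.1)) + x.2 * (2 * (b.2 - a.2)) =
    b.1 ^+ 2 + b.2 ^+ 2 - a.1 ^+ 2 - a.2 ^+ 2.
  move=> /(congr1 (fun y => y ^+ 2)); rewrite !cabs_sqr /= => h.
  apply/eqP; rewrite -subr_eq0; apply/eqP.
  transitivity (((x.1 - a.1) ^+ 2 + (x.2 - a.2) ^+ 2) - ((x.1 - b.1) ^+ 2 + (x.2 - b.2) ^+ 2)).
    by ring.
  by rewrite h subrr.
have [h2|h2] := eqVneq a.2 b.2; last first.
  have n0 : 2 * (b.2 - a.2) != 0 by rewrite mulf_neq0// ?pnatr_eq0// subr_eq0 eq_sym.
  rewrite /leb2 /product_measure1; apply: integral0_eq => x _ /=.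
  apply/eqP; rewrite eq_le measure_ge0 andbT.
  rewrite -(lebesgue_measure_set1
    ((b.1 ^+ 2 + b.2 ^+ 2 - a.1 ^+ 2 - a.2 ^+ 2 - x * (2 * (b.1 - a.1))) / (2 * (b.2 - a.2)))).
  apply: le_measure; rewrite ?inE//; first exact: measurable_xsection.
  move=> y; rewrite /xsection /= inE => /EP /= h.
  by apply: (mulIf n0); rewrite divfK// -h addrAC subrr add0r.
have n0 : 2 * (b.1 - a.1) != 0.
  rewrite mulf_neq0// ?pnatr_eq0// subr_eq0; apply: contraNN ab => /eqP h1.
  by apply/eqP; move: h1 h2; case: (a) (b) => ? ? [? ?] /= -> ->.
pose c := (b.1 ^+ 2 + b.2 ^+ 2 - a.1 ^+ 2 - a.2 ^+ 2) / (2 * (b.1 - a.1)).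
apply/eqP; rewrite eq_le measure_ge0 andbT.
have mc : measurable ([set c] `*` [set: R]) by exact: measurableX.
apply: (@le_trans _ _ (leb2 ([set c] `*` [set: R]))).
  apply: le_measure; rewrite ?inE// => x /EP h; split => //=.
  by apply: (mulIf n0); rewrite divfK// -h h2 subrr !mulr0 addr0.
rewrite /leb2 product_measure1E//.
by rewrite -[X in (X * _ <= _)%E]/(@lebesgue_measure R [set c]) lebesgue_measure_set1 mul0e.
Qed.

Variables (r : R) (K : nat) (p : 'I_K -> P).
Hypothesis p_inj : injective p.
Local Notation Om := (Omega0 r).
Local Notation V := (hint Om (cst 1)).

(** The closed cells [Delta] overlap, but only inside this null set; once it is deleted they
    partition the disk, so the weights [alpha] add up to its area. *)
Definition bisN : set P := \big[setU/set0]_(kl <- index_enum ('I_K * 'I_K)%type | kl.1 != kl.2)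
  [set x | cabs (csub x (p kl.1)) = cabs (csub x (p kl.2))].

Lemma bisN_null : measurable bisN /\ leb2 bisN = 0%E.
Proof.
apply: (big_ind (fun A : set P => measurable A /\ leb2 A = 0%E)).
- by split => //; exact: measure0.
- by move=> A B [mA A0] [mB B0]; split; [exact: measurableU|rewrite -[RHS]A0; exact: measureU0].
- move=> kl kl1; split; first exact: measurable_bisector.
  by apply: bisector_null; apply: contraNN kl1 => /eqP /p_inj ->.
Qed.

Lemma bisN_mem k l x : k != l -> cabs (csub x (p k)) = cabs (csub x (p l)) -> bisN x.
Proof.
move=> kl h; rewrite /bisN -bigcup_seq_cond; exists (k, l) => //=.
by rewrite mem_index_enum kl.
Qed.

Lemma measurable_Delta k : measurable (Delta r p k).
Proof.
have -> : Delta r p k = Om `&` \bigcap_(l in [set: 'I_K])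
   (setT `&` (fun x => cabs (csub x (p l)) - cabs (csub x (p k))) @^-1` `[0, +oo[%classic).
  apply/seteqP; split => x.
    move=> [Ox h]; split => // l _; split => //=; rewrite in_itv /= andbT subr_ge0; exact: h.
  move=> [Ox h]; split => // l; have [_ /=] := h l I.
  by rewrite in_itv /= andbT subr_ge0.
apply: measurableI; first exact: measurable_Omega0.
apply: fin_bigcap_measurable => // l _.
have m : measurable_fun setT (fun x : P => cabs (csub x (p l)) - cabs (csub x (p k))).
  by apply: measurable_funB; exact: measurable_dist.
by apply: m => //; exact: measurable_itv.
Qed.

Lemma Delta_sub k : Delta r p k `<=` Om. Proof. by move=> x []. Qed.

Lemma Delta_cover x : (0 < K)%N -> Om x -> exists k, Delta r p k x.
Proof.
move=> K0 Ox; pose k0 := Ordinal K0.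
exists [arg min_(k < k0) cabs (csub x (p k))]%O; split => // l.
by case: (Order.TotalTheory.arg_minP (fun k => cabs (csub x (p k))) (erefl : xpredT k0)) => k _; exact.
Qed.

Lemma hint_Delta_sum (f : P -> R) : (0 < K)%N -> measurable_fun Om f ->
  (forall x, Om x -> 0 <= f x) -> (hint Om f = \sum_k hint (Delta r p k) f)%E.
Proof.
move=> K0 mf f0; have [mN N0] := bisN_null.
have mO := measurable_Omega0 r.
have g0 x : Om x -> (0 <= (f x * hden x)%:E)%E by move=> Ox; rewrite lee_fin mulr_ge0 ?f0// hden_ge0.
transitivity (\int[leb2]_(x in Om `\` bisN) (f x * hden x)%:E)%E.
  by apply: ge0_negligible_integral => //; exact: measurable_hintE.
transitivity (\sum_k \int[leb2]_(x in Delta r p k `\` bisN) (f x * hden x)%:E)%E; last first.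
  apply: eq_bigr => k _; apply: esym; apply: ge0_negligible_integral => //.
  + exact: measurable_Delta.
  + by apply: measurable_hintE; apply: (measurable_funS mO) mf; exact: Delta_sub.
  + by move=> x /Delta_sub; exact: g0.
apply: ge0_integral_partition.
- by move=> k; apply: measurableD => //; exact: measurable_Delta.
- move=> k l kl; apply/seteqP; split => x //= -[[[_ h1] nN] [[_ h2] _]]; apply: nN.
  by apply: (bisN_mem kl); apply/eqP; rewrite eq_le h1 h2.
- apply/seteqP; split.
    move=> x [k _ [Dx nN]]; split => //; exact: Delta_sub Dx.
  move=> x [Ox nN].
  by have [k Dk] := Delta_cover K0 Ox; exists k.
- by apply: (measurable_funS mO) (measurable_hintE mf) => x [].
- by move=> x [Ox _]; exact: g0.
Qed.

Lemma hint_Delta_fin k (f : P -> R) : measurable_fun Om f ->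
  (forall x, Om x -> 0 <= f x) -> (hint Om f < +oo)%E -> hint (Delta r p k) f \is a fin_num.
Proof.
move=> mf f0 lty; rewrite ge0_fin_numE; last by apply: hint_ge0 => x /Delta_sub; exact: f0.
apply: le_lt_trans lty; apply: ge0_subset_integral => //.
- exact: measurable_Delta.
- exact: measurable_Omega0.
- exact: measurable_hintE.
- by move=> x Ox; rewrite lee_fin mulr_ge0 ?f0// hden_ge0.
- exact: Delta_sub.
Qed.

Lemma alphaE k : hint (Delta r p k) (cst 1) = (alpha r p k)%:E.
Proof.
rewrite /alpha -[fun=> 1]/(cst 1) fineK//; apply: hint_Delta_fin => //.
exact: hint_Omega0_lty.
Qed.

(** On each cell [f] is within [Lf * phi] of its value at the centre. The two one-sided estimates
    are made separately so that only nonnegative functions are integrated. *)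
Lemma quadrature (f : P -> R) (Lf phi : R) : (0 < K)%N -> (forall k, Om (p k)) ->
  measurable_fun Om f -> (forall x, Om x -> 0 <= f x) -> (hint Om f < +oo)%E ->
  0 <= Lf -> 0 <= phi ->
  (forall u v, Om u -> Om v -> `|f u - f v| <= Lf * cabs (csub u v)) ->
  (forall k x, Delta r p k x -> cabs (csub x (p k)) <= phi) ->
  `|\sum_k alpha r p k * f (p k) - fine (hint Om f)| <= Lf * phi * fine V.
Proof.
move=> K0 pO mf f0 lty Lf0 phi0 lip near.
have mD k : measurable (Delta r p k) by exact: measurable_Delta.
have mfD k : measurable_fun (Delta r p k) f.
  by apply: (measurable_funS (measurable_Omega0 r)) mf; exact: Delta_sub.
have c0 : 0 <= Lf * phi by rewrite mulr_ge0.
have loc k x : Delta r p k x -> `|f x - f (p k)| <= Lf * phi.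
  move=> Dx; apply: le_trans (lip _ _ (Delta_sub Dx) (pO k)) _.
  by rewrite ler_wpM2l// near.
have finD k := hint_Delta_fin k mf f0 lty.
have VE : fine V = \sum_k alpha r p k.
  rewrite hint_Delta_sum// (eq_bigr (fun k => (alpha r p k)%:E)) ?sumEFin// => k _.
  exact: alphaE.
have FE : fine (hint Om f) = \sum_k fine (hint (Delta r p k) f).
  rewrite hint_Delta_sum// (eq_bigr (fun k => (fine (hint (Delta r p k) f))%:E)) ?sumEFin//.
  by move=> k _; rewrite fineK.
rewrite FE VE -sumrB mulr_sumr; apply: le_trans (ler_norm_sum _ _ _) _.
apply: ler_sum => k _; rewrite ler_norml; apply/andP; split.
  have : (hint (Delta r p k) f <= (f (p k) + Lf * phi)%:E * hint (Delta r p k) (cst 1%R))%E.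
    rewrite -hint_cst//; last by rewrite addr_ge0// f0.
    apply: hint_le => // x Dx; first exact/f0/(Delta_sub Dx).
    by have := loc _ _ Dx; rewrite ler_norml => /andP[_]; rewrite /cst; lra.
  rewrite alphaE -(fineK (finD k)) -EFinM lee_fin.
  have -> : (f (p k) + Lf * phi) * alpha r p k =
    alpha r p k * f (p k) + Lf * phi * alpha r p k by ring.
  lra.
have : (hint (Delta r p k) (cst (f (p k))) <=
    hint (Delta r p k) f + (Lf * phi)%:E * hint (Delta r p k) (cst 1%R))%E.
  apply: hint_le_add => // x Dx; first exact/f0/pO.
    exact/f0/(Delta_sub Dx).
  by have := loc _ _ Dx; rewrite ler_norml => /andP[]; rewrite /cst; lra.
rewrite hint_cst//; last exact/f0/pO.
rewrite alphaE -(fineK (finD k)) -!EFinM -EFinD lee_fin.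
by rewrite [f (p k) * _]mulrC; lra.
Qed.

End Quadrature.

(** * Gaps of finite point sets and the Euclidean fill distance *)

Section Avoid.
Context {R : realType}.
Notation P := (R * R)%type.

(** Pigeonhole: among $n+1$ distinct points of the radius, one is missed by the $n$ values of
    [z]. *)
Lemma range_avoid (n : nat) (z : 'I_n -> P) (rho : R) : 0 < rho ->
  exists x : R, [/\ 0 < x, x < rho & forall i, z i != (x, 0)].
Proof.
move=> r0; apply: contrapT => H.
pose x (k : 'I_n.+1) : R := rho * (k.+1%:R / n.+2%:R).
have n0 : 0 < n.+2%:R :> R by rewrite ltr0n.
have xr k : 0 < x k /\ x k < rho.
  split; first by rewrite mulr_gt0// divr_gt0// ltr0n.
  by rewrite -[ltRHS]mulr1 ltr_pM2l// ltr_pdivrMr// mul1r ltr_nat ltnS ltn_ord.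
have h k : exists i, z i = (x k, 0).
  apply: contrapT => Hk; apply: H; exists (x k); have [? ?] := xr k; split => // i.
  by apply/eqP => zi; apply: Hk; exists i.
have [g gE] := choice h.
have : injective g.
  move=> k l kl; have := gE k; rewrite kl gE => -[/(mulfI (lt0r_neq0 r0))].
  move/(mulIf (invr_neq0 (lt0r_neq0 n0)))/eqP; rewrite eqr_nat eqSS => /eqP.
  by move=> ?; apply/val_inj.
by move/leq_card; rewrite !card_ord ltnn.
Qed.

Lemma cabs_fst (x : R) : 0 <= x -> cabs (x, 0) = x.
Proof. by move=> x0; rewrite /cabs /= expr0n addr0 sqrtr_sqr ger0_norm. Qed.

Lemma min_dist_pos (n : nat) (z : 'I_n -> P) (x : P) : (forall i, z i != x) ->
  exists2 d, 0 < d & forall i, d <= cabs (csub (z i) x).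
Proof.
move=> zx; pose D i := cabs (csub (z i) x).
have D0 i : 0 < D i.
  rewrite cabs_gt0; apply: contraNN (zx i) => /eqP [/eqP h1 /eqP h2].
  move: h1 h2; rewrite !subr_eq0 => /eqP h1 /eqP h2; apply/eqP.
  by rewrite (surjective_pairing (z i)) h1 h2 -surjective_pairing.
exists (\big[Num.min/1]_i D i).
  by apply: (big_ind (fun x : R => 0 < x)) => // a b a0 b0; rewrite lt_min a0.
move=> i; rewrite (bigD1 i)//= ge_min lexx//.
Qed.

(** The supremum runs over positive radii and would be [-oo] if there were none; a finite set always
    leaves a gap. *)
Lemma fillE_gt0 (r : R) (K : nat) (p : 'I_K -> P) : 0 < r -> (0 < fillE r (range p))%E.
Proof.
move=> r0; have [x [x0 xr hx]] := range_avoid p (tanh_gt0 r0).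
have [d d0 hd] := min_dist_pos hx.
apply: (@lt_le_trans _ _ d%:E); first by rewrite lte_fin.
apply: ereal_sup_ubound; exists d => //; split => //; exists (x, 0); split.
  by rewrite /Omega0 /mkset cabs_fst ltW.
apply/seteqP; split => y //= -[] /[swap] -[k _ <-]; rewrite /eball /mkset.
by rewrite ltNge hd.
Qed.

(** For $x$ in the cell of $p_k$, the open ball about $x$ of radius $|x-p_k|$ contains no centre, so
    this radius takes part in the supremum as soon as it is positive. *)
Lemma Delta_near (r : R) (K : nat) (p : 'I_K -> P) (phi : R) : 0 < r ->
  fillE r (range p) = phi%:E ->
  [/\ (0 < K)%N, 0 <= phi & forall k x, Delta r p k x -> cabs (csub x (p k)) <= phi].
Proof.
move=> r0 fE; have phi0 : 0 < phi by rewrite -lte_fin -fE fillE_gt0.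
split; last 2 first.
- exact: ltW.
- move=> k x [Ox h]; have [->|n0] := eqVneq (cabs (csub x (p k))) 0; first exact: ltW.
  rewrite -lee_fin -fE; apply: ereal_sup_ubound.
  exists (cabs (csub x (p k))) => //; split; first by rewrite lt_def n0 cabs_ge0.
  exists x; split => //; apply/seteqP; split => y //= -[] /[swap] -[l _ <-].
  by rewrite /eball /mkset => hb; have := h l; rewrite leNgt (cabs_subC x (p l)) hb.
(* Without centres every radius is admissible, so the supremum could not be the finite number
   [phi]. *)
- case: K p fE => // p fE; exfalso.
  have : ((phi + 1)%:E <= fillE r (range p))%E.
    apply: ereal_sup_ubound; exists (phi + 1) => //; split; first by rewrite addr_gt0.
    exists origin; split; first by rewrite /Omega0 /mkset cabs0 ltW// tanh_gt0.
    by apply/seteqP; split => y //= -[_ [[]]].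
  by rewrite fE lee_fin; lra.
Qed.

End Avoid.

(** * Error of the discretized cost *)

Section Discretization.
Context {R : realType}.
Notation P := (R * R)%type.
Variables (mu nu : P -> R) (k r : R).
Hypothesis k0 : 0 < k.
Hypothesis r0 : 0 < r.
Hypothesis mulip : forall x y, disk x -> disk y -> `|mu x - mu y| <= k * cabs (csub x y).
Hypothesis nulip : forall x y, disk x -> disk y -> `|nu x - nu y| <= k * cabs (csub x y).

Local Notation Om := (Omega0 r).
Local Notation rho := (tanh r).
Local Notation V := (hint Om (cst 1)).

(** The minimum in [dhh] starts from [+oo], which [fine] would send to 0; a nonempty range of
    rotations rules this out. *)
Lemma bigmin_seq (s : seq nat) (S : nat -> R) : s != [::] ->
  exists2 l, l \in s & \big[Order.min/+oo%E]_(i <- s) (S i)%:E = (S l)%:E /\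
    forall l', l' \in s -> S l <= S l'.
Proof.
elim: s => // x [|y s] IH _.
  exists x; rewrite ?mem_head// big_cons big_nil; split; first by rewrite /Order.min ltry.
  by move=> l'; rewrite inE => /eqP ->.
have [l ls [E h]] := IH isT; rewrite big_cons E.
case: (leP (S x) (S l)) => xl.
  exists x; first exact: mem_head.
  split; first by rewrite -EFin_min min_l.
  by move=> l'; rewrite inE => /orP[/eqP->//|/h]; exact: le_trans.
exists l; first by rewrite inE ls orbT.
split; first by rewrite -EFin_min min_r// ltW.
by move=> l'; rewrite inE => /orP[/eqP->|/h//]; exact: ltW.
Qed.

Lemma integrand_lip a e b f g u v : disk a -> cabs e = 1 -> disk b -> cabs f = 1 ->
  cabs g = 1 -> Om u -> Om v ->
  `|integrand mu nu a e b f g u - integrand mu nu a e b f g v| <=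
  2 * k / (1 - rho) ^+ 2 * cabs (csub u v).
Proof.
move=> da e1 db f1 g1 Ou Ov; have du := Omega0_disk Ou; have dv := Omega0_disk Ov.
apply: le_trans (ler_dist_dist _ _) _.
have m1 := mulip (mobe_disk da e1 du) (mobe_disk da e1 dv).
have m2 := nulip (mobe_disk db f1 (disk_cmul g1 du)) (mobe_disk db f1 (disk_cmul g1 dv)).
have l1 := mobe_lip da e1 (tanh_lt1 r) Ou Ov.
have gO w : Om w -> cabs (cmul g w) <= rho by rewrite /Omega0 /= cabsM g1 mul1r.
have l2 := mobe_lip db f1 (tanh_lt1 r) (gO _ Ou) (gO _ Ov).
have cE : csub (cmul g u) (cmul g v) = cmul g (csub u v).
  by apply: toC_inj; rewrite !toCE mulrBr.
rewrite cE cabsM g1 mul1r in l2.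
rewrite -(ler_pM2l k0) in l1; rewrite -(ler_pM2l k0) in l2.
set A := mu _ in m1 *; set B := nu _ in m2 *; set A' := mu _ in m1 *; set B' := nu _ in m2 *.
have -> : A - B - (A' - B') = (A - A') - (B - B') by ring.
have := ler_normB (A - A') (B - B').
have -> : 2 * k / (1 - rho) ^+ 2 * cabs (csub u v) =
  2 * (k * (cabs (csub u v) / (1 - rho) ^+ 2)) by ring.
lra.
Qed.

(** The Lipschitz constant of [integrand] in [u], one share each for [mu] and [nu], times the area
    of $\Omega_{0,R}$. *)
Definition C1c : R := 2 * k / (1 - rho) ^+ 2 * fine V.
(** The grid error $4\pi$ over [L], stretched by the Mobius map and by [nu], times the area; the
    division by [L] comes later. *)
Definition C2c : R := k * (4 * pi / (1 - rho) ^+ 2) * fine V.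

Lemma C1c_ge0 : 0 <= C1c.
Proof.
apply: mulr_ge0; last exact: V_ge0.
by apply: divr_ge0; [apply: mulr_ge0 => //; exact: ltW|exact: sqr_ge0].
Qed.

Lemma C2c_ge0 : 0 <= C2c.
Proof.
apply: mulr_ge0; last exact: V_ge0.
apply: mulr_ge0; first exact: ltW.
by apply: divr_ge0; [apply: mulr_ge0 => //; exact: pi_ge0|exact: sqr_ge0].
Qed.

(** The two sides differ: grid rotations are competitors in the infimum defining [dR], so from below
    only the quadrature error occurs; from above a nearly optimal rotation is rounded to the grid,
    which adds the [C2c] term. *)
Lemma dhh_bound (K : nat) (p : 'I_K -> P) (L : nat) ai ti bj sj z w (phi : R) :
  injective p -> (forall i, Om (p i)) -> (1 <= L)%N ->
  disk ai -> mob ai ti origin = z -> disk bj -> mob bj sj origin = w ->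
  fillE r (range p) = phi%:E ->
  `|dhh mu nu r p L ai ti bj sj - fine (dR mu nu r z w)| <= C1c * phi + C2c / L%:R.
Proof.
move=> pinj pO L1 da az db bw fE.
have [K0 phi0 near] := Delta_near r0 fE.
have L0 : 0 < L%:R :> R by rewrite ltr0n.
have q0 : 0 < (1 - rho) ^+ 2 by rewrite exprn_gt0// rho1.
pose e : P := cexpi ti; pose f : P := cexpi sj.
have e1 : cabs e = 1 by exact: cabs_expi.
have f1 : cabs f = 1 by exact: cabs_expi.
pose gl (l : nat) : P := cexpi (2 * pi * l%:R / L%:R).
have gl1 l : cabs (gl l) = 1 by exact: cabs_expi.
pose S l := \sum_i alpha r p i * integrand mu nu ai e bj f (gl l) (p i).
pose J g := fine (costJ mu nu r ai e bj f g).
have JE g : cabs g = 1 -> costJ mu nu r ai e bj f g = (J g)%:E.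
  by move=> g1; rewrite fineK// ge0_fin_numE ?costJ_ge0//; exact: (costJ_lty r k0 mulip nulip).
have dRE : dR mu nu r z w = ereal_inf [set costJ mu nu r ai e bj f g | g in [set g | cabs g = 1]].
  exact: (dR_rep r k0 mulip nulip).
have dz : disk z by rewrite -az; apply: (mobe_disk da e1); exact: disk0.
have dw : disk w by rewrite -bw; apply: (mobe_disk db f1); exact: disk0.
have dRf := dR_fin r k0 mulip nulip dz dw.
have SJ g : cabs g = 1 ->
    `|\sum_i alpha r p i * integrand mu nu ai e bj f g (p i) - J g| <= C1c * phi.
  move=> g1.
  have -> : C1c * phi = 2 * k / (1 - rho) ^+ 2 * phi * fine V by rewrite /C1c; ring.
  apply: (@quadrature R r K p pinj (integrand mu nu ai e bj f g)) => //.
  - exact: (@measurable_integrand _ mu nu k r k0 mulip nulip).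
  - by move=> *; exact: integrand_ge0.
  - exact: (costJ_lty r k0 mulip nulip).
  - by apply: divr_ge0; [apply: mulr_ge0 => //; exact: ltW|exact: ltW].
  - by move=> u v Ou Ov; exact: integrand_lip.
have dhhE : dhh mu nu r p L ai ti bj sj =
    fine (\big[Order.min/+oo%E]_(l <- index_iota 1 L.+1) (S l)%:E).
  congr fine; apply: eq_bigr => l _; congr EFin; apply: eq_bigr => i _.
  by rewrite mob_invK//; exact: Omega0_disk.
have s0 : index_iota 1 L.+1 != [::] by rewrite -size_eq0 size_iota subSS subn0 -lt0n.
have [l ls [lE lmin]] := bigmin_seq S s0.
rewrite dhhE lE /= ler_norml; apply/andP; split.
  rewrite lerBrDr addrC -lerBrDr opprK.
  have h : fine (dR mu nu r z w) <= J (gl l).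
    rewrite -lee_fin fineK// -JE// dRE; apply: ereal_inf_lbound; by exists (gl l).
  have := SJ _ (gl1 l); rewrite ler_norml => /andP[+ _]; rewrite -/(S l).
  have : 0 <= C2c / L%:R.
    by apply: divr_ge0; [exact: C2c_ge0|exact: ltW].
  lra.
(* A rotation that is optimal up to [eps] replaces a minimizer. *)
apply/ler_addgt0Pr => eps eps0.
have : (ereal_inf [set costJ mu nu r ai e bj f g | g in [set g | cabs g = 1%R]] <
    (fine (dR mu nu r z w) + eps)%:E)%E.
  by rewrite -dRE -[ltLHS]fineK// lte_fin ltrDl.
move/ereal_inf_lt => [_ [g /= g1 <-]]; rewrite JE// lte_fin => Jg.
have [l' l'L gd] := grid_unit L1 g1.
have l's : l' \in index_iota 1 L.+1 by rewrite mem_index_iota.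
have cc : cabs (csub (gl l') g) / (1 - rho) ^+ 2 <= 4 * pi / L%:R / (1 - rho) ^+ 2.
  by rewrite ler_pM2r ?invr_gt0.
have Jl : J (gl l') <= J g + C2c / L%:R.
  have := @costJ_lip _ mu nu k r k0 mulip nulip ai e bj f (gl l') ai e bj f g 0
    (4 * pi / L%:R / (1 - rho) ^+ 2) da e1 db f1 (gl1 l') da e1 db f1 g1 (lexx 0).
  have p0 : 0 <= 4 * pi / L%:R / (1 - rho) ^+ 2 by apply: le_trans cc; rewrite divr_ge0 ?cabs_ge0 ?ltW.
  move=> /(_ p0) H.
  have : (costJ mu nu r ai e bj f (gl l') <= costJ mu nu r ai e bj f g +
     (k * (0 + 4 * pi / L%:R / (1 - rho) ^+ 2))%:E * V)%E.
    apply: H.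
    - by move=> u Ou; rewrite /csub !subrr (_ : (0, 0) = origin)// cabs0.
    - move=> u Ou; apply: le_trans cc.
      have gO h : cabs h = 1 -> cabs (cmul h u) <= rho by move=> h1; rewrite cabsM h1 mul1r.
      apply: le_trans (mobe_lip db f1 (tanh_lt1 r) (gO _ (gl1 l')) (gO _ g1)) _.
      rewrite ler_pM2r ?invr_gt0//.
      have -> : csub (cmul (gl l') u) (cmul g u) = cmul (csub (gl l') g) u.
        by apply: toC_inj; rewrite !toCE mulrBl.
      by rewrite cabsM ler_piMr ?cabs_ge0// ltW//; exact: (Omega0_disk Ou).
  rewrite !JE// -(fineK (V_fin r)) -EFinM -EFinD lee_fin add0r => h.
  apply: le_trans h _; rewrite lerD2l le_eqVlt; apply/orP; left; apply/eqP.
  by rewrite /C2c; ring.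
have := lmin _ l's; have := SJ _ (gl1 l'); rewrite ler_norml => /andP[_]; rewrite -/(S l').
lra.
Qed.

End Discretization.

(** * Geodesic distances *)

Section Geodesic.
Context {R : realType}.
Notation P := (R * R)%type.
Notation leb := (@lebesgue_measure R).
Variables (mu : P -> R) (k : R).
Hypothesis k0 : 0 < k.
Hypothesis mulip : forall x y, disk x -> disk y -> `|mu x - mu y| <= k * cabs (csub x y).
Hypothesis mu_pos : forall x, disk x -> 0 < mu x.

Definition seg (a b : R) : set R := `[a, b]%classic.

Lemma segP a b t : seg a b t <-> a <= t <= b.
Proof. by rewrite /seg /= in_itv. Qed.

Lemma measurable_seg a b : measurable (seg a b).
Proof. exact: measurable_itv. Qed.

Definition speed (g1 g2 : R -> R) t :=
  Num.sqrt (mu (g1 t, g2 t)) * cabs (derive1 g1 t, derive1 g2 t) / (1 - cabs (g1 t, g2 t) ^+ 2).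

Lemma speed_ge0 g1 g2 t : disk (g1 t, g2 t) -> 0 <= speed g1 g2 t.
Proof.
by move/disk_sqr/ltW => h; rewrite divr_ge0// mulr_ge0 ?sqrtr_ge0 ?cabs_ge0.
Qed.

Lemma derivable_cont (g : R -> R) : (forall t, derivable g t 1) -> continuous g.
Proof. by move=> dg t; exact/differentiable_continuous/derivable1_diffP. Qed.

Lemma measurable_speed g1 g2 z y (A : set R) : C1curve g1 g2 z y -> A `<=` seg 0 1 ->
  measurable_fun A (speed g1 g2).
Proof.
move=> [d1 [d2 [c1 [c2 [dg _]]]]] A01.
have m1 : measurable_fun setT g1 by apply: continuous_measurable_fun; exact: derivable_cont.
have m2 : measurable_fun setT g2 by apply: continuous_measurable_fun; exact: derivable_cont.
have m12 : measurable_fun setT (fun t => (g1 t, g2 t)) by exact: measurable_fun_pair.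
have mD : measurable_fun setT (fun t => (derive1 g1 t, derive1 g2 t)).
  by apply: measurable_fun_pair; exact: continuous_measurable_fun.
have msub : measurable_fun A (fun t => mu (g1 t, g2 t)).
  apply: (@measurable_comp _ _ _ _ _ _ (@disk R) mu A (fun t => (g1 t, g2 t))).
  - exact: measurable_disk.
  - by move=> _ [t /A01/segP/dg h <-].
  - exact: lip_disk_measurable k0 mulip.
  - exact: measurable_funTS.
have mc : measurable_fun A (fun t => cabs (g1 t, g2 t)).
  by apply: measurable_funTS; exact: (measurableT_comp measurable_cabs).
apply: measurable_funM; first apply: measurable_funM.
- exact: (measurableT_comp measurable_sqrt).
- by apply: measurable_funTS; exact: (measurableT_comp measurable_cabs).
- apply: (measurableT_comp measurable_invr); apply: measurable_funB => //.
  exact: measurable_funX.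
Qed.

Local Open Scope ereal_scope.

Lemma glengthE g1 g2 : glength mu g1 g2 = \int[leb]_(t in seg 0 1) (speed g1 g2 t)%:E.
Proof. by []. Qed.

Lemma glength_ge0 g1 g2 z y : C1curve g1 g2 z y -> 0 <= glength mu g1 g2.
Proof.
move=> [_ [_ [_ [_ [dg _]]]]]; rewrite glengthE.
by apply: integral_ge0 => t /segP/dg h; rewrite lee_fin speed_ge0.
Qed.

Lemma geod_ge0 z y : 0 <= geod mu z y.
Proof.
by apply: le_ereal_inf_tmp => _ [g1 [g2 [c ->]]]; exact: glength_ge0 c.
Qed.

Lemma line_curve z y : disk z -> disk y ->
  C1curve (fun t => z.1 + t * (y.1 - z.1))%R (fun t => z.2 + t * (y.2 - z.2))%R z y /\
  forall t : R, derive1 (fun t : R => z.1 + t * (y.1 - z.1))%R t = (y.1 - z.1)%R /\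
    derive1 (fun t : R => z.2 + t * (y.2 - z.2))%R t = (y.2 - z.2)%R.
Proof.
move=> dz dy.
have D (a b t : R) : is_derive t 1%R (fun t : R => a + t * b)%R b.
  apply: isd_eq.
    apply: isdD; first exact: isd_cst.
    by apply: isdM; [exact: isd_id|exact: isd_cst].
  by rewrite mulr0 add0r add0r mulr1.
have D1 (a b t : R) : derive1 (fun t : R => a + t * b)%R t = b.
  by rewrite derive1E; have h := D a b t; rewrite derive_val.
split; last by move=> t; rewrite !D1.
split; first by move=> t; have [] := D z.1 (y.1 - z.1)%R t.
split; first by move=> t; have [] := D z.2 (y.2 - z.2)%R t.
have cD a b : continuous (derive1 (fun t : R => a + t * b)%R).
  have -> : derive1 (fun t : R => a + t * b)%R = cst b by apply/funext => t; rewrite D1.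
  exact: cst_continuous.
split; first exact: cD.
split; first exact: cD.
split; last first.
  by rewrite !mul0r !addr0 !mul1r !subrKC; split; rewrite -surjective_pairing.
move=> t /andP[t0 t1]; rewrite /disk /mkset.
have -> : (z.1 + t * (y.1 - z.1), z.2 + t * (y.2 - z.2))%R =
    cadd (cmul (1 - t, 0)%R z) (cmul (t, 0)%R y).
  by rewrite /cadd /cmul /=; congr pair; ring.
apply: le_lt_trans (cabsD _ _) _; rewrite !cabsM !cabs_fst ?subr_ge0//.
have := dz; have := dy; rewrite /disk /mkset => y1 z1.
have [t_eq|t_neq] := eqVneq t 1%R; first by rewrite t_eq subrr mul0r add0r mul1r.
have t1' : (t < 1)%R by rewrite lt_neqAle t_neq t1.
have h1 : ((1 - t) * cabs z < 1 - t)%R by rewrite gtr_pMr// subr_gt0.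
have h2 : (t * cabs y <= t)%R by rewrite ler_piMr// ltW.
lra.
Qed.

(** The straight segment stays within radius $\max(|z|,|y|)<1$, where its speed is bounded by the
    constant [M]. *)
Lemma geod_fin z y : disk z -> disk y -> geod mu z y \is a fin_num.
Proof.
move=> dz dy; rewrite ge0_fin_numE ?geod_ge0//.
have [C D] := line_curve dz dy.
set g1 := (fun t => _) in C D; set g2 := (fun t => z.2 + _)%R in C D.
apply: (@le_lt_trans _ _ (glength mu g1 g2)).
  by apply: ereal_inf_lbound; exists g1, g2.
pose s := Num.max (cabs z) (cabs y).
have s1 : (s < 1)%R by rewrite gt_max dz.
have s0 : (0 <= s)%R by rewrite le_max cabs_ge0.
have p0 : (0 < 1 - s ^+ 2)%R by rewrite subr_gt0 expr_lt1.
pose M := (Num.sqrt (mu origin + k) * cabs (csub y z) / (1 - s ^+ 2))%R.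
rewrite glengthE; apply: (@le_lt_trans _ _ (\int[leb]_(t in seg 0 1) (cst M%:E) t)).
  have [_ [_ [_ [_ [dg _]]]]] := C.
  apply: ge0_le_integral.
  - exact: measurable_seg.
  - by move=> t /segP/dg h; rewrite lee_fin speed_ge0.
  - by apply/measurable_EFinP; exact: measurable_speed C _.
  - by [].
  move=> t /segP t01; have dt := dg _ t01; have [E1 E2] := D t.
  rewrite lee_fin /speed E1 E2 /M -[(y.1 - z.1, y.2 - z.2)%R]/(csub y z).
  apply: ler_pM.
  - by rewrite mulr_ge0 ?sqrtr_ge0 ?cabs_ge0.
  - by rewrite invr_ge0 ltW//; exact/disk_sqr.
  - rewrite ler_wpM2r ?cabs_ge0// ler_wsqrtr//.
    have := mulip dt disk0; rewrite ler_norml => /andP[_].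
    have -> : csub (g1 t, g2 t) origin = (g1 t, g2 t) by rewrite /csub /= !subr0.
    have : (k * cabs (g1 t, g2 t) <= k)%R by rewrite ger_pMr// ltW.
    lra.
  - rewrite lef_pV2 ?posrE//; last exact/disk_sqr.
    rewrite lerD2l lerN2; apply: lerXn2r; rewrite ?nnegrE ?cabs_ge0//.
    have -> : (g1 t, g2 t) = cadd (cmul (1 - t, 0)%R z) (cmul (t, 0)%R y).
      by rewrite /cadd /cmul /g1 /g2 /=; congr pair; ring.
    case/andP: t01 => t0 t1.
    apply: le_trans (cabsD _ _) _; rewrite !cabsM !cabs_fst ?subr_ge0//.
    have h1 : ((1 - t) * cabs z <= (1 - t) * s)%R by rewrite ler_wpM2l ?subr_ge0// le_max lexx.
    have h2 : (t * cabs y <= t * s)%R by rewrite ler_wpM2l// le_max lexx orbT.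
    lra.
rewrite integral_cst//; last exact: measurable_seg.
have E : @lebesgue_measure R (seg 0 1) = 1%:E.
  by rewrite /seg lebesgue_measure_itv /= lte_fin ltr01 -EFinB subr0.
by change (M%:E * @lebesgue_measure R (seg 0 1) < +oo); rewrite E -EFinM ltry.
Qed.

Lemma geod_refl z : disk z -> geod mu z z = 0.
Proof.
move=> dz; apply/eqP; rewrite eq_le geod_ge0 andbT.
have [C D] := line_curve dz dz.
set g1 := (fun t => _) in C D; set g2 := (fun t => z.2 + _)%R in C D.
apply: (@le_trans _ _ (glength mu g1 g2)).
  by apply: ereal_inf_lbound; exists g1, g2.
rewrite glengthE integral0_eq// => t _; have [E1 E2] := D t.
by rewrite /speed E1 E2 !subrr (_ : (0, 0)%R = origin)// cabs0 mulr0 mul0r.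
Qed.

Lemma cont_dist g1 g2 (z : P) : continuous g1 -> continuous g2 ->
  continuous (fun t : R => cabs (csub (g1 t, g2 t) z)).
Proof.
move=> c1 c2 t; rewrite /cabs /=.
apply: (@continuous_comp _ _ _ (fun t => (g1 t - z.1) ^+ 2 + (g2 t - z.2) ^+ 2)%R Num.sqrt);
  last exact: sqrt_continuous.
apply: cvgD.
  apply: (@continuous_comp _ _ _ (fun t => g1 t - z.1)%R (fun x => x ^+ 2)%R); last exact: exprn_continuous.
  by apply: cvgB; [exact: c1|exact: cvg_cst].
apply: (@continuous_comp _ _ _ (fun t => g2 t - z.2)%R (fun x => x ^+ 2)%R); last exact: exprn_continuous.
by apply: cvgB; [exact: c2|exact: cvg_cst].
Qed.

(* The first time at which a curve issued from [z] is at distance [eta]. *)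
Lemma exit_time g1 g2 z y (eta : R) : C1curve g1 g2 z y -> (0 < eta)%R ->
  (eta <= cabs (csub y z))%R -> exists s : R, [/\ (0 < s <= 1)%R,
    cabs (csub (g1 s, g2 s) z) = eta &
    forall t, (0 <= t <= s)%R -> (cabs (csub (g1 t, g2 t) z) <= eta)%R].
Proof.
move=> [d1 [d2 [_ [_ [dg [g0 g1E]]]]]] eta0 etay.
pose h t := cabs (csub (g1 t, g2 t) z).
have ch : continuous h by apply: cont_dist; exact: derivable_cont.
have h0 : h 0%R = 0%R by rewrite /h g0 /csub !subrr (_ : (0, 0)%R = origin)// cabs0.
have ivt (t : R) : (0 <= t)%R -> (eta <= h t)%R -> exists2 c, (0 <= c <= t)%R & h c = eta.
  move=> t0 ht; have := @IVT R h 0%R t eta t0 (continuous_subspaceT ch).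
  rewrite h0 => /(_ _)[|c ct hc].
    by rewrite ge_min (ltW eta0) /= le_max ht orbT.
  by exists c => //; move: ct; rewrite in_itv.
pose A := seg 0 1 `&` h @^-1` [set eta].
have A0 : A !=set0.
  have [c c01 hc] := ivt 1%R ler01 ltac:(by rewrite /h g1E).
  by exists c; split => //; exact/segP.
have cA : compact A.
  apply: (@subclosed_compact _ A (seg 0 1)).
  - apply: closedI; first exact: interval_closed.
    by apply: closed_comp => [t _|]; [exact: ch|exact: closed_eq].
  - exact: segment_compact.
  - by move=> t [].
have cid : {within A, continuous (@id R)} by apply: continuous_subspaceT => ?; exact: cvg_id.
have [s sA smin] := compact_EVT_min A0 cA cid.
move: sA; rewrite inE => -[/segP/andP[s0 s1] hs].
exists s; split.
- rewrite s1 andbT lt_neqAle s0 andbT; apply/eqP => s00.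
  by move: hs; rewrite -s00 /= h0 => h00; move: eta0; rewrite h00 ltxx.
- exact: hs.
- move=> t /andP[t0 ts]; rewrite leNgt; apply/negP => ht.
  have [c /andP[c0 ct] hc] := ivt t t0 (ltW ht).
  have cA' : c \in A.
    rewrite inE; split => //; apply/segP; rewrite c0 (le_trans ct)// (le_trans ts)//.
  have sc := smin _ cA'.
  have ctE : c = t by apply/eqP; rewrite eq_le ct (le_trans ts sc).
  by move: ht; rewrite -ctE -[cabs _]/(h c) hc ltxx.
Qed.

(** A lower bound for $\sqrt\mu$ at distance at most $\eta$ from $z$ as long as
    $k\eta\le\mu(z)/2$. *)
Definition cmin (z : P) : R := Num.sqrt (mu z / 2).

Lemma cmin_gt0 z : disk z -> (0 < cmin z)%R.
Proof. by move=> dz; rewrite sqrtr_gt0 divr_gt0// mu_pos. Qed.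

(** Up to time [s] the speed is at least [cmin z] times the Euclidean speed, because
    $1/(1-|\cdot|^2)\ge 1$. The Euclidean speed dominates the derivative [D] of the projection onto
    the direction [(e1, e2)] of the exit point, and [D] integrates to [eta]. *)
Lemma length_lower g1 g2 z y (eta s : R) : C1curve g1 g2 z y -> disk z ->
  (0 < eta)%R -> (k * eta <= mu z / 2)%R -> (0 < s <= 1)%R ->
  cabs (csub (g1 s, g2 s) z) = eta ->
  (forall t, (0 <= t <= s)%R -> (cabs (csub (g1 t, g2 t) z) <= eta)%R) ->
  (cmin z * eta)%:E <= \int[leb]_(t in seg 0 s) (speed g1 g2 t)%:E.
Proof.
move=> C dz eta0 keta /andP[s0 s1] hs near.
have [d1 [d2 [c1 [c2 [dg [g0 g1E]]]]]] := C.
pose e1 := ((g1 s - z.1) / eta)%R; pose e2 := ((g2 s - z.2) / eta)%R.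
have e12 : (e1 ^+ 2 + e2 ^+ 2 = 1)%R.
  rewrite /e1 /e2 !expr_div_n -mulrDl.
  have := cabs_sqr (csub (g1 s, g2 s) z); rewrite hs /= => <-.
  by rewrite divff// expf_neq0// gt_eqF.
pose D t := (e1 * derive1 g1 t + e2 * derive1 g2 t)%R.
have cD : continuous D.
  move=> t; apply: cvgD; apply: cvgM; [exact: cvg_cst|exact: c1|exact: cvg_cst|exact: c2].
have FTC : \int[leb]_(t in seg 0 s) (D t)%:E = eta%:E.
  pose F t := (e1 * g1 t + e2 * g2 t)%R.
  have dF (t : R) : is_derive t 1%R F (D t).
    have h1 : isd t g1 (derive1 g1 t) by rewrite derive1E; exact/derivableP.
    have h2 : isd t g2 (derive1 g2 t) by rewrite derive1E; exact/derivableP.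
    apply: isd_eq.
      apply: isdD; (apply: isdM; [exact: isd_cst|]); [exact: h1|exact: h2].
    by rewrite /D !mulr0 !addr0.
  have cF : continuous F.
    by move=> t; apply: (isd_cont (a := D t)); exact: dF.
  rewrite /seg (@continuous_FTC2 _ D F 0%R s s0).
  - have z1 : g1 0%R = z.1 by rewrite -g0.
    have z2 : g2 0%R = z.2 by rewrite -g0.
    rewrite -EFinB; congr EFin; rewrite /F z1 z2.
    transitivity (eta * (e1 ^+ 2 + e2 ^+ 2))%R; last by rewrite e12 mulr1.
    by rewrite /e1 /e2; field; rewrite gt_eqF.
  - exact: continuous_subspaceT.
  - split; first by move=> t _; have [] := dF t.
    + by apply: cvg_at_right_filter; exact: cF.
    + by apply: cvg_at_left_filter; exact: cF.
  - by move=> t _; rewrite derive1E; have h := dF t; rewrite derive_val.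
have mD : measurable_fun (seg 0 s) (EFin \o D).
  by apply/measurable_EFinP; apply: measurable_funTS; exact: continuous_measurable_fun.
have ms := measurable_seg 0 s.
have c0 := cmin_gt0 dz.
apply: (@le_trans _ _ ((cmin z)%:E * \int[leb]_(t in seg 0 s) `|(D t)%:E|)).
  rewrite EFinM; apply: lee_wpmul2l; first by rewrite lee_fin ltW.
  by rewrite -FTC; apply: (le_trans (lee_abs _)); exact: le_abse_integral.
have mabs : measurable_fun (seg 0 s) (fun t => `|(D t)%:E|) by exact: (measurableT_comp (f := abse)).
rewrite -ge0_integralZl//; last by rewrite lee_fin ltW.
apply: ge0_le_integral => //.
- by move=> t _; rewrite mule_ge0// lee_fin ltW.
- exact: emeasurable_funM.
- apply/measurable_EFinP; apply: measurable_speed C _ => t /segP/andP[t0 ts].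
  by apply/segP; rewrite t0 (le_trans ts).
move=> t /segP t0s; have t01 : (0 <= t <= 1)%R.
  by case/andP: t0s => -> ts; exact: le_trans ts s1.
have dt := dg _ t01.
rewrite abse_EFin -EFinM lee_fin /speed -mulrA; apply: ler_pM; rewrite ?(ltW c0)//.
  rewrite ler_wsqrtr//; have := mulip dz dt; rewrite ler_norml => /andP[_].
  have := near _ t0s; rewrite cabs_subC -(ler_pM2l k0); lra.
have q0 := (disk_sqr _).1 dt.
apply: (@le_trans _ _ (cabs (derive1 g1 t, derive1 g2 t))).
  rewrite -(ler_pXn2r (n := 2)) ?nnegrE ?cabs_ge0// cabs_sqr real_normK ?num_real//=.
  rewrite /D -[leRHS]mul1r -e12; set a := derive1 g1 t; set b := derive1 g2 t.
  rewrite -subr_ge0 (_ : _ - _ = (e1 * b - e2 * a) ^+ 2)%R ?sqr_ge0//; ring.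
by rewrite ler_peMr ?cabs_ge0// invf_ge1// gerBl sqr_ge0.
Qed.

Lemma geod_lower z y (eta : R) : disk z -> (0 < eta)%R -> (k * eta <= mu z / 2)%R ->
  (eta <= cabs (csub y z))%R -> (cmin z * eta)%:E <= geod mu z y.
Proof.
move=> dz eta0 keta etay; apply: le_ereal_inf_tmp => _ [g1 [g2 [C ->]]].
have [s [s01 hs near]] := exit_time C eta0 etay.
apply: le_trans (length_lower C dz eta0 keta s01 hs near) _.
have [_ [_ [_ [_ [dg _]]]]] := C.
rewrite glengthE; apply: ge0_subset_integral; try exact: measurable_seg.
- by apply/measurable_EFinP; exact: measurable_speed C _.
- by move=> t /segP/dg h; rewrite lee_fin speed_ge0.
- by move=> t /segP/andP[t0 ts]; apply/segP; rewrite t0 (le_trans ts)//; case/andP: s01.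
Qed.

(** Competitors for [geod] are parametrized by $[0,1]$, so the tail is reparametrized affinely;
    [integral_substitution] shows that its length is unchanged. *)
Lemma tail_length g1 g2 z y (s : R) : C1curve g1 g2 z y -> (0 < s < 1)%R ->
  geod mu (g1 s, g2 s) y <= \int[leb]_(t in seg s 1) (speed g1 g2 t)%:E.
Proof.
move=> C /andP[s0 s1]; have [d1 [d2 [c1 [c2 [dg [g0 g1E]]]]]] := C.
pose phi (t : R) := (s + t * (1 - s))%R.
have p0 : (0 < 1 - s)%R by rewrite subr_gt0.
have dphi t : isd t phi (1 - s)%R.
  apply: isd_eq.
    apply: isdD; first exact: isd_cst.
    by apply: isdM; [exact: isd_id|exact: isd_cst].
  by rewrite mulr0 !add0r mulr1.
have cphi : continuous phi by move=> t; exact: isd_cont (dphi t).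
have phi01 t : (0 <= t <= 1)%R -> (s <= phi t <= 1)%R.
  move=> /andP[t0 t1]; rewrite /phi; apply/andP; split; nra.
have dcomp (g : R -> R) (t : R) : (forall t, derivable g t 1%R) ->
    is_derive t 1%R (g \o phi) (derive1 g (phi t) * (1 - s))%R.
  move=> dg'; have h1 : is_derive (phi t) 1%R g (derive1 g (phi t)).
    by rewrite derive1E; exact/derivableP.
  by have h2 : is_derive t 1%R phi (1 - s)%R := dphi t; exact: is_derive1_comp.
have dcompE (g : R -> R) (t : R) : (forall t, derivable g t 1%R) ->
    derive1 (g \o phi) t = (derive1 g (phi t) * (1 - s))%R.
  by move=> dg'; rewrite derive1E; have h := dcomp g t dg'; rewrite derive_val.
have cdcomp (g : R -> R) : (forall t, derivable g t 1%R) -> continuous (derive1 g) ->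
    continuous (derive1 (g \o phi)).
  move=> dg' cg; have -> : derive1 (g \o phi) = (fun t => derive1 g (phi t) * (1 - s))%R.
    by apply/funext => t; exact: dcompE.
  move=> t; apply: cvgM; last exact: cvg_cst.
  by apply: continuous_comp; [exact: cphi|exact: cg].
have C' : C1curve (g1 \o phi) (g2 \o phi) (g1 s, g2 s) y.
  split; first by move=> t; have [] := dcomp g1 t d1.
  split; first by move=> t; have [] := dcomp g2 t d2.
  split; first exact: cdcomp.
  split; first exact: cdcomp.
  split.
    move=> t /phi01/andP[h1 h2]; apply: dg; rewrite h2 andbT.
    exact: le_trans (ltW s0) h1.
  by rewrite /= /phi mul0r addr0 mul1r subrKC.
apply: (@le_trans _ _ (glength mu (g1 \o phi) (g2 \o phi))).
  by apply: ereal_inf_lbound; exists (g1 \o phi), (g2 \o phi).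
pose F : R -> \bar R := (EFin \o speed g1 g2) \_ (seg s 1).
have sub : seg s 1 `<=` seg 0 1.
  move=> t /segP/andP[h1 h2]; apply/segP; rewrite h2 andbT.
  exact: le_trans (ltW s0) h1.
have mF : measurable_fun setT F.
  apply/(measurable_restrictT _ _).1; first exact: measurable_seg.
  by apply/measurable_EFinP; exact: measurable_speed C sub.
have F0 u : 0 <= F u.
  rewrite /F patchE; case: ifPn => //; rewrite inE => /sub/segP/dg h.
  by rewrite lee_fin speed_ge0.
have mphi : measurable_fun setT phi by exact: continuous_measurable_fun.
have surj u : exists2 x : R, [set: R] x & phi x = u.
  exists ((u - s) / (1 - s))%R => //; rewrite /phi divfK ?gt_eqF//.
  by rewrite addrC subrK.
have E : \int[leb]_(x in [set: R]) (F (phi x) * (cst (1 - s)%R x)%:E) = \int[leb]_u F u.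
  by apply: integral_substitution => // x _; [exact: dphi|exact: cst_continuous].
rewrite [leRHS]integral_mkcond -[leRHS]/(\int[leb]_u F u) -E.
rewrite glengthE integral_mkcond le_eqVlt; apply/orP; left; apply/eqP.
apply: eq_integral => t _; rewrite /F !patchE.
have mem : (t \in seg 0 1) = (phi t \in seg s 1).
  apply/idP/idP; rewrite !inE => /segP h; apply/segP; first exact: phi01.
  by move: h; rewrite /phi => /andP[h1 h2]; apply/andP; split; nra.
rewrite mem; case: ifPn => _; last by rewrite mul0e.
rewrite -EFinM; congr EFin; rewrite /speed !dcompE//=.
have -> : (derive1 g1 (phi t) * (1 - s), derive1 g2 (phi t) * (1 - s))%R =
    cmul (1 - s, 0)%R (derive1 g1 (phi t), derive1 g2 (phi t)).
  by rewrite /cmul /=; congr pair; ring.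
rewrite cabsM cabs_fst ?ltW//; ring.
Qed.

(** Following a nearly shortest curve up to its first exit from a small Euclidean disk costs at
    least [cmin z * eta]. If the curve exceeds the infimum by less than that, its tail is strictly
    shorter than the infimum. *)
Lemma geod_approx z y (eps : R) : disk z -> disk y -> 0 < geod mu z y -> (0 < eps)%R ->
  exists z', [/\ disk z', (cabs (csub z' z) <= eps)%R & geod mu z' y < geod mu z y].
Proof.
move=> dz dy g0 eps0.
have yz : (0 < cabs (csub y z))%R.
  rewrite cabs_gt0; apply/eqP => -[/eqP h1 /eqP h2]; move: h1 h2; rewrite !subr_eq0 => /eqP h1 /eqP h2.
  have yzE : y = z by rewrite (surjective_pairing y) h1 h2 -surjective_pairing.
  by move: g0; rewrite yzE geod_refl// ltxx.
pose eta := Num.min (Num.min eps (mu z / (2 * k))%R) (cabs (csub y z)).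
have eta0 : (0 < eta)%R by rewrite !lt_min eps0 yz !andbT divr_gt0 ?mu_pos// mulr_gt0.
have eta_eps : (eta <= eps)%R by rewrite !ge_min lexx.
have eta_y : (eta <= cabs (csub y z))%R by rewrite ge_min lexx orbT.
have keta : (k * eta <= mu z / 2)%R.
  have -> : (mu z / 2 = k * (mu z / (2 * k)))%R by field; rewrite gt_eqF.
  by rewrite ler_pM2l// !ge_min lexx orbT.
have c0 := cmin_gt0 dz.
have gf := geod_fin dz dy.
have ex : ereal_inf [set x | exists g1 g2, C1curve g1 g2 z y /\ x = glength mu g1 g2] <
    geod mu z y + (cmin z * eta)%:E by rewrite -[ltLHS]/(geod mu z y) lteDl// lte_fin mulr_gt0.
have [_ [g1 [g2 [C ->]]] lt] := ereal_inf_lt ex.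
have [s [s01 hs near]] := exit_time C eta0 eta_y.
have low := length_lower C dz eta0 keta s01 hs near.
have [_ [_ [_ [_ [dg [_ g1E]]]]]] := C.
case/andP: (s01) => s0 s1.
exists (g1 s, g2 s); split; first by apply: dg; rewrite ltW.
  by rewrite hs.
(* If the exit happens at the end of the curve, the new point is [y] itself, at distance 0. *)
have [sE|sn] := eqVneq s 1%R.
  by rewrite sE g1E geod_refl.
have s1' : (s < 1)%R by rewrite lt_neqAle sn s1.
apply: le_lt_trans (tail_length C _) _; first by rewrite s0.
have m01 (A : set R) : A `<=` seg 0 1 -> measurable_fun A (fun t => (speed g1 g2 t)%:E).
  by move=> A01; apply/measurable_EFinP; exact: measurable_speed C A01.
have sp0 t : seg 0 1 t -> 0 <= (speed g1 g2 t)%:E.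
  by move/segP/dg => h; rewrite lee_fin speed_ge0.
have split01 : glength mu g1 g2 = \int[leb]_(t in seg 0 s) (speed g1 g2 t)%:E +
    \int[leb]_(t in seg s 1) (speed g1 g2 t)%:E.
  have sub2 : `]s, 1%R]%classic `<=` seg 0 1.
    move=> t; rewrite /= in_itv /= => /andP[h1 h2]; apply/segP.
    by rewrite h2 andbT (le_trans (ltW s0) (ltW h1)).
  have UE : seg 0 1 = seg 0 s `|` `]s, 1%R]%classic.
    apply/seteqP; split => t.
      move/segP => /andP[h1 h2]; case: (leP t s) => ts; first by left; apply/segP; rewrite h1.
      by right; rewrite /= in_itv /= ts.
    move=> [/segP/andP[h1 h2]|/sub2//]; apply/segP; rewrite h1 /=; exact: le_trans h2 s1.
  rewrite glengthE {1}UE ge0_integral_setU.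
  - by congr (_ + _); rewrite /seg -integral_itv_obnd_cbnd//; apply/measurable_EFinP;
      exact: measurable_speed C sub2.
  - exact: measurable_seg.
  - exact: measurable_itv.
  - by rewrite -UE; exact: m01.
  - by rewrite -UE; exact: sp0.
  - rewrite disj_set2E; apply/eqP/seteqP; split => t //= -[/segP/andP[_ h1]].
    by rewrite in_itv /= ltNge h1.
move: lt; rewrite split01.
have : \int[leb]_(t in seg s 1) (speed g1 g2 t)%:E <= glength mu g1 g2.
  by rewrite split01 leeDr// (le_trans _ low)// lee_fin mulr_ge0 ?ltW.
set X := \int[leb]_(t in seg 0 s) _ in low *; set Y := \int[leb]_(t in seg s 1) _.
move=> _ lt; rewrite -(@lteD2rE _ (cmin z * eta)%:E)//.
by apply: le_lt_trans lt; rewrite [leLHS]addeC; exact: leeD2r.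
Qed.

(** A point of the disk off the finite sample has positive Euclidean distance to it, and
    [geod_lower] makes this a positive geodesic distance. Positivity excludes the value [-oo] of an
    empty supremum. *)
Lemma fill_gt0 (n : nat) (z : 'I_n -> P) : 0 < fill mu (range z).
Proof.
have [x [x0 x1 hx]] := range_avoid z ltr01.
have [d d0 hd] := min_dist_pos hx.
have dx : disk (x, 0%R) by rewrite /disk /mkset cabs_fst// ltW.
pose eta := Num.min d (mu (x, 0) / (2 * k))%R.
have eta0 : (0 < eta)%R by rewrite lt_min d0 divr_gt0 ?mu_pos// mulr_gt0.
have keta : (k * eta <= mu (x, 0%R) / 2)%R.
  have -> : (mu (x, 0) / 2 = k * (mu (x, 0) / (2 * k)))%R by field; rewrite gt_eqF.
  by rewrite ler_pM2l// ge_min lexx orbT.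
have c0 := cmin_gt0 dx.
apply: (@lt_le_trans _ _ (cmin (x, 0%R) * eta)%:E); first by rewrite lte_fin mulr_gt0.
apply: ereal_sup_ubound; exists (cmin (x, 0%R) * eta)%R => //; split; first exact: mulr_gt0.
exists (x, 0%R); split => //; apply/seteqP; split => y //= -[[_ h]] [i _ E].
move: h; rewrite -E ltNge; apply/negP; rewrite negbK; apply: geod_lower => //.
by apply: le_trans (hd i); rewrite ge_min lexx.
Qed.

(** No sample is nearer to $x$ than $z_i$, so the open ball about $x$ reaching up to $z_i$ is free
    of samples. The supremum only sees positive radii, hence the appeal to [fill_gt0] when the
    distance vanishes. *)
Lemma cell_fill (n : nat) (z : 'I_n -> P) Xi i x : (forall i, disk (z i)) ->
  voronoi mu z Xi -> Xi i x -> disk x /\ geod mu x (z i) <= fill mu (range z).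
Proof.
move=> dz [XU [_ [_ X4]]] Xx.
have dx : disk x by rewrite -XU; exists i.
split => //; have gf := geod_fin dx (dz i).
have [g0|g0] := eqVneq (geod mu x (z i)) 0; first by rewrite g0 ltW// fill_gt0.
rewrite -(fineK gf); apply: ereal_sup_ubound; exists (fine (geod mu x (z i))) => //; split.
  by rewrite fine_gt0// lt_def g0 geod_ge0 /= ltey_eq gf.
exists x; split => //; apply/seteqP; split => y //= -[[_ h]] [j _ E].
move: h; rewrite -E fineK// ltNge => /negP; apply.
by have [->//|ji] := eqVneq j i; exact: X4.
Qed.

End Geodesic.

(** * Couplings *)

Lemma measure_partition d (T : measurableType d) (R : realType)
    (m : {measure set T -> \bar R}) (I : finType) (A : I -> set T) :
  (forall i, measurable (A i)) -> (forall i j, i != j -> A i `&` A j = set0) ->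
  (m (\bigcup_i A i) = \sum_i m (A i))%E.
Proof.
move=> mA tA; have mU : measurable (\bigcup_i A i) by apply: fin_bigcup_measurable.
transitivity (\int[m]_(x in \bigcup_i A i) 1)%E; first by rewrite integral_cst// mul1e.
rewrite (@ge0_integral_partition _ _ _ _ _ A)//.
by apply: eq_bigr => i _; rewrite integral_cst// mul1e.
Qed.

Section Couplings.
Context {R : realType}.
Notation P := (R * R)%type.
Variables (mu nu : P -> R) (k r : R).
Hypothesis k0 : 0 < k.
Hypothesis mulip : forall x y, disk x -> disk y -> `|mu x - mu y| <= k * cabs (csub x y).
Hypothesis nulip : forall x y, disk x -> disk y -> `|nu x - nu y| <= k * cabs (csub x y).
Hypothesis mu_pos : forall x, disk x -> 0 < mu x.
Hypothesis nu_pos : forall x, disk x -> 0 < nu x.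
Hypothesis mu_prob : hint (@disk R) mu = 1%:E.
Hypothesis nu_prob : hint (@disk R) nu = 1%:E.

Definition DD : set (P * P) := @disk R `*` @disk R.

Lemma measurable_DD : measurable DD.
Proof. by apply: measurableX; exact: measurable_disk. Qed.

Definition dreal (x : P * P) : R := fine (dR mu nu r x.1 x.2).

Lemma dR_real x : DD x -> dR mu nu r x.1 x.2 = (dreal x)%:E.
Proof. by case=> d1 d2; rewrite fineK//; exact: (dR_fin r k0 mulip nulip). Qed.

Lemma dreal_ge0 x : 0 <= dreal x.
Proof. by apply: fine_ge0; exact: dR_ge0. Qed.

Lemma dreal_lip x y : DD x -> DD y ->
  `|dreal x - dreal y| <= costL k r * (cabs (csub x.1 y.1) + cabs (csub x.2 y.2)).
Proof.
move=> Dx Dy; have [dx1 dx2] := Dx; have [dy1 dy2] := Dy.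
have h1 := dR_lip r k0 mulip nulip dx1 dx2 dy1 dy2.
have h2 := dR_lip r k0 mulip nulip dy1 dy2 dx1 dx2.
move: h1 h2; rewrite !(dR_real Dx) !(dR_real Dy) -!EFinD !lee_fin.
rewrite (cabs_subC y.1) (cabs_subC y.2).
move: (dreal x) (dreal y) (costL k r * _) => A B c h1 h2.
by rewrite ler_norml; apply/andP; split; lra.
Qed.

Lemma costL_ge0 : 0 <= costL k r.
Proof.
apply: mulr_ge0; last exact: V_ge0.
by apply: mulr_ge0; [exact: ltW|apply: divr_ge0 => //; exact: sqr_ge0].
Qed.

(** [dreal] comes from an uncountable infimum; its Lipschitz bound supplies the measurability. The
    added 1 makes the constant positive. *)
Lemma measurable_dreal : measurable_fun DD dreal.
Proof.
apply: (@lipschitz_measurable _ _ R ((rat * rat) * (rat * rat))%type (fun q => (ratP q.1, ratP q.2)) DD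
  (fun x y => cabs (csub x.1 y.1) + cabs (csub x.2 y.2)) dreal (costL k r + 1)).
- exact: measurable_DD.
- move=> q; apply: measurable_funD.
    by apply: (measurableT_comp (measurable_dist (ratP q.1))); exact: measurable_fst.
  by apply: (measurableT_comp (measurable_dist (ratP q.2))); exact: measurable_snd.
- by have := costL_ge0; lra.
- move=> x y Dx Dy; apply: le_trans (dreal_lip Dx Dy) _.
  by rewrite ler_wpM2r ?addr_ge0 ?cabs_ge0// lerDl.
- move=> x e [d1 d2] e0; have e2 : 0 < e / 2 by rewrite divr_gt0.
  have [q1 dq1 h1] := ratP_dense d1 e2; have [q2 dq2 h2] := ratP_dense d2 e2.
  exists (q1, q2); first by split.
  by rewrite /=; lra.
Qed.

Local Open Scope ereal_scope.

Lemma coupling_DDC (pi : probability (P * P)%type R) : couplings mu nu pi -> pi (~` DD) = 0.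
Proof.
move=> [p1 p2]; have mD := @measurable_disk R.
have h1 : pi ((~` @disk R) `*` setT) = 0.
  by rewrite p1; [rewrite setICl [hint _ _]integral_set0|exact: measurableC].
have h2 : pi (setT `*` (~` @disk R)) = 0.
  by rewrite p2; [rewrite setICl [hint _ _]integral_set0|exact: measurableC].
have m1 : measurable ((~` @disk R) `*` [set: P]) by apply: measurableX => //; exact: measurableC.
have m2 : measurable ([set: P] `*` (~` @disk R)) by apply: measurableX => //; exact: measurableC.
apply/eqP; rewrite eq_le measure_ge0 andbT.
have E : pi ((~` @disk R) `*` setT `|` setT `*` (~` @disk R)) = 0 by rewrite measureU0.
rewrite -E; apply: le_measure; rewrite ?inE.
- by apply: measurableC; exact: measurable_DD.
- exact: measurableU.
- move=> [x y] nDD; apply: contrapT => H; apply: nDD; split => /=.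
    by apply: contrapT => h; apply: H; left.
  by apply: contrapT => h; apply: H; right.
Qed.

Import HBNNSimple.

(* [dR] need not be measurable off [DD]; the lower integral does not see the null set. *)
Lemma integral_dR (pi : probability (P * P)%type R) : couplings mu nu pi ->
  \int[pi]_x dR mu nu r x.1 x.2 = \int[pi]_(x in DD) (dreal x)%:E.
Proof.
move=> cpi; have N0 := coupling_DDC cpi; have mDD := measurable_DD.
have mNDD : measurable (~` DD) by exact: measurableC.
have mE : measurable_fun DD (fun x => (dreal x)%:E) by apply/measurable_EFinP; exact: measurable_dreal.
apply/eqP; rewrite eq_le; apply/andP; split.
  rewrite ge0_integralTE; last by move=> x; exact: dR_ge0.
  apply: ge_ereal_sup => _ [h /= hf <-].
  rewrite -integralT_nnsfun (@ge0_negligible_integral _ _ _ pi setT (~` DD))//; last 2 first.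
  - by apply/measurable_EFinP.
  - by move=> x _; rewrite lee_fin.
  rewrite setTD setCK; apply: ge0_le_integral.
  - exact: mDD.
  - by move=> x _; rewrite lee_fin.
  - by apply: measurable_funTS; exact/measurable_EFinP.
  - exact: mE.
  - by move=> x Dx; rewrite -dR_real//; exact: hf.
rewrite integral_mkcond ge0_integralTE; last first.
  by move=> x; rewrite patchE; case: ifPn => // _; rewrite lee_fin dreal_ge0.
rewrite ge0_integralTE; last by move=> x; exact: dR_ge0.
apply: ge_ereal_sup => _ [h /= hf <-]; apply: ereal_sup_ubound; exists h => //= x.
apply: le_trans (hf x) _; rewrite patchE; case: ifPn => [|_]; last exact: dR_ge0.
by rewrite inE => /dR_real ->.
Qed.

Section Cells.
Variables (n q : nat) (z : 'I_n -> P) (w : 'I_q -> P).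
Variables (Xi : 'I_n -> set P) (Ups : 'I_q -> set P).
Hypothesis dz : forall i, disk (z i).
Hypothesis dw : forall j, disk (w j).
Hypothesis vX : voronoi mu z Xi.
Hypothesis vU : voronoi nu w Ups.
Hypothesis mX : forall i, measurable (Xi i).
Hypothesis mU : forall j, measurable (Ups j).

Local Notation tt := (2%:E * maxe (fill mu (range z)) (fill nu (range w))).
Local Notation om := (modcont mu nu r tt).

Lemma tt_gt0 : 0 < tt.
Proof.
rewrite mule_gt0// lt_max; apply/orP; left.
exact: (fill_gt0 k0 mulip mu_pos).
Qed.

Lemma fills_le : fill mu (range z) + fill nu (range w) <= tt.
Proof.
set a := fill _ _; set b := fill _ _.
have a0 : 0 < a by exact: (fill_gt0 k0 mulip mu_pos).
have b0 : 0 < b by exact: (fill_gt0 k0 nulip nu_pos).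
rewrite mule_natl mule2n; apply: leeD; first by rewrite le_max lexx.
by rewrite le_max lexx orbT.
Qed.

Lemma modcont_mem a b a' b' : disk a -> disk b -> disk a' -> disk b' ->
  geod mu a a' + geod nu b b' < tt ->
  (`|dreal (a, b) - dreal (a', b')|%R)%:E <= om.
Proof.
move=> da db da' db' h; apply: ereal_sup_ubound; exists a, b, a', b'; do !split => //.
by rewrite (@dR_real (a, b))// (@dR_real (a', b')).
Qed.

(** The modulus is not an empty supremum: [tt] is positive, so a pair compared with itself is
    admissible. *)
Lemma om_ge0 : 0 <= om.
Proof.
have d0 := @disk0 R.
have := @modcont_mem origin origin origin origin d0 d0 d0 d0.
rewrite subrr normr0; apply.
by rewrite (geod_refl mu d0) (geod_refl nu d0) adde0 tt_gt0.
Qed.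

(* The modulus is a supremum over strict inequalities; in the boundary case one
   of the two points is first moved closer to its centre. *)
Lemma cell_modcont i j x y : Xi i x -> Ups j y ->
  (`|dreal (x, y) - dreal (z i, w j)|%R)%:E <= om.
Proof.
move=> Xx Uy.
have [dx gx] := cell_fill k0 mulip mu_pos dz vX Xx.
have [dy gy] := cell_fill k0 nulip nu_pos dw vU Uy.
have fx := geod_fin k0 mulip dx (dz i); have fy := geod_fin k0 nulip dy (dw j).
have le_tt : geod mu x (z i) + geod nu y (w j) <= tt.
  by apply: le_trans fills_le; exact: leeD.
case: (ltP (geod mu x (z i) + geod nu y (w j)) tt) => [|ge_tt]; first exact: modcont_mem.
have C0 : (0 < costL k r + 1)%R by have := costL_ge0; lra.
apply/lee_addgt0Pr => eps eps0.
have del0 : (0 < eps / (costL k r + 1))%R by rewrite divr_gt0.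
have step x' y' : disk x' -> disk y' ->
    (cabs (csub x' x) + cabs (csub y' y) <= eps / (costL k r + 1))%R ->
    geod mu x' (z i) + geod nu y' (w j) < geod mu x (z i) + geod nu y (w j) ->
    (`|dreal (x, y) - dreal (z i, w j)|%R)%:E <= om + eps%:E.
  move=> dx' dy' hd hg.
  have m := modcont_mem dx' dy' (dz i) (dw j) (lt_le_trans hg le_tt).
  have l := @dreal_lip (x, y) (x', y') (conj dx dy) (conj dx' dy').
  rewrite /= (cabs_subC x) (cabs_subC y) in l.
  have l' : (`|dreal (x, y) - dreal (x', y')| <= eps)%R.
    apply: le_trans l _; apply: (@le_trans _ _ ((costL k r + 1) * (eps / (costL k r + 1)))%R).
      by apply: ler_pM; rewrite ?costL_ge0 ?addr_ge0 ?cabs_ge0// lerDl.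
    by rewrite mulrC divfK// gt_eqF.
  apply: le_trans (leeD m (lexx eps%:E)); rewrite -EFinD lee_fin [leRHS]addrC.
  have -> : (dreal (x, y) - dreal (z i, w j) =
    (dreal (x, y) - dreal (x', y')) + (dreal (x', y') - dreal (z i, w j)))%R by rewrite addrA subrK.
  by apply: le_trans (ler_normD _ _) _; rewrite lerD2r.
(* The two distances cannot both vanish, since their sum is at least the positive [tt]; a point at
   positive distance is the one to move. *)
have [gx0|gx0] := eqVneq (geod mu x (z i)) 0.
  have [gy0|gy0] := eqVneq (geod nu y (w j)) 0.
    by move: ge_tt; rewrite gx0 gy0 adde0 leNgt tt_gt0.
  have gyp : 0 < geod nu y (w j) by rewrite lt_def gy0 geod_ge0.
  have [y' [dy' cy' hy']] := geod_approx k0 nulip nu_pos dy (dw j) gyp del0.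
  apply: (step x y' dx dy').
    by rewrite /csub !subrr (_ : (0, 0)%R = origin)// cabs0 add0r.
  by rewrite lteD2lE.
have gxp : 0 < geod mu x (z i) by rewrite lt_def gx0 geod_ge0.
have [x' [dx' cx' hx']] := geod_approx k0 mulip mu_pos dx (dz i) gxp del0.
apply: (step x' y dx' dy).
  by rewrite /csub !subrr (_ : (0, 0)%R = origin)// cabs0 addr0.
by rewrite lteD2rE.
Qed.

(** On each product cell [dreal] is within [a] of its value at the centres, and the cell masses
    total 1 because a coupling has no mass off [DD]. *)
Lemma cells_integral (pi : probability (P * P)%type R) (a : R) : couplings mu nu pi ->
  om = a%:E ->
  [/\ forall i j, pi (Xi i `*` Ups j) \is a fin_num,
   \int[pi]_x dR mu nu r x.1 x.2 <=
     (\sum_i \sum_j dreal (z i, w j) * fine (pi (Xi i `*` Ups j)) + a)%R%:E &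
   (\sum_i \sum_j dreal (z i, w j) * fine (pi (Xi i `*` Ups j)) - a)%R%:E <=
     \int[pi]_x dR mu nu r x.1 x.2].
Proof.
move=> cpi omE; have [XU [Xd _]] := vX; have [UU [Ud _]] := vU.
have a0 : (0 <= a)%R by rewrite -lee_fin -omE om_ge0.
have mXU i j : measurable (Xi i `*` Ups j) by exact: measurableX.
have fin i j : pi (Xi i `*` Ups j) \is a fin_num by exact: fin_num_measure.
rewrite integral_dR//; pose A (ij : 'I_n * 'I_q) := Xi ij.1 `*` Ups ij.2.
have mA ij : measurable (A ij) by exact: mXU.
have AE : \bigcup_ij A ij = DD.
  apply/seteqP; split.
    move=> [x y] [[i j] _ [/= Xx Uy]]; split; first by rewrite -XU; exists i.
    by rewrite -UU; exists j.
  move=> [x y] [/= dx dy]; have := dx; rewrite -XU => -[i _ Xx].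
  have := dy; rewrite -UU => -[j _ Uy].
  by exists (i, j).
have Adis ij kl : ij != kl -> A ij `&` A kl = set0.
  case: ij kl => [i j] [i' j'] ne; apply/seteqP; split => -[x y] //= [[/= h1 h2] [/= h3 h4]].
  have [ii|ii] := eqVneq i i'.
    have jj : j != j' by apply: contraNN ne => /eqP ->; rewrite ii.
    by have := Ud _ _ jj; rewrite -subset0 => /(_ y); apply.
  by have := Xd _ _ ii; rewrite -subset0 => /(_ x); apply.
have mdr := measurable_dreal.
have mAdr ij : measurable_fun (A ij) (fun x => (dreal x)%:E).
  apply/measurable_EFinP; apply: (measurable_funS measurable_DD) mdr.
  by rewrite -AE; exact: bigcup_sup.
have piA1 : (\sum_i \sum_j fine (pi (Xi i `*` Ups j)) = 1)%R.
  rewrite pair_big /=; apply: EFin_inj; rewrite -sumEFin.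
  under eq_bigr do rewrite fineK//.
  transitivity (\int[pi]_(x in DD) 1).
    rewrite (@ge0_integral_partition _ _ _ _ _ A)//; apply: eq_bigr => ij _.
    by rewrite integral_cst// mul1e.
  rewrite integral_cst ?mul1e; last exact: measurable_DD.
  have := probability_setT pi; rewrite -(setUv DD) => <-.
  rewrite measureU0//; [exact: measurable_DD|by apply: measurableC; exact: measurable_DD|exact: coupling_DDC].
rewrite (@ge0_integral_partition _ _ _ _ _ A)//; last 2 first.
- exact/measurable_EFinP.
- by move=> x _; rewrite lee_fin dreal_ge0.
have near ij x : A ij x -> (`|dreal x - dreal (z ij.1, w ij.2)| <= a)%R.
  by case: x => x y [Xx Uy]; rewrite -lee_fin -omE; exact: cell_modcont.
split => //.
- have -> : (\sum_i \sum_j dreal (z i, w j) * fine (pi (Xi i `*` Ups j)) + a =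
      \sum_i \sum_j (dreal (z i, w j) + a) * fine (pi (Xi i `*` Ups j)))%R.
    rewrite -[in LHS](mulr1 a) -piA1 mulr_sumr -big_split /=; apply: eq_bigr => i _.
    by rewrite mulr_sumr -big_split /=; apply: eq_bigr => j _; rewrite mulrDl.
  rewrite pair_big /= -sumEFin; apply: lee_sum => -[i j] _ /=.
  have E : \int[pi]_(x in Xi i `*` Ups j) (cst (dreal (z i, w j) + a)%R%:E x) =
      (dreal (z i, w j) + a)%R%:E * pi (Xi i `*` Ups j) by exact: integral_cst.
  rewrite EFinM fineK// -E; apply: ge0_le_integral.
  - exact: mXU.
  - by move=> x _; rewrite lee_fin dreal_ge0.
  - exact: (mAdr (i, j)).
  - exact: measurable_cst.
  - move=> x Ax; rewrite lee_fin; have := near (i, j) x Ax; rewrite ler_norml => /andP[_].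
    by rewrite /= lerBlDl.
- have -> : (\sum_i \sum_j dreal (z i, w j) * fine (pi (Xi i `*` Ups j)) - a =
      \sum_i \sum_j (dreal (z i, w j) * fine (pi (Xi i `*` Ups j)) - a * fine (pi (Xi i `*` Ups j))))%R.
    rewrite -[in LHS](mulr1 a) -piA1 mulr_sumr -sumrB; apply: eq_bigr => i _.
    by rewrite mulr_sumr -sumrB.
  rewrite pair_big /= -sumEFin; apply: lee_sum => -[i j] _ /=.
  (* With [a] moved to the other side every integrand is nonnegative. *)
  rewrite EFinB leeBlDr// !EFinM !(fineK (fin i j)).
  have E1 : \int[pi]_(x in Xi i `*` Ups j) (cst (dreal (z i, w j))%:E x) =
      (dreal (z i, w j))%:E * pi (Xi i `*` Ups j) by exact: integral_cst.
  have E2 : \int[pi]_(x in Xi i `*` Ups j) (cst a%:E x) =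
      a%:E * pi (Xi i `*` Ups j) by exact: integral_cst.
  have E3 : \int[pi]_(x in Xi i `*` Ups j) ((dreal x)%:E + cst a%:E x) =
      \int[pi]_(x in Xi i `*` Ups j) (dreal x)%:E + \int[pi]_(x in Xi i `*` Ups j) (cst a%:E x).
    apply: ge0_integralD.
    - exact: mXU.
    - by move=> x _; rewrite lee_fin dreal_ge0.
    - exact: (mAdr (i, j)).
    - by move=> x _; rewrite lee_fin.
    - exact: measurable_cst.
  rewrite -E1 -E2 -E3; apply: ge0_le_integral.
  - exact: mXU.
  - by move=> x _; rewrite lee_fin dreal_ge0.
  - exact: measurable_cst.
  - by apply: emeasurable_funD; [exact: (mAdr (i, j))|exact: measurable_cst].
  - move=> x Ax; rewrite /cst -EFinD lee_fin; have := near (i, j) x Ax.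
    by rewrite ler_norml /= lerBrDr addrC -lerBrDr opprK => /andP[].
Qed.

(** The marginal of a coupling is tested on strips over the whole plane, whereas the cells only fill
    the part of the strip inside [DD]; the difference is null. *)
Lemma cell_feasible (pi : probability (P * P)%type R) : couplings mu nu pi ->
  lp_feasible (fun i => fine (hint (Xi i) mu)) (fun j => fine (hint (Ups j) nu))
    (fun i j => fine (pi (Xi i `*` Ups j))).
Proof.
move=> cpi; have [XU [Xd _]] := vX; have [UU [Ud _]] := vU; have [p1 p2] := cpi.
have XD i : Xi i `<=` @disk R by move=> x Xx; rewrite -XU; exists i.
have UD j : Ups j `<=` @disk R by move=> x Ux; rewrite -UU; exists j.
have mXU i j : measurable (Xi i `*` Ups j) by exact: measurableX.
have fin i j : pi (Xi i `*` Ups j) \is a fin_num by exact: fin_num_measure.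
have mD := @measurable_disk R.
have N0 : pi (~` DD) = 0 by exact: coupling_DDC.
have mN : measurable (~` DD) by apply: measurableC; exact: measurable_DD.
have ext (B C : set (P * P)) : measurable B -> measurable C -> C `<=` B ->
    B `<=` C `|` ~` DD -> pi B = pi C.
  move=> mB mC CB BC; apply/eqP; rewrite eq_le; apply/andP; split.
    rewrite -(measureU0 mC mN N0); apply: le_measure; rewrite ?inE//.
    exact: measurableU.
  by apply: le_measure; rewrite ?inE.
split; first by move=> i j; exact: fine_ge0.
split.
- move=> j; apply: EFin_inj; rewrite -sumEFin; under eq_bigr do rewrite fineK//.
  have mUj : measurable ([set: P] `*` Ups j) by exact: measurableX.
  have -> : hint (Ups j) nu = pi (setT `*` Ups j) by rewrite p2// (setIidl (@UD j)).
  rewrite fineK; last exact: fin_num_measure.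
  rewrite -(@measure_partition _ _ _ pi _ (fun i => Xi i `*` Ups j))//; last first.
    move=> i i' ii; apply/seteqP; split => -[x y] //= [[/= h1 _] [/= h3 _]].
    by have := Xd _ _ ii; rewrite -subset0 => /(_ x); apply.
  apply/esym; apply: ext => //.
  + by apply: fin_bigcup_measurable => // i _; exact: mXU.
  + by move=> [x y] [i _ [_ Uy]].
  + move=> [x y] [_ /= Uy]; case: (pselect (disk x)) => dx.
      by left; move: dx; rewrite -XU => -[i _ Xx]; exists i.
    by right => -[].
- move=> i; apply: EFin_inj; rewrite -sumEFin; under eq_bigr do rewrite fineK//.
  have mXi : measurable (Xi i `*` [set: P]) by exact: measurableX.
  have -> : hint (Xi i) mu = pi (Xi i `*` setT) by rewrite p1// (setIidl (@XD i)).
  rewrite fineK; last exact: fin_num_measure.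
  rewrite -(@measure_partition _ _ _ pi _ (fun j => Xi i `*` Ups j))//; last first.
    move=> j j' jj; apply/seteqP; split => -[x y] //= [[/= _ h1] [/= _ h3]].
    by have := Ud _ _ jj; rewrite -subset0 => /(_ y); apply.
  apply/esym; apply: ext => //.
  + by apply: fin_bigcup_measurable => // j _; exact: mXU.
  + by move=> [x y] [j _ [Xx _]].
  + move=> [x y] [/= Xx _]; case: (pselect (disk y)) => dy.
      by left; move: dy; rewrite -UU => -[j _ Uy]; exists j.
    by right => -[].
Qed.

End Cells.
End Couplings.

(** * The coupling attached to a feasible matrix *)

Section HyperbolicProbability.
Local Open Scope ereal_scope.
Context {R : realType}.
Notation P := (R * R)%type.
Variables (f : P -> R) (mf : measurable_fun (@disk R) f).
Variables (f0 : forall x, disk x -> (0 <= f x)%R) (f1 : hint (@disk R) f = 1%:E).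

(** Intersecting with the disk makes this a measure on the whole plane although [f] is controlled
    only on the disk. As with [densm], the proofs are arguments so that the term determines its
    structure. *)
Definition hprob of measurable_fun (@disk R) f & (forall x, disk x -> (0 <= f x)%R)
    & hint (@disk R) f = 1%:E :=
  fun A : set P => hint (A `&` @disk R) f.

Local Notation hp := (hprob mf f0 f1).

Let hp0 : hp set0 = 0. Proof. by rewrite /hprob set0I; exact: integral_set0. Qed.

Let hp_ge0 A : 0 <= hp A.
Proof. by apply: hint_ge0 => x [_ dx]; exact: f0. Qed.

Let hp_sigma_additive : semi_sigma_additive hp.
Proof.
move=> /= F mF tF mUF; rewrite /hprob; apply: cvg_toP.
  apply: ereal_nondecreasing_is_cvgn => k n kn.
  by apply: lee_sum_nneg_natr => // i _ _; exact: hp_ge0.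
rewrite setI_bigcupl /hint ge0_integral_bigcup//.
- by move=> k; apply: measurableI; [exact: mF|exact: measurable_disk].
- apply: measurable_hintE; apply: (measurable_funS measurable_disk) mf.
  by move=> x [k _ []].
- by move=> x [k _ [_ dx]]; rewrite lee_fin mulr_ge0 ?hden_ge0// f0.
- exact: trivIset_setIr.
Qed.

HB.instance Definition _ := isMeasure.Build _ _ _ hp hp0 hp_ge0 hp_sigma_additive.

Let hpT : hp setT = 1%E. Proof. by rewrite /hprob setTI f1. Qed.

HB.instance Definition _ := @Measure_isProbability.Build _ _ R hp hpT.

End HyperbolicProbability.

Section DensityProbability.
Local Open Scope ereal_scope.
Context d (T : measurableType d) (R : realType) (m : {measure set T -> \bar R}).
Variables (g : T -> R) (g0 : forall x, (0 <= g x)%R) (mg : measurable_fun setT g).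
Variable g1 : densm m g0 mg setT = 1%:E.

(** A separate name for [densm] that carries the proof of total mass 1, so that the probability
    structure can be attached to it. *)
Definition densp of densm m g0 mg setT = 1%:E := densm m g0 mg.

HB.instance Definition _ := Measure.copy (densp g1) (densm m g0 mg).
HB.instance Definition _ := @Measure_isProbability.Build _ _ R (densp g1) g1.

End DensityProbability.

Section CouplingOfMatrix.
Context {R : realType}.
Notation P := (R * R)%type.
Variables (mu nu : P -> R).
Hypothesis mmu : measurable_fun (@disk R) mu.
Hypothesis mnu : measurable_fun (@disk R) nu.
Hypothesis mu0 : forall x, disk x -> 0 <= mu x.
Hypothesis nu0 : forall x, disk x -> 0 <= nu x.
Hypothesis mu_prob : hint (@disk R) mu = 1%:E.
Hypothesis nu_prob : hint (@disk R) nu = 1%:E.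
Variables (n q : nat) (Xi : 'I_n -> set P) (Ups : 'I_q -> set P) (ps : 'I_n -> 'I_q -> R).
Hypothesis mX : forall i, measurable (Xi i).
Hypothesis mU : forall j, measurable (Ups j).
Hypothesis XU : \bigcup_i Xi i = @disk R.
Hypothesis UU : \bigcup_j Ups j = @disk R.
Hypothesis Xd : forall i j, i != j -> Xi i `&` Xi j = set0.
Hypothesis Ud : forall i j, i != j -> Ups i `&` Ups j = set0.
Hypothesis feas : lp_feasible (fun i => fine (hint (Xi i) mu)) (fun j => fine (hint (Ups j) nu)) ps.

Local Notation mm := (hprob mmu mu0 mu_prob).
Local Notation nn := (hprob mnu nu0 nu_prob).
Local Notation a := (fun i => fine (hint (Xi i) mu)).
Local Notation b := (fun j => fine (hint (Ups j) nu)).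

(** The density is relative to the product of the two marginals. On a cell of zero mass the quotient
    is 0 by convention, consistently with feasibility, which forces the matrix entry to vanish there
    ([ps_a0], [ps_b0]). *)
Definition cellg (x : P * P) : R :=
  \sum_i \sum_j (ps i j / (a i * b j)) * \1_(Xi i `*` Ups j) x.

Let a0 i : 0 <= a i.
Proof. by apply: fine_ge0; apply: hint_ge0 => x Xx; apply: mu0; rewrite -XU; exists i. Qed.
Let b0 j : 0 <= b j.
Proof. by apply: fine_ge0; apply: hint_ge0 => x Xx; apply: nu0; rewrite -UU; exists j. Qed.
Let c0 i j : 0 <= ps i j / (a i * b j).
Proof. by case: feas => h _; rewrite divr_ge0 ?mulr_ge0 ?a0 ?b0. Qed.

Lemma cellg_ge0 x : 0 <= cellg x.
Proof.
by apply: sumr_ge0 => i _; apply: sumr_ge0 => j _; apply: mulr_ge0; [exact: c0|rewrite indicE].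
Qed.

Let mXU i j : measurable (Xi i `*` Ups j). Proof. exact: measurableX. Qed.

Lemma measurable_cellg : measurable_fun setT cellg.
Proof.
apply: measurable_sum => i; apply: measurable_sum => j.
by apply: measurable_funM => //; exact: measurable_indic.
Qed.

Local Open Scope ereal_scope.

Lemma mmE i (A : set P) : measurable A -> mm (A `&` Xi i) = hint (A `&` Xi i) mu.
Proof.
move=> mA; rewrite /hprob -setIA (setIidl (B := @disk R))// => x Xx.
by rewrite -XU; exists i.
Qed.

Lemma nnE j (A : set P) : measurable A -> nn (A `&` Ups j) = hint (A `&` Ups j) nu.
Proof.
move=> mA; rewrite /hprob -setIA (setIidl (B := @disk R))// => x Xx.
by rewrite -UU; exists j.
Qed.

Lemma aE i : mm (Xi i) = (a i)%:E.
Proof.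
rewrite -[Xi i]setTI mmE// setTI fineK//.
by rewrite -[Xi i]setTI -mmE//; apply: fin_num_measure; rewrite setTI.
Qed.

Lemma bE j : nn (Ups j) = (b j)%:E.
Proof.
rewrite -[Ups j]setTI nnE// setTI fineK//.
by rewrite -[Ups j]setTI -nnE//; apply: fin_num_measure; rewrite setTI.
Qed.

Local Notation gm := (densm (mm \x nn) cellg_ge0 measurable_cellg).

Lemma gmE (A B : set P) : measurable A -> measurable B -> gm (A `*` B) =
  \sum_i \sum_j (ps i j / (a i * b j))%:E * (mm (A `&` Xi i) * nn (B `&` Ups j)).
Proof.
move=> mA mB; have mAB : measurable (A `*` B) by exact: measurableX.
have mterm i j : measurable_fun (A `*` B)
    (fun x => ((ps i j / (a i * b j)) * \1_(Xi i `*` Ups j) x)%:E).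
  by apply/measurable_EFinP; apply: measurable_funM => //; exact: measurable_indic.
have term0 i j x : 0 <= ((ps i j / (a i * b j)) * \1_(Xi i `*` Ups j) x)%:E.
  by rewrite lee_fin; apply: mulr_ge0; [exact: c0|rewrite indicE].
rewrite /densm /cellg; under eq_integral do rewrite -sumEFin.
under eq_integral do under eq_bigr do rewrite -sumEFin.
rewrite ge0_integral_sum//; last 2 first.
- by move=> i; apply: emeasurable_sum => j; exact: mterm.
- by move=> i x _; exact: sume_ge0.
apply: eq_bigr => i _; rewrite ge0_integral_sum//; apply: eq_bigr => j _.
under eq_integral do rewrite EFinM.
rewrite ge0_integralZl//; try (by apply/measurable_EFinP; exact: measurable_indic);
  try (by move=> x _; rewrite lee_fin indicE); try (by rewrite lee_fin; exact: c0).
rewrite integral_indic//; congr (_ * _).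
transitivity ((mm \x nn) ((A `&` Xi i) `*` (B `&` Ups j))).
  by congr (product_measure1 _ _ _); apply/seteqP; split => -[x y] /= [[? ?] [? ?]].
by apply: product_measure1E; exact: measurableI.
Qed.

Lemma sum_mm (A : set P) : measurable A -> \sum_i mm (A `&` Xi i) = mm A.
Proof.
move=> mA; rewrite -(@measure_partition _ _ _ mm _ (fun i => A `&` Xi i)).
- by rewrite -setI_bigcupr XU -[LHS]/(hint (A `&` @disk R `&` @disk R) mu) -setIA setIid.
- by move=> i; exact: measurableI.
- by move=> i j /Xd h; rewrite setIACA h setI0.
Qed.

Lemma sum_nn (A : set P) : measurable A -> \sum_j nn (A `&` Ups j) = nn A.
Proof.
move=> mA; rewrite -(@measure_partition _ _ _ nn _ (fun j => A `&` Ups j)).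
- by rewrite -setI_bigcupr UU -[LHS]/(hint (A `&` @disk R `&` @disk R) nu) -setIA setIid.
- by move=> j; exact: measurableI.
- by move=> i j /Ud h; rewrite setIACA h setI0.
Qed.

Let ps_a0 i j : a i = 0%R -> ps i j = 0%R.
Proof.
case: feas => p0 [_ sa] ai; have := sa i; rewrite ai => /eqP.
by rewrite psumr_eq0// => /allP /(_ j); rewrite mem_index_enum => /(_ isT) /eqP.
Qed.

Let ps_b0 i j : b j = 0%R -> ps i j = 0%R.
Proof.
case: feas => p0 [sb _] bj; have := sb j; rewrite bj => /eqP.
by rewrite psumr_eq0// => /allP /(_ i); rewrite mem_index_enum => /(_ isT) /eqP.
Qed.

Let fin_mm (A : set P) : measurable A -> mm A \is a fin_num.
Proof. by move=> mA; exact: fin_num_measure. Qed.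
Let fin_nn (A : set P) : measurable A -> nn A \is a fin_num.
Proof. by move=> mA; exact: fin_num_measure. Qed.

(** Over the whole second factor the cell $\Upsilon_j$ contributes its mass, which cancels $b_j$;
    the remaining sum of row [i] is $a_i$ and cancels the other denominator. *)
Lemma gm_left (A : set P) : measurable A -> gm (A `*` setT) = hint (A `&` @disk R) mu.
Proof.
move=> mA; rewrite gmE// -[RHS]/(mm A) -sum_mm//; apply: eq_bigr => i _.
have mAX : measurable (A `&` Xi i) by exact: measurableI.
under eq_bigr do rewrite setTI bE -(fineK (fin_mm mAX)) -!EFinM.
rewrite sumEFin -[RHS](fineK (fin_mm mAX)); congr EFin.
(* If $a_i=0$ the subset [A] meets $\Xi_i$ in zero mass as well, and both sides vanish. *)
have [ai|ai] := eqVneq (a i) 0%R.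
  have -> : fine (mm (A `&` Xi i)) = 0%R.
    apply/eqP; rewrite eq_le fine_ge0// andbT -ai -lee_fin fineK ?fin_mm// -aE.
    by apply: le_measure; rewrite ?inE// => x [].
  by rewrite big1// => j _; rewrite mul0r mulr0.
have [_ [_ sa]] := feas.
transitivity (\sum_j ps i j * (fine (mm (A `&` Xi i)) / a i))%R; last first.
  by rewrite -mulr_suml sa mulrC divfK.
apply: eq_bigr => j _; have [bj|bj] := eqVneq (b j) 0%R.
  by rewrite (ps_b0 i bj) !mul0r.
by field; rewrite ai bj.
Qed.

Lemma gm_right (B : set P) : measurable B -> gm (setT `*` B) = hint (B `&` @disk R) nu.
Proof.
move=> mB; rewrite gmE// -[RHS]/(nn B) -sum_nn// exchange_big /=; apply: eq_bigr => j _.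
have mBU : measurable (B `&` Ups j) by exact: measurableI.
under eq_bigr do rewrite setTI aE -(fineK (fin_nn mBU)) -!EFinM.
rewrite sumEFin -[RHS](fineK (fin_nn mBU)); congr EFin.
have [bj|bj] := eqVneq (b j) 0%R.
  have -> : fine (nn (B `&` Ups j)) = 0%R.
    apply/eqP; rewrite eq_le fine_ge0// andbT -bj -lee_fin fineK ?fin_nn// -bE.
    by apply: le_measure; rewrite ?inE// => x [].
  by rewrite big1// => i _; rewrite !mulr0.
have [_ [sb _]] := feas.
transitivity (\sum_i ps i j * (fine (nn (B `&` Ups j)) / b j))%R; last first.
  by rewrite -mulr_suml sb mulrC divfK.
apply: eq_bigr => i _; have [ai|ai] := eqVneq (a i) 0%R.
  by rewrite (ps_a0 j ai) !mul0r.
by field; rewrite ai bj.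
Qed.

Lemma gm_cell i j : gm (Xi i `*` Ups j) = (ps i j)%:E.
Proof.
rewrite gmE// (bigD1 i)//= [X in _ + X]big1 ?adde0; last first.
  move=> i' ii; rewrite big1// => j' _.
  by rewrite Xd 1?eq_sym// measure0 mul0e mule0.
rewrite (bigD1 j)//= [X in _ + X]big1 ?adde0; last first.
  move=> j' jj; by rewrite (Ud (i := j)) 1?eq_sym// measure0 !mule0.
rewrite !setIid aE bE -!EFinM; congr EFin.
have [ai|ai] := eqVneq (a i) 0%R; first by rewrite (ps_a0 j ai) !mul0r.
have [bj|bj] := eqVneq (b j) 0%R; first by rewrite (ps_b0 i bj) !mul0r.
by rewrite divfK// mulf_neq0.
Qed.

Lemma coupling_of_matrix : exists2 pi : probability (P * P)%type R, couplings mu nu pi &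
  forall i j, pi (Xi i `*` Ups j) = (ps i j)%:E.
Proof.
have g1 : gm setT = 1%:E by rewrite -setXTT gm_left// setTI.
exists (densp g1); last exact: gm_cell.
by split => A mA; [exact: gm_left|exact: gm_right].
Qed.

End CouplingOfMatrix.

(** * Assembly of the estimate *)

Section Assembly.
Context {R : realType}.

Lemma lp_total (n q : nat) (a : 'I_n -> R) (b : 'I_q -> R) ps : lp_feasible a b ps ->
  \sum_i \sum_j ps i j = \sum_i a i.
Proof. by move=> [_ [_ sa]]; apply: eq_bigr => i _; rewrite sa. Qed.

Lemma lp_cost_dist (n q : nat) (c d ps : 'I_n -> 'I_q -> R) (E : R) :
  (forall i j, 0 <= ps i j) -> \sum_i \sum_j ps i j = 1 ->
  (forall i j, `|c i j - d i j| <= E) ->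
  `|\sum_i \sum_j c i j * ps i j - \sum_i \sum_j d i j * ps i j| <= E.
Proof.
move=> p0 p1 h; rewrite !pair_big /= -sumrB.
apply: le_trans (ler_norm_sum _ _ _) _.
rewrite -[leRHS]mulr1 -p1 pair_big /= mulr_sumr; apply: ler_sum => -[i j] _ /=.
by rewrite -mulrBl normrM (ger0_norm (p0 i j)) ler_wpM2r.
Qed.

Lemma hint_cells_total (n : nat) (Xi : 'I_n -> set (R * R)) (mu : R * R -> R) :
  measurable_fun (@disk R) mu -> (forall x, disk x -> 0 <= mu x) ->
  (forall i, measurable (Xi i)) -> (forall i j, i != j -> Xi i `&` Xi j = set0) ->
  \bigcup_i Xi i = @disk R -> hint (@disk R) mu = 1%:E ->
  \sum_i fine (hint (Xi i) mu) = 1.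
Proof.
move=> mmu mu0 mX Xd XU mu1; apply: EFin_inj; rewrite -sumEFin -mu1.
have XD i : Xi i `<=` @disk R by move=> x Xx; rewrite -XU; exists i.
have g0 x : disk x -> (0 <= (mu x * hden x)%:E)%E.
  by move=> dx; rewrite lee_fin mulr_ge0 ?hden_ge0// mu0.
rewrite [RHS](@ge0_integral_partition _ _ _ leb2 _ Xi)//; last exact: measurable_hintE.
apply: eq_bigr => i _; rewrite fineK// ge0_fin_numE; last first.
  by apply: hint_ge0 => x /XD; exact: mu0.
apply: (@le_lt_trans _ _ (hint (@disk R) mu)); last by rewrite mu1 ltry.
apply: ge0_subset_integral.
- exact: mX.
- exact: measurable_disk.
- exact: measurable_hintE.
- exact: g0.
- exact: XD.
Qed.

End Assembly.

Theorem theorem1p1 (R : realType) (mu nu : R * R -> R)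
  (* mu, nu : Lipschitz continuous (on D), positive probability densities
     with respect to the hyperbolic area measure *)
  (mu_lip : exists k : R, forall x y, disk x -> disk y ->
       `|mu x - mu y| <= k * cabs (csub x y))
  (nu_lip : exists k : R, forall x y, disk x -> disk y ->
       `|nu x - nu y| <= k * cabs (csub x y))
  (mu_pos : forall x, disk x -> 0 < mu x)
  (nu_pos : forall x, disk x -> 0 < nu x)
  (mu_prob : hint disk mu = 1%:E)
  (nu_prob : hint disk nu = 1%:E)
  (r : R) (r_pos : 0 < r) :
  exists C1 C2 : R, 0 < C1 /\ 0 < C2 /\
  forall (n : nat) (z : 'I_n -> R * R) (q : nat) (w : 'I_q -> R * R)
         (Xi : 'I_n -> set (R * R)) (Ups : 'I_q -> set (R * R))
         (K : nat) (p : 'I_K -> R * R) (L : nat)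
         (ai : 'I_n -> R * R) (ti : 'I_n -> R)
         (bj : 'I_q -> R * R) (sj : 'I_q -> R)
         (pistar : 'I_n -> 'I_q -> R),
    (* sample sets Z, W in D *)
    injective z -> (forall i, disk (z i)) ->
    injective w -> (forall j, disk (w j)) ->
    (* Voronoi cells of Z (w.r.t. d_g) and of W (w.r.t. d_h) *)
    voronoi mu z Xi -> (forall i, measurable (Xi i)) ->
    voronoi nu w Ups -> (forall j, measurable (Ups j)) ->
    (* quadrature centers in Omega_{0,R} *)
    injective p -> (forall k, Omega0 r (p k)) ->
    (1 <= L)%N ->
    (* fixed Mobius maps tilde m_i = mob (ai i) (ti i), tilde m_i (0) = z_i *)
    (forall i, disk (ai i) /\ 0 <= ti i < 2 * pi /\ mob (ai i) (ti i) origin = z i) ->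
    (forall j, disk (bj j) /\ 0 <= sj j < 2 * pi /\ mob (bj j) (sj j) origin = w j) ->
    (* pistar : a minimizer of the linear program T_{dhh}(mu_Z, nu_W) *)
    lp_minimizer
      (fun i j => dhh mu nu r p L (ai i) (ti i) (bj j) (sj j))
      (fun i => fine (hint (Xi i) mu))
      (fun j => fine (hint (Ups j) nu))
      pistar ->
    (`| dRMN mu nu r
        - (\sum_(i < n) \sum_(j < q)
             dhh mu nu r p L (ai i) (ti i) (bj j) (sj j) * pistar i j)%:E |
     <= modcont mu nu r (2%:E * maxe (fill mu (range z)) (fill nu (range w)))
        + C1%:E * fillE r (range p) + (C2 / L%:R)%:E)%E.

Proof.
have [k1 lip1] := mu_lip; have [k2 lip2] := nu_lip.
(* One positive Lipschitz constant for both densities; the given ones come without a sign. *)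
pose k := `|k1| + `|k2| + 1.
have k0 : 0 < k by rewrite /k ltr_wpDl// addr_ge0.
have mulip x y : disk x -> disk y -> `|mu x - mu y| <= k * cabs (csub x y).
  move=> dx dy; apply: le_trans (lip1 _ _ dx dy) _; rewrite ler_wpM2r ?cabs_ge0//.
  by apply: le_trans (ler_norm _) _; rewrite /k -addrA lerDl addr_ge0.
have nulip x y : disk x -> disk y -> `|nu x - nu y| <= k * cabs (csub x y).
  move=> dx dy; apply: le_trans (lip2 _ _ dx dy) _; rewrite ler_wpM2r ?cabs_ge0//.
  by have := ler_norm k2; have := normr_ge0 k1; rewrite /k; lra.
have mmu := lip_disk_measurable k0 mulip; have mnu := lip_disk_measurable k0 nulip.
have mu0 x (dx : disk x) : 0 <= mu x by exact/ltW/mu_pos.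
have nu0 x (dx : disk x) : 0 <= nu x by exact/ltW/nu_pos.
have C10 := C1c_ge0 r k0; have C20 := C2c_ge0 r k0.
(* Adding 1 makes the constants strictly positive, so that $C_1$ times an infinite fill distance is
   infinite. *)
exists (C1c k r + 1), (C2c k r + 1); split; first by rewrite ltr_wpDl.
split; first by rewrite ltr_wpDl.
move=> n z q w Xi Ups K p L ai ti bj sj pistar _ dz _ dw vX mX vU mU pinj pO L1 hai hbj [feas opt].
have om0 := om_ge0 r k0 mulip nulip mu_pos z w.
set om := modcont _ _ _ _ in om0 *.
have fe0 := fillE_gt0 p r_pos; set fe := fillE _ _ in fe0 *.
have [XU [Xd _]] := vX; have [UU [Ud _]] := vU.
(* Positivity excludes [-oo]; if the fill distance is [+oo], so is the right-hand side. *)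
case fE : fe fe0 => [phi| |] // fe0; last first.
  by rewrite gt0_muley ?lte_fin ?ltr_wpDl// addey ?addye ?leey// gt_eqF// (lt_le_trans _ om0) ?ltNy0.
case oE : om om0 => [m| |] // om0; last by rewrite addye ?addye ?leey.
pose E0 := C1c k r * phi + C2c k r / L%:R.
have dhhE i j : `|dhh mu nu r p L (ai i) (ti i) (bj j) (sj j) - dreal mu nu r (z i, w j)| <= E0.
  have [da [_ az]] := hai i; have [db [_ bw]] := hbj j.
  exact: (dhh_bound k0 r_pos mulip nulip).
set T := \sum_i \sum_j _.
have tot ps : lp_feasible (fun i => fine (hint (Xi i) mu)) (fun j => fine (hint (Ups j) nu)) ps ->
    \sum_i \sum_j ps i j = 1.
  by move=> /lp_total ->; exact: hint_cells_total.
have costE ps : lp_feasible (fun i => fine (hint (Xi i) mu)) (fun j => fine (hint (Ups j) nu)) ps ->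
    `|\sum_i \sum_j dhh mu nu r p L (ai i) (ti i) (bj j) (sj j) * ps i j -
      \sum_i \sum_j dreal mu nu r (z i, w j) * ps i j| <= E0.
  by move=> fps; apply: lp_cost_dist => //; [case: fps|exact: tot].
(* The cell masses of an arbitrary coupling compete with [pistar], so their discretized cost is at
   least [T]; passing to [dreal] loses [E0] and passing to the integral loses [m]. *)
have low : ((T - (m + E0))%:E <= dRMN mu nu r)%E.
  apply: le_ereal_inf_tmp => _ [pi cpi <-].
  have [_ _ h] := cells_integral k0 mulip nulip mu_pos nu_pos dz dw vX vU mX mU cpi oE.
  apply: le_trans h; rewrite lee_fin.
  have fpi := cell_feasible vX vU mX mU cpi.
  have := opt _ fpi; have := costE _ fpi; rewrite ler_norml => /andP[_]; rewrite -/T; lra.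
have up : (dRMN mu nu r <= (T + (m + E0))%:E)%E.
  have [pi cpi piE] := coupling_of_matrix mmu mnu mu0 nu0 mu_prob nu_prob mX mU XU UU Xd Ud feas.
  have [_ h _] := cells_integral k0 mulip nulip mu_pos nu_pos dz dw vX vU mX mU cpi oE.
  apply: (@le_trans _ _ (\int[pi]_x dR mu nu r x.1 x.2)%E).
    by apply: ereal_inf_lbound; exists pi.
  apply: le_trans h _; rewrite lee_fin.
  under eq_bigr do under eq_bigr do rewrite piE /=.
  have := costE _ feas; rewrite ler_norml => /andP[+ _]; rewrite -/T; lra.
have dfin : dRMN mu nu r \is a fin_num.
  by apply: fin_real; rewrite (lt_le_trans (ltNyr _) low) (le_lt_trans up (ltry _)).
case: (dRMN mu nu r) dfin low up => [d| |] // _ low up.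
rewrite !lee_fin in low up.
rewrite -EFinB abse_EFin -EFinM -!EFinD lee_fin.
have phi0 : 0 < phi by rewrite -lte_fin.
have L0 : 0 <= L%:R^-1 :> R by rewrite invr_ge0.
have : E0 <= (C1c k r + 1) * phi + (C2c k r + 1) / L%:R.
  by rewrite /E0 !mulrDl !mul1r; lra.
by rewrite ler_norml => hE; apply/andP; split; lra.
Qed.
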